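(* Let $M$ be a Frölicher space that is microlinear and Weil exponentiable. If $\xi_1\in[M\otimes\mathcal{W}_{D^p}\to M]\otimes\mathcal{W}_D$ is a tangent-vector-valued $p$-semiform on $M$ and $\xi_2\in[M\otimes\mathcal{W}_{D^q}\to M]\otimes\mathcal{W}_D$ is a tangent-vector-valued $q$-semiform on $M$, then, as operators on the graded space $\Omega(M)$ of differential forms on $M$, $$\mathcal{L}_{[\xi_1,\xi_2]_{FN}}=[\mathcal{L}_{\xi_1},\mathcal{L}_{\xi_2}]=\mathcal{L}_{\xi_1}\circ\mathcal{L}_{\xi_2}-(-1)^{pq}\mathcal{L}_{\xi_2}\circ\mathcal{L}_{\xi_1},$$ where $[\xi_1,\xi_2]_{FN}=\mathcal{A}_{p,q}([\xi_1,\xi_2]_L)$ and the middle term is the graded commutator, defined by the right-hand side.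
   Context: Frölicher spaces and Weil prolongations. $\mathbf{FS}$ is the cartesian closed category of Frölicher spaces and smooth maps; $[X\to Y]=Y^X$ is the Frölicher space of smooth maps. A Weil algebra is a finite-dimensional commutative unital local $\mathbb{R}$-algebra with residue field $\mathbb{R}$. The Weil prolongation $X\otimes W$ of a Frölicher space $X$ by $W=C^\infty(\mathbb{R}^n)/I$ is the set of classes of smooth maps $f:\mathbb{R}^n\to X$, where $f\sim g$ iff $f(0)=g(0)$ and $h\circ f-h\circ g\in I$ for all smooth $h:X\to\mathbb{R}$, with the initial Frölicher structure for the induced maps $X\otimes W\to\mathbb{R}\otimes W=W$; this is a bifunctor and $\cdot\otimes W$ preserves products. Weil algebras are named by ''infinitesimal objects'': $D=\{d: d^2=0\}$, $D^n$, $D(2)=\{(d_1,d_2)\in D^2: d_1d_2=0\}$, $D^2\oplus D=\{(d_1,d_2,e)\in D^3: d_1e=d_2e=0\}$, with $\mathcal{W}_{D^n}=\mathbb{R}[X_1,\dots,X_n]/(X_1^2,\dots,X_n^2)$ ($\mathcal W_{D^0}=\mathbb R$), $\mathcal{W}_{D(2)}=\mathbb{R}[X,Y]/(X^2,Y^2,XY)$, $\mathcal{W}_{D^2\oplus D}=\mathbb{R}[X,Y,Z]/(X^2,Y^2,Z^2,XZ,YZ)$. A polynomial map $f:E\to E'$ of these objects induces contravariantly $\mathcal{W}_f:\mathcal{W}_{E'}\to\mathcal{W}_E$, hence $\mathrm{id}_X\otimes\mathcal{W}_f:X\otimes\mathcal{W}_{E'}\to X\otimes\mathcal{W}_E$ (pullback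 along $f$). $\otimes_\infty$ is the tensor product of Weil algebras; $\mathcal{W}_{D^{m+n}}=\mathcal{W}_{D^m}\otimes_\infty\mathcal{W}_{D^n}$. $X$ is microlinear if every finite limit diagram $\mathbb{D}$ of Weil algebras yields a limit diagram $X\otimes\mathbb{D}$ in $\mathbf{FS}$. $X$ is Weil exponentiable if $(X\otimes(W_1\otimes_\infty W_2))^Y=(X\otimes W_1)^Y\otimes W_2$ naturally for all Frölicher spaces $Y$ and Weil algebras $W_1,W_2$. Such spaces form a cartesian closed category. $\pi:X\otimes W\to X$ is the canonical projection. For $X$ microlinear, tangent vectors $t_1,t_2\in X\otimes\mathcal{W}_D$ with the same foot point $\pi(t_1)=\pi(t_2)$ are added as follows: there is a unique $\gamma\in X\otimes\mathcal{W}_{D(2)}$ with pullbacks $t_1,t_2$ along $d\mapsto(d,0)$, $d\mapsto(0,d)$, and $t_1+t_2$ is its pullback along $d\mapsto(d,d)$; $\alpha t$ is the pullback of $t$ along $d\mapsto\alpha d$. Strong difference. Let $X$ be microlinear and $\gamma_1,\gamma_2\in X\otimes\mathcal{W}_{D^2}$ have the same pullback along the inclusion $D(2)\to D^2$. Let $\varphi(d_1,d_2)=(d_1,d_2,0)$, $\psi(d_1,d_2)=(d_1,d_2,d_1d_2)$ be maps $D^2\to D^2\oplus D$. There is a unique $\gamma\in X\otimes\mathcal{W}_{D^2\oplus D}$ with $(\mathrm{id}_X\otimes\mathcal{W}_\psi)(\gamma)=\gamma_1$, $(\mathrm{id}_X\otimes\mathcal{W}_\varphi)(\gamma)=\gamma_2$;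 define $\gamma_1\overset{\cdot}{-}\gamma_2\in X\otimes\mathcal{W}_D$ as the pullback of $\gamma$ along $d\mapsto(0,0,d)$. Icons and semiforms. $\delta_M^p:M\otimes\mathcal{W}_{D^p}\to M$ is the canonical projection. A $(1,p)$-icon on $M$ is an element $\xi\in[M\otimes\mathcal{W}_{D^p}\to M]\otimes\mathcal{W}_D$ with foot point $\pi(\xi)=\delta_M^p$. For $\gamma\in M\otimes\mathcal{W}_{D^p}$, $\alpha\in\mathbb{R}$, $1\le i\le p$, let $\alpha\underset{i}{\cdot}\gamma$ be the pullback of $\gamma$ along $(d_1,\dots,d_p)\mapsto(d_1,\dots,\alpha d_i,\dots,d_p)$; for $\sigma\in\mathbb{S}_p$ let $\gamma^\sigma$ be the pullback along $(d_1,\dots,d_p)\mapsto(d_{\sigma(1)},\dots,d_{\sigma(p)})$. For a map $\eta$ on $M\otimes\mathcal{W}_{D^p}$ with values in $M$ or $\mathbb{R}$ let $\eta^\sigma(\gamma)=\eta(\gamma^\sigma)$, and for $\xi\in[M\otimes\mathcal{W}_{D^p}\to M]\otimes\mathcal{W}_D$ let $\xi^\sigma$ be the image of $\xi$ under $((\ )^\sigma)\otimes\mathrm{id}_{\mathcal{W}_D}$. A tangent-vector-valued $p$-semiform on $M$ is a $(1,p)$-icon $\xi$ with $(((\alpha\underset{i}{\cdot})^* )\otimes\mathrm{id}_{\mathcal{W}_D})(\xi)=\alpha\xi$ for all $\alpha,i$ (where $(\alpha\underset{i}{\cdot})^*$ is precomposition with $\gamma\mapsto\alpha\underset{i}{\cdot}\gamma$).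 A differential $n$-form on $M$ is $\theta\in[M\otimes\mathcal{W}_{D^n}\to\mathbb{R}]$ with $\theta(\alpha\underset{i}{\cdot}\gamma)=\alpha\theta(\gamma)$ for all $\alpha,i,\gamma$ and $\theta(\gamma^\sigma)=\varepsilon_\sigma\theta(\gamma)$ for all $\sigma\in\mathbb{S}_n$, $\varepsilon_\sigma$ being the sign; $\Omega^n(M)$ is the space of these and $\Omega(M)$ is the graded space of all differential forms. Lie bracket. For $\eta_1\in[M\otimes\mathcal{W}_{D^p}\to M]$, $\eta_2\in[M\otimes\mathcal{W}_{D^q}\to M]$: $\eta_1*\eta_2\in[M\otimes\mathcal{W}_{D^{p+q}}\to M]$ is $M\otimes\mathcal{W}_{D^{p+q}}=M\otimes(\mathcal{W}_{D^q}\otimes_\infty\mathcal{W}_{D^p})=(M\otimes\mathcal{W}_{D^q})\otimes\mathcal{W}_{D^p}\xrightarrow{\eta_2\otimes\mathrm{id}}M\otimes\mathcal{W}_{D^p}\xrightarrow{\eta_1}M$ (the first $p$ coordinates of $D^{p+q}$ being the $\mathcal{W}_{D^p}$ factor, the last $q$ the $\mathcal{W}_{D^q}$ factor), and $\eta_1\widetilde{*}\eta_2$ is $M\otimes\mathcal{W}_{D^{p+q}}=(M\otimes\mathcal{W}_{D^p})\otimes\mathcal{W}_{D^q}\xrightarrow{\eta_1\otimes\mathrm{id}}M\otimes\mathcal{W}_{D^q}\xrightarrow{\eta_2}M$. For a $(1,p)$-icon $\xi_1$ and a $(1,q)$-icon $\xi_2$, let $\xi_1\circledast\xi_2$ and $\xi_1\widetilde{\circledast}\xi_2$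 in $[M\otimes\mathcal{W}_{D^{p+q}}\to M]\otimes\mathcal{W}_{D^2}$ be obtained by pulling $\xi_1$ back along $(d_1,d_2)\mapsto d_1$, $\xi_2$ along $(d_1,d_2)\mapsto d_2$, and applying $*\otimes\mathrm{id}_{\mathcal{W}_{D^2}}$, resp. $\widetilde{*}\otimes\mathrm{id}_{\mathcal{W}_{D^2}}$. These agree on $D(2)$, and $[\xi_1,\xi_2]_L=\xi_1\widetilde{\circledast}\xi_2\overset{\cdot}{-}\xi_1\circledast\xi_2$, a $(1,p+q)$-icon. For a $(1,n)$-icon $\xi$ (resp. $\theta\in[M\otimes\mathcal{W}_{D^n}\to\mathbb{R}]$), $\mathcal{A}\xi=\sum_{\sigma\in\mathbb{S}_n}\varepsilon_\sigma\xi^\sigma$ (resp. $\mathcal{A}\theta=\sum_\sigma\varepsilon_\sigma\theta^\sigma$), and for $n=p+q$, $\mathcal{A}_{p,q}=\frac{1}{p!q!}\mathcal{A}$. Lie derivation. For $\eta\in[M\otimes\mathcal{W}_{D^p}\to M]$ and $\theta\in[M\otimes\mathcal{W}_{D^q}\to\mathbb{R}]$, $\eta\widetilde{*}\theta\in[M\otimes\mathcal{W}_{D^{p+q}}\to\mathbb{R}]$ is $M\otimes\mathcal{W}_{D^{p+q}}=(M\otimes\mathcal{W}_{D^p})\otimes\mathcal{W}_{D^q}\xrightarrow{\eta\otimes\mathrm{id}}M\otimes\mathcal{W}_{D^q}\xrightarrow{\theta}\mathbb{R}$. For $\xi\in[M\otimes\mathcal{W}_{D^p}\to M]\otimes\mathcal{W}_D$,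 $\xi\widetilde{\circledast}\theta\in[M\otimes\mathcal{W}_{D^{p+q}}\to\mathbb{R}]\otimes\mathcal{W}_D$ is the image of $\xi$ under $(\eta\mapsto\eta\widetilde{*}\theta)\otimes\mathrm{id}_{\mathcal{W}_D}$. The vector space $\mathbb{E}=[M\otimes\mathcal{W}_{D^{p+q}}\to\mathbb{R}]$ is Euclidean, i.e. $(\mathbf{a},\mathbf{b})\mapsto$ class of $(x\mapsto\mathbf{a}+x\mathbf{b})$ is a bijection $\mathbb{E}\times\mathbb{E}\to\mathbb{E}\otimes\mathcal{W}_D$, and $\mathbf{D}:\mathbb{E}\otimes\mathcal{W}_D\to\mathbb{E}$ sends that class to $\mathbf{b}$. Put $\widehat{\mathcal{L}}_\xi\theta=\mathbf{D}(\xi\widetilde{\circledast}\theta)$ and $\mathcal{L}_\xi\theta=\mathcal{A}_{p,q}(\widehat{\mathcal{L}}_\xi\theta)$. *)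

(* Defs.v *)
Set Warnings "-notation-overridden,-ambiguous-paths,-notation-incompatible-prefix".
From HB Require Import structures.
From mathcomp Require Import all_boot all_order all_algebra perm.
From mathcomp Require Import boolp classical_sets functions reals.
From mathcomp Require Import topology normedtype derive.

Set Implicit Arguments.
Unset Strict Implicit.
Unset Printing Implicit Defensive.
Import Order.TTheory GRing.Theory Num.Theory.
Import numFieldNormedType.Exports.
Local Open Scope classical_set_scope.
Local Open Scope ring_scope.
Local Open Scope quotient_scope.

Definition smoothR (R : realType) (f : R -> R) : Prop :=
  forall n x, derivable (derive1n n f) x 1.

Section SmoothR.
Variable R : realType.
Implicit Types f g : R -> R.

Fixpoint diffn n f : Prop :=
  if n is n'.+1 then (forall x, derivable f x 1) /\ diffn n' (derive1 f)
  else True.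

Lemma smoothRP f : smoothR f <-> forall n, diffn n f.
Proof.
split=> [sf n|df n].
  elim: n f sf => [//|n IHn] f sf; split; first exact: (sf 0%N).
  by apply: IHn => m x; move: (sf m.+1 x); rewrite /derive1n iterSr.
elim: n f df => [|n IHn] f df x; first by have [] := df 1%N.
rewrite /derive1n iterSr; apply: IHn => m; by have [] := df m.+1.
Qed.

Lemma diffnS n f : diffn n.+1 f -> diffn n f.
Proof. by elim: n f => [//|n IHn] f [df /IHn]. Qed.

Lemma diffn_cst n (a : R) : diffn n (cst a).
Proof.
elim: n a => [//|n IHn] a; split=> [x|]; first exact: derivable_cst.
have -> : derive1 (cst a : R -> R) = cst 0; last exact: IHn.
by apply/funext => x; rewrite derive1_cst.
Qed.

Lemma diffnD n f g : diffn n f -> diffn n g -> diffn n (fun x => f x + g x).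
Proof.
elim: n f g => [//|n IHn] f g [df sf] [dg sg]; split=> [x|].
  exact: derivableD.
have -> : derive1 (fun x => f x + g x) = (fun x => derive1 f x + derive1 g x).
  by apply/funext => x; rewrite !derive1E -deriveD.
exact: IHn.
Qed.

Lemma diffnM n f g : diffn n f -> diffn n g -> diffn n (fun x => f x * g x).
Proof.
elim: n f g => [//|n IHn] f g sf sg.
have [df sf'] := sf; have [dg sg'] := sg; split=> [x|].
  exact: derivableM.
have -> : derive1 (fun x => f x * g x) =
    (fun x => f x * derive1 g x + g x * derive1 f x).
  by apply/funext => x; rewrite !derive1E -[LHS]/('D_1 (f * g) x) deriveM.
by apply: diffnD; apply: IHn => //; exact: diffnS.
Qed.

Lemma smoothR_cst (a : R) : smoothR (fun=> a).
Proof. by apply/smoothRP => n; exact: diffn_cst. Qed.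

Lemma smoothRD f g :
  smoothR f -> smoothR g -> smoothR (fun x => f x + g x).
Proof.
by move=> /smoothRP sf /smoothRP sg; apply/smoothRP => n; exact: diffnD.
Qed.

Lemma smoothRM f g :
  smoothR f -> smoothR g -> smoothR (fun x => f x * g x).
Proof.
by move=> /smoothRP sf /smoothRP sg; apply/smoothRP => n; exact: diffnM.
Qed.

End SmoothR.

Arguments smoothR_cst {R} a.
Arguments smoothRD {R} f g.
Arguments smoothRM {R} f g.

Record frolicher (R : realType) := Frolicher {
  fcarrier :> Type;
  fcurve : set (R -> fcarrier);
  ffun : set (fcarrier -> R);
  fcurveP : forall c, fcurve c <-> forall f, ffun f -> smoothR (f \o c);
  ffunP : forall f, ffun f <-> forall c, fcurve c -> smoothR (f \o c) }.

Section Frolicher.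
Variable R : realType.

Section Generated.
Variable T : Type.

Definition curves_of (F : set (T -> R)) : set (R -> T) :=
  [set c : R -> T | forall f, F f -> smoothR (f \o c)].

Definition funs_of (C : set (R -> T)) : set (T -> R) :=
  [set f : T -> R | forall c, C c -> smoothR (f \o c)].

Fact gen_by_funs_subproof F c :
  curves_of F c <-> forall f, funs_of (curves_of F) f -> smoothR (f \o c).
Proof.
split=> [Cc f|Cc f Ff]; first exact.
by apply: Cc => c' Cc'; exact: Cc'.
Qed.

Fact gen_by_curves_subproof C f :
  funs_of C f <-> forall c, curves_of (funs_of C) c -> smoothR (f \o c).
Proof.
split=> [Ff c|Ff c Cc]; first exact.
by apply: Ff => f' Ff'; exact: Ff'.
Qed.

Definition gen_by_funs (F : set (T -> R)) : frolicher R :=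
  Frolicher (@gen_by_funs_subproof F) (fun=> iff_refl _).

Definition gen_by_curves (C : set (R -> T)) : frolicher R :=
  Frolicher (fun=> iff_refl _) (@gen_by_curves_subproof C).

End Generated.

Definition fline : frolicher R := gen_by_funs [set (id : R -> R)].

(* By Boman's theorem the smooth functions on feuclid n are the C^oo functions
   on R^n in the usual sense. *)
Definition feuclid (n : nat) : frolicher R :=
  gen_by_funs [set k : 'rV[R]_n -> R | exists i, k = (fun x => x 0 i)].

Definition fprod (X Y : frolicher R) : frolicher R :=
  gen_by_funs [set k : X * Y -> R |
    (exists2 f, ffun f & k = f \o fst) \/ (exists2 g, ffun g & k = g \o snd)].

Definition is_smooth (X Y : frolicher R) (f : X -> Y) : Prop :=
  forall c : R -> X, fcurve c -> fcurve (f \o c).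

Record smap (X Y : frolicher R) := SMap {
  smap_fun :> X -> Y;
  smapP : is_smooth smap_fun }.

Lemma smap_eq X Y (f g : smap X Y) : (f : X -> Y) = g -> f = g.
Proof.
case: f g => f sf [g sg] /= fg; rewrite -{}fg in sg *.
by congr SMap; exact: Prop_irrelevance.
Qed.

Lemma cst_smooth (X Y : frolicher R) (y : Y) : is_smooth (fun _ : X => y).
Proof. move=> c _; apply: (iffRL (fcurveP _)) => f _.
exact: (smoothR_cst (f y)). Qed.

Lemma comp_smooth (X Y Z : frolicher R) (g : Y -> Z) (f : X -> Y) :
  is_smooth g -> is_smooth f -> is_smooth (g \o f).
Proof. by move=> sg sf c cc; apply: (sg (f \o c)); exact: sf. Qed.

Lemma nonsmooth_inhabited (X Y : frolicher R) (f : X -> Y) :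
  ~ is_smooth f -> exists x : X, True.
Proof.
by move=> nsf; apply: contrapT => nx; apply: nsf => c _; case: nx; exists (c 0).
Qed.

(* The smooth map with underlying function f (see mk_smapE). The constant
   returned for a function f that is not smooth is a default that plays no
   role: all the functions to which mk_smap and cls are applied below are
   smooth (when the space is microlinear and Weil exponentiable). *)
Definition mk_smap (X Y : frolicher R) (f : X -> Y) : smap X Y :=
  match pselect (is_smooth f) with
  | left sf => SMap sf
  | right nsf => SMap (@cst_smooth X Y (f (sval (cid (nonsmooth_inhabited nsf)))))
  end.

Lemma mk_smapE (X Y : frolicher R) (f : X -> Y) :
  is_smooth f -> mk_smap f = f :> (X -> Y).
Proof. by rewrite /mk_smap => sf; case: pselect. Qed.

(* The curves of the function space are the maps with smooth adjoint; these
   are already saturated (cartesian closedness), so that generating a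
   structure by them adds no other curve. *)
Definition fexp (X Y : frolicher R) : frolicher R :=
  gen_by_curves [set c : R -> smap X Y |
    is_smooth (fun sx : fprod fline X => (c sx.1 sx.2 : Y))].

(* C^oo(X) *)
Definition Csm (X : frolicher R) := smap X fline.

HB.instance Definition _ X := gen_eqMixin (Csm X).
HB.instance Definition _ X := gen_choiceMixin (Csm X).

Section CsmAlgebra.
Variable X : frolicher R.
Implicit Types (f g h : Csm X) (a b : R).

Lemma fline_smoothP (f : X -> fline) :
  is_smooth f <-> forall c : R -> X, fcurve c -> smoothR (f \o c : R -> R).
Proof.
split=> sf c cc; first exact: (sf c cc id).
by move=> _ ->; exact: sf.
Qed.

Fact Csm_add_subproof f g : is_smooth (fun x => (f x : R) + g x : fline).
Proof.
apply/fline_smoothP => c cc; apply: smoothRD.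
  exact: (fline_smoothP f).1 (smapP f) c cc.
exact: (fline_smoothP g).1 (smapP g) c cc.
Qed.

Fact Csm_mul_subproof f g : is_smooth (fun x => (f x : R) * g x : fline).
Proof.
apply/fline_smoothP => c cc; apply: smoothRM.
  exact: (fline_smoothP f).1 (smapP f) c cc.
exact: (fline_smoothP g).1 (smapP g) c cc.
Qed.

Fact Csm_scale_subproof a f : is_smooth (fun x => a * (f x : R) : fline).
Proof.
apply/fline_smoothP => c cc; apply: smoothRM; first exact: smoothR_cst.
exact: (fline_smoothP f).1 (smapP f) c cc.
Qed.

Arguments Csm_add_subproof f g : clear implicits.
Arguments Csm_mul_subproof f g : clear implicits.
Arguments Csm_scale_subproof a f : clear implicits.

Definition Csm_cst a : Csm X := SMap (@cst_smooth X fline a).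
Definition Csm_add f g : Csm X := SMap (Csm_add_subproof f g).
Definition Csm_mul f g : Csm X := SMap (Csm_mul_subproof f g).
Definition Csm_scale a f : Csm X := SMap (Csm_scale_subproof a f).

Local Ltac pw := repeat intro; apply: smap_eq; apply/funext => ? /=.

Fact Csm_addA : associative Csm_add.
Proof. by pw; rewrite addrA. Qed.
Fact Csm_addC : commutative Csm_add.
Proof. by pw; rewrite addrC. Qed.
Fact Csm_add0 : left_id (Csm_cst 0) Csm_add.
Proof. by pw; rewrite add0r. Qed.
Fact Csm_addN : left_inverse (Csm_cst 0) (Csm_scale (-1)) Csm_add.
Proof. by pw; rewrite mulN1r addNr. Qed.

HB.instance Definition _ :=
  GRing.isZmodule.Build (Csm X) Csm_addA Csm_addC Csm_add0 Csm_addN.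

Fact Csm_mulA : associative Csm_mul.
Proof. by pw; rewrite mulrA. Qed.
Fact Csm_mulC : commutative Csm_mul.
Proof. by pw; rewrite mulrC. Qed.
Fact Csm_mul1 : left_id (Csm_cst 1) Csm_mul.
Proof. by pw; rewrite mul1r. Qed.
Fact Csm_mulDl : left_distributive Csm_mul Csm_add.
Proof. by pw; rewrite mulrDl. Qed.

HB.instance Definition _ :=
  GRing.Zmodule_isComPzRing.Build (Csm X) Csm_mulA Csm_mulC Csm_mul1 Csm_mulDl.

Fact Csm_scaleA a b f : Csm_scale a (Csm_scale b f) = Csm_scale (a * b) f.
Proof. by pw; rewrite mulrA. Qed.
Fact Csm_scale1 : left_id 1 Csm_scale.
Proof. by pw; rewrite mul1r. Qed.
Fact Csm_scaleDr : right_distributive Csm_scale +%R.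
Proof. by pw; rewrite mulrDr. Qed.
Fact Csm_scaleDl f : {morph Csm_scale^~ f : a b / a + b}.
Proof. by pw; rewrite mulrDl. Qed.

HB.instance Definition _ := GRing.Zmodule_isLmodule.Build R (Csm X)
  Csm_scaleA Csm_scale1 Csm_scaleDr Csm_scaleDl.

End CsmAlgebra.

Definition Csm_comp (X Y : frolicher R) (h : Csm Y) (f : smap X Y) : Csm X :=
  SMap (comp_smooth (smapP h) (smapP f)).

Definition is_ideal (X : frolicher R) (I : set (Csm X)) : Prop :=
  [/\ I 0, forall f g, I f -> I g -> I (f + g) & forall f g, I g -> I (f * g)].

Definition ideal_gen (X : frolicher R) (G : set (Csm X)) : set (Csm X) :=
  [set f | forall J, is_ideal J -> G `<=` J -> J f].

Lemma ideal_gen_ideal (X : frolicher R) (G : set (Csm X)) :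
  is_ideal (ideal_gen G).
Proof.
split=> [J []//|f g If Ig J iJ GJ|f g Ig J iJ GJ].
  by have [_ + _] := iJ; apply; [exact: If|exact: Ig].
by have [_ _] := iJ; apply; exact: Ig.
Qed.

(* A presentation (n, I) of the algebra C^oo(R^n)/I. *)
Record pres := Pres {
  pdim : nat;
  pideal : set (Csm (feuclid pdim));
  pidealP : is_ideal pideal }.

Arguments pideal : clear implicits.

Definition pres_gen n (G : set (Csm (feuclid n))) : pres :=
  Pres (ideal_gen_ideal G).

(* C^oo(R^n)/I is a Weil algebra whose residue map to R is evaluation at 0. *)
Definition is_weil (W : pres) : Prop :=
  [/\ (forall f, pideal W f -> f 0 = 0),
      (forall f : Csm (feuclid (pdim W)), f 0 <> 0 ->
         exists g, pideal W (f * g - 1))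
    & exists k (e : 'I_k -> Csm (feuclid (pdim W))),
        forall f, exists a : 'I_k -> R,
          pideal W (f - \sum_(i < k) a i *: e i)].

Section Quotient.
Variable W : pres.

Definition walg_rel (f g : Csm (feuclid (pdim W))) : bool :=
  `[< pideal W (f - g) >].

Fact walg_rel_equiv : equiv_class_of walg_rel.
Proof.
have [I0 ID IM] := pidealP W.
split=> [f|f g|g f h].
- by apply/asboolP; rewrite subrr.
- by apply/asboolP/asboolP => /(IM (-1)); rewrite mulN1r opprB.
- by move=> /asboolP fg /asboolP gh; apply/asboolP; rewrite -(subrKA g); exact: ID.
Qed.

Canonical walg_equiv := EquivRelPack walg_rel_equiv.

Definition walg := {eq_quot walg_equiv}.

(* The standard structure of a finite dimensional vector space. *)
Definition fwalg : frolicher R :=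
  gen_by_funs [set l : walg -> R |
    forall a (f g : Csm (feuclid (pdim W))),
      l (\pi_walg (a *: f + g)) = a * l (\pi_walg f) + l (\pi_walg g)].

End Quotient.

Section Prolongation.
Variables (X : frolicher R) (W : pres).

Definition prol_rel (f g : {classic smap (feuclid (pdim W)) X}) : bool :=
  `[< f 0 = g 0 /\
      forall h : Csm X, pideal W (Csm_comp h f - Csm_comp h g) >].

Fact prol_rel_equiv : equiv_class_of prol_rel.
Proof.
have [I0 ID IM] := pidealP W.
split=> [f|f g|g f h].
- by apply/asboolP; split=> // h; rewrite subrr.
- by apply/asboolP/asboolP => -[-> fg]; split=> // h;
    rewrite -opprB -mulN1r; exact: IM.
- move=> /asboolP[fg0 fg] /asboolP[gh0 gh]; apply/asboolP; split.
    by rewrite fg0.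
  by move=> k; rewrite -(subrKA (Csm_comp k g)); exact: ID.
Qed.

Canonical prol_equiv := EquivRelPack prol_rel_equiv.

Definition prol_carrier := {eq_quot prol_equiv}.

(* h ⊗ id_W : X ⊗ W -> R ⊗ W = W *)
Definition prol_fun (h : Csm X) (u : prol_carrier) : fwalg W :=
  \pi_(walg W) (Csm_comp h (repr u)).

Definition prol : frolicher R :=
  gen_by_funs [set k : prol_carrier -> R |
    exists h (l : fwalg W -> R), ffun l /\ k = l \o prol_fun h].

(* The class of f : R^n -> X. *)
Definition cls (f : 'rV[R]_(pdim W) -> X) : prol :=
  \pi_prol_carrier (mk_smap (f : feuclid (pdim W) -> X)).

Definition rep (u : prol) : smap (feuclid (pdim W)) X := repr (u : prol_carrier).

Definition foot (u : prol) : X := rep u 0.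

End Prolongation.

End Frolicher.

Arguments pideal {R} p _ : rename.
Arguments cls {R X} W f.
Notation "X ⊗ W" := (prol X W) (at level 40, left associativity).

(* Only used for sets P with exactly one element; d is returned when P is
   empty. *)
Definition the (T : Type) (d : T) (P : set T) : T := xget (d : {classic T}) P.

Definition vec (R : realType) (s : seq R) : 'rV[R]_(size s) :=
  \row_(i < size s) s`_i.

Section Weil.
Variable R : realType.
Implicit Types (X Y Z : frolicher R) (V W : pres R).

(* id_X ⊗ W_phi for a map phi inducing an algebra homomorphism *)
Definition pull X V W (phi : 'rV[R]_(pdim W) -> 'rV[R]_(pdim V))
  (u : X ⊗ V) : X ⊗ W := cls W (rep u \o phi).
Arguments pull {X} V W phi u.

(* F ⊗ id_W *)
Definition fmap X Y W (F : X -> Y) (u : X ⊗ W) : Y ⊗ W := cls W (F \o rep u).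

Definition pairing X Y W (u : X ⊗ W) (v : Y ⊗ W) : fprod X Y ⊗ W :=
  cls W (fun x => (rep u x, rep v x) : fprod X Y).

Definition tensor V W : pres R := pres_gen
  [set k : Csm (feuclid R (pdim V + pdim W)) |
    (exists2 f, pideal V f & forall x, k x = f (lsubmx x)) \/
    (exists2 g, pideal W g & forall x, k x = g (rsubmx x))].

(* The identifications X ⊗ (V ⊗ W) = (X ⊗ V) ⊗ W and X ⊗ (V ⊗ W) = (X ⊗ W) ⊗ V
   on the class of f : R^(m+n) -> X; the coordinates of V come first. *)
Definition curry_last X V W (f : 'rV[R]_(pdim V + pdim W) -> X) : X ⊗ V ⊗ W :=
  cls W (fun y => cls V (fun x => f (row_mx x y))).

Definition curry_first X V W (f : 'rV[R]_(pdim V + pdim W) -> X) : X ⊗ W ⊗ V :=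
  cls V (fun x => cls W (fun y => f (row_mx x y))).

(* (X ⊗ (V ⊗ W))^Y = (X ⊗ V)^Y ⊗ W. Naturality is expressed by compatibility
   with the evaluations at the points of Y and with the canonical map
   X ⊗ (V ⊗ W) -> (X ⊗ V) ⊗ W. *)
Definition weil_exponentiable X : Prop :=
  forall V W, is_weil V -> is_weil W -> forall Y,
  exists (F : smap (fexp Y (X ⊗ tensor V W)) (fexp Y (X ⊗ V) ⊗ W))
         (G : smap (fexp Y (X ⊗ V) ⊗ W) (fexp Y (X ⊗ tensor V W))),
  [/\ cancel F G, cancel G F &
   forall (g : fexp Y (X ⊗ tensor V W)) (y : Y)
          (f : smap (feuclid R (pdim V + pdim W)) X),
     g y = cls (tensor V W) f ->
     fmap (fun k : fexp Y (X ⊗ V) => k y) (F g) = curry_last f].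

(* A homomorphism C^oo(R^n)/I -> C^oo(R^m)/J, given by a smooth map R^m -> R^n
   which induces it (every homomorphism of Weil algebras is of this form). *)
Record whom V W := WHom {
  whom_map :> smap (feuclid R (pdim W)) (feuclid R (pdim V));
  whom_map0 : whom_map 0 = 0;
  whomP : forall f, pideal V f -> pideal W (Csm_comp f whom_map) }.

Definition walg_map V W (phi : whom V W) (a : walg V) : walg W :=
  \pi_(walg W) (Csm_comp (repr a) phi).

(* Cones over finite diagrams; as usual the shape of a diagram is a graph. *)
Record wcone := WCone {
  cvertex : finType;
  cedge : finType;
  csrc : cedge -> cvertex;
  ctgt : cedge -> cvertex;
  cobj : cvertex -> pres R;
  carr : forall e, whom (cobj (csrc e)) (cobj (ctgt e));
  capex : pres R;
  cproj : forall v, whom capex (cobj v);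
  cobj_weil : forall v, is_weil (cobj v);
  capex_weil : is_weil capex;
  cproj_carr : forall e a,
    walg_map (carr e) (walg_map (cproj (csrc e)) a) =
    walg_map (cproj (ctgt e)) a }.

Arguments cobj : clear implicits.
Arguments carr : clear implicits.
Arguments cproj : clear implicits.

(* Limits are taken among R-algebras, where they are the algebras of
   compatible families (not among Weil algebras, where for instance R would
   be terminal). *)
Definition is_alg_limit (D : wcone) : Prop :=
  forall a : (forall v, walg (cobj D v)),
    (forall e, walg_map (carr D e) (a (csrc e)) = a (ctgt e)) ->
    exists! b : walg (capex D), forall v, walg_map (cproj D v) b = a v.

Definition is_prol_limit X (D : wcone) : Prop :=
  forall Y (g : forall v, smap Y (X ⊗ cobj D v)),
    (forall e y, pull _ _ (carr D e) (g (csrc e) y) = g (ctgt e) y) ->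
    exists! h : smap Y (X ⊗ capex D),
      forall v y, pull _ _ (cproj D v) (h y) = g v y.

Definition microlinear X : Prop :=
  forall D : wcone, is_alg_limit D -> is_prol_limit X D.

(* The algebras of D^p, D(2) and D^2 (+) D *)
Definition Dn (p : nat) : pres R := pres_gen
  [set k : Csm (feuclid R p) |
    exists i, forall x : 'rV[R]_p, k x = x 0 i ^+ 2].

Definition D2 : pres R := pres_gen
  [set k : Csm (feuclid R 2) |
    (exists i, forall x : 'rV[R]_2, k x = x 0 i ^+ 2) \/
    (forall x : 'rV[R]_2, k x = x 0 0 * x 0 1)].

Definition D2plusD : pres R := pres_gen
  [set k : Csm (feuclid R 3) |
    [\/ exists i, forall x : 'rV[R]_3, k x = x 0 i ^+ 2,
        forall x : 'rV[R]_3, k x = x 0 0 * x 0 2 |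
        forall x : 'rV[R]_3, k x = x 0 1 * x 0 2]].

Definition tadd X (t1 t2 : X ⊗ Dn 1) : X ⊗ Dn 1 :=
  pull D2 (Dn 1) (fun d => vec [:: d 0 0; d 0 0])
    (the (pull (Dn 1) D2 (fun d => vec [:: d 0 0]) t1)
      [set g : X ⊗ D2 |
        pull D2 (Dn 1) (fun d => vec [:: d 0 0; 0]) g = t1 /\
        pull D2 (Dn 1) (fun d => vec [:: 0; d 0 0]) g = t2]).

Definition tscale X (a : R) (t : X ⊗ Dn 1) : X ⊗ Dn 1 :=
  pull (Dn 1) (Dn 1) (fun d => a *: d) t.

Definition strong_diff X (g1 g2 : X ⊗ Dn 2) : X ⊗ Dn 1 :=
  pull D2plusD (Dn 1) (fun d => vec [:: 0; 0; d 0 0])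
    (the (pull (Dn 2) D2plusD (fun d => vec [:: d 0 0; d 0 1]) g1)
      [set g : X ⊗ D2plusD |
        pull D2plusD (Dn 2) (fun d => vec [:: d 0 0; d 0 1; d 0 0 * d 0 1]) g = g1 /\
        pull D2plusD (Dn 2) (fun d => vec [:: d 0 0; d 0 1; 0]) g = g2]).

(* [x |-> a + x b] |-> b for the Euclidean vector space [Z -> R] *)
Definition Dder Z (v : fexp Z (fline R) ⊗ Dn 1) : Csm Z :=
  the 0 [set b : Csm Z | exists a : Csm Z,
    v = cls (Dn 1) (fun x => a + x 0 0 *: b : fexp Z (fline R))].

Definition dil X p (a : R) (i : 'I_p) (g : X ⊗ Dn p) : X ⊗ Dn p :=
  pull (Dn p) (Dn p) (fun d => \row_j (if j == i then a * d 0 j else d 0 j)) g.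

Definition permute X p (s : 'S_p) (g : X ⊗ Dn p) : X ⊗ Dn p :=
  pull (Dn p) (Dn p) (fun d => \row_j d 0 (s j)) g.

Definition precomp X Y (a : X -> X) (eta : fexp X Y) : fexp X Y :=
  mk_smap (eta \o a).

Section Forms.
Variable M : frolicher R.

Definition is_form n (theta : Csm (M ⊗ Dn n)) : Prop :=
  (forall a i g, theta (dil a i g) = a * (theta g : R)) /\
  (forall s g, theta (permute s g) = (-1) ^+ (s : 'S_n) * (theta g : R)).

Definition delta p : fexp (M ⊗ Dn p) M := mk_smap (@foot R M (Dn p)).

Definition is_icon p (xi : fexp (M ⊗ Dn p) M ⊗ Dn 1) : Prop :=
  foot xi = delta p.

Definition is_semiform p (xi : fexp (M ⊗ Dn p) M ⊗ Dn 1) : Prop :=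
  is_icon xi /\ forall a i, fmap (precomp (dil a i)) xi = tscale a xi.

Definition alt_icon n (xi : fexp (M ⊗ Dn n) M ⊗ Dn 1) :
    fexp (M ⊗ Dn n) M ⊗ Dn 1 :=
  \big[@tadd _ / cls (Dn 1) (fun=> delta n)]_(s : 'S_n)
    tscale ((-1) ^+ s) (fmap (precomp (permute s)) xi).

Definition alt_icon_pq p q (xi : fexp (M ⊗ Dn (p + q)) M ⊗ Dn 1) :=
  tscale (p`!%:R * q`!%:R)^-1 (alt_icon xi).

Definition alt_fun n (theta : Csm (M ⊗ Dn n)) : Csm (M ⊗ Dn n) :=
  \sum_(s : 'S_n) (-1) ^+ s *: (precomp (permute s) theta : Csm _).

Definition alt_fun_pq p q (theta : Csm (M ⊗ Dn (p + q))) :=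
  (p`!%:R * q`!%:R)^-1 *: alt_fun theta.

Definition star p q (eta1 : fexp (M ⊗ Dn p) M) (eta2 : fexp (M ⊗ Dn q) M) :
    fexp (M ⊗ Dn (p + q)) M :=
  mk_smap (fun u : M ⊗ Dn (p + q) =>
    eta1 (fmap eta2 (curry_first (V := Dn p) (W := Dn q) (rep u)))).

Definition tstar p q Z (eta : fexp (M ⊗ Dn p) M) (zeta : fexp (M ⊗ Dn q) Z) :
    fexp (M ⊗ Dn (p + q)) Z :=
  mk_smap (fun u : M ⊗ Dn (p + q) =>
    zeta (fmap eta (curry_last (V := Dn p) (W := Dn q) (rep u)))).

Section Icons.
Variables (p q : nat).
Variables (xi1 : fexp (M ⊗ Dn p) M ⊗ Dn 1) (xi2 : fexp (M ⊗ Dn q) M ⊗ Dn 1).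

Let xi12 := pairing (pull (Dn 1) (Dn 2) (fun d => vec [:: d 0 0]) xi1)
                    (pull (Dn 1) (Dn 2) (fun d => vec [:: d 0 1]) xi2).

Definition ostar : fexp (M ⊗ Dn (p + q)) M ⊗ Dn 2 :=
  fmap (fun eta : fprod _ _ => star eta.1 eta.2) xi12.

Definition otstar : fexp (M ⊗ Dn (p + q)) M ⊗ Dn 2 :=
  fmap (fun eta : fprod _ _ => tstar eta.1 eta.2) xi12.

Definition Lbracket : fexp (M ⊗ Dn (p + q)) M ⊗ Dn 1 := strong_diff otstar ostar.

Definition FNbracket : fexp (M ⊗ Dn (p + q)) M ⊗ Dn 1 := alt_icon_pq Lbracket.

End Icons.

Definition operator (p : nat) :=
  forall r, Csm (M ⊗ Dn r) -> Csm (M ⊗ Dn (p + r)).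

Definition Lie_hat p (xi : fexp (M ⊗ Dn p) M ⊗ Dn 1) : operator p :=
  fun r theta => Dder (fmap (fun eta => tstar eta (theta : fexp _ (fline R))) xi).

Definition Lie p (xi : fexp (M ⊗ Dn p) M ⊗ Dn 1) : operator p :=
  fun r theta => alt_fun_pq (Lie_hat xi theta).

(* A o B - (-1)^(pq) B o A; the casts identify the degrees p + (q + r) and
   q + (p + r) with p + q + r. *)
Definition graded_comm p q (A : operator p) (B : operator q) :
    operator (p + q) := fun r theta =>
  ecast n (Csm (M ⊗ Dn n)) (addnA p q r) (A _ (B _ theta)) -
  (-1) ^+ (p * q) *:
  ecast n (Csm (M ⊗ Dn n)) (etrans (addnCA q p r) (addnA p q r)) (B _ (A _ theta)).

End Forms.
End Weil.

Arguments Dn {R} p.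

(* Main.v *)
From mathcomp Require Import all_boot all_order all_algebra perm.
From mathcomp Require Import boolp classical_sets functions reals.
From mathcomp Require Import topology normedtype sequences derive realfun exp.
From mathcomp Require Import ring lra zify.
Require Import Defs.

Set Implicit Arguments.
Unset Strict Implicit.
Unset Printing Implicit Defensive.
Import Order.TTheory GRing.Theory Num.Theory.
Import numFieldNormedType.Exports.
Local Open Scope ring_scope.
Local Open Scope classical_set_scope.

(** All the operations in the theorem are read off from real-valued test
    functions. For a test function [h] of a function space, [dcoef h t] is its
    derivative along the tangent vector [t] and [mixed_coef h g] its mixed
    derivative along an element [g] over [D^2]; sums and multiples of tangent
    vectors become sums and multiples of derivatives, and a strong difference
    becomes a difference of mixed derivatives ([dcoef_diagonal], [dcoef_scale],
    [dcoef_sd_axis]). At a point [u], [Lie_hat xi theta] is the derivative along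
    [xi] of the test function [eta |-> tstar eta theta u] ([Lie_hatE]). The
    operation [tstar] is associative ([tstarA]), and [star] is [tstar] with the
    two maps and the two blocks of coordinates exchanged ([starE]). Since mixed
    derivatives are symmetric, the Lie bracket of [xi1] and [xi2] acts on
    [theta] as the operator of [xi1] after that of [xi2], minus the operator of
    [xi2] after that of [xi1] followed by the permutation [tau] which exchanges
    the first [p] and the next [q] coordinates ([Lie_hat_Lbracket]).

    What remains is algebra in the group ring of the symmetric group. The
    alternations inside the Frölicher-Nijenhuis bracket and inside an iterated
    Lie derivation range over subgroups and are absorbed by the outermost
    alternation, up to factorials which are the same on both sides
    ([alt_Lie_hat_l], [alt_Lie_hat_r]); [tau] contributes its sign
    [(-1) ^ (p * q)] ([block_swap_perm]).

    The two hypotheses on [M] ensure that sums and strong differences exist in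
    the function space [M ^ Z]. As a union of infinitesimal objects, [D(2)]
    consists of two copies of [D] with a common point, and [D^2 + D] of two
    copies of [D^2] with a common [D(2)]: the corresponding diagrams of algebras
    are limits, and microlinearity glues families of elements of [M] along them
    ([glueD2], [glueD2plusD]). By Weil exponentiability families of elements lift
    to elements over [M ^ Z], which are determined by their values
    ([weil_lift_fexp], [weil_pointwise]). It also provides a smooth family of
    representatives of all the elements over [D^n] ([Dn_representatives]), so
    that [star] and [tstar] are smooth maps. To pass to classes smoothly one uses
    that an element over a Weil algebra depends on finitely many Taylor
    coefficients only, which depend smoothly on parameters ([cls_smooth]).

    The calculus behind this concerns functions that are smooth along all smooth
    curves, and is developed from the derivatives of functions of one variable.
    It has two main results. Hadamard's lemma with parameters
    ([hadamard_smooth]) rests on the smoothness of partial derivatives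
    ([bismooth_derive]) and on an integral defined by dyadic sums. Cartesian
    closedness ([fcurve_fexpP]), a theorem of Lawvere, Schanuel and Zame, says
    that a curve in a function space is smooth as a map of two variables as soon
    as its composites with all test functions are smooth. The test functions
    used are weighted sums of derivatives at bounded sequences of points, and a
    gliding hump argument turns their smoothness into uniform bounds for
    difference quotients ([gliding_hump], [weakly_smooth_diag]). *)

(** * Smooth functions of one real variable *)

Section SmoothClass.
Variable R : realType.
Implicit Types (f g : R -> R) (x : R).

Lemma smooth_derivable f x : smoothR f -> derivable f x 1.
Proof. by move/(_ 0%N x). Qed.

Lemma smooth_derive f : smoothR f -> smoothR (derive1 f).
Proof. by move=> sf n x; have := sf n.+1 x; rewrite derive1Sn. Qed.

Lemma smooth_deriven f n : smoothR f -> smoothR (derive1n n f).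
Proof.
move=> sf; elim: n => [|n IHn]; first by rewrite derive1n0.
by rewrite derive1nS; exact: smooth_derive.
Qed.

Lemma is_derive_derive1 f x (d : R) : is_derive x 1 f d -> (derive1 f) x = d.
Proof. by move=> df; rewrite derive1E; exact: derive_val. Qed.

Lemma smooth_is_derive f x : smoothR f -> is_derive x 1 f ((derive1 f) x).
Proof. by move=> sf; rewrite derive1E; apply/derivableP/smooth_derivable. Qed.

(** Smoothness is the largest class of differentiable functions which is
    closed under differentiation; the proofs that the functions built below are
    smooth exhibit such a class and do not compute higher derivatives. *)
Lemma smooth_coind (P : (R -> R) -> Prop) :
  (forall f, P f -> exists2 g, P g & forall x, is_derive x 1 f (g x)) ->
  forall f, P f -> smoothR f.
Proof.
move=> HP f Pf n; elim: n f Pf => [|n IHn] f Pf x.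
  by have [g _ /(_ x) []] := HP _ Pf.
have [g Pg dg] := HP _ Pf; rewrite derive1Sn.
suff -> : (derive1 f) = g by exact: IHn.
by apply/funext => y; exact: is_derive_derive1.
Qed.

Lemma smooth_id : smoothR (id : R -> R).
Proof.
apply/smoothRP => -[//|n]; split=> [x|]; first exact: derivable_id.
have -> : (derive1 (id : R -> R)) = cst 1 by apply/funext => x; rewrite derive1_id.
exact: diffn_cst.
Qed.

Lemma smooth_comp f g : smoothR f -> smoothR g -> smoothR (fun x => f (g x)).
Proof.
move=> /smoothRP sf /smoothRP sg; apply/smoothRP => n.
elim: n f sf => [//|n IHn] f sf; split=> [x|].
  have [df _] := sf 1%N; have [dg _] := sg 1%N.
  apply/derivable1_diffP/(@differentiable_comp _ _ _ _ g f);
  exact/derivable1_diffP.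
have -> : (derive1 (fun x => f (g x))) = (fun x => (derive1 f) (g x) * (derive1 g) x).
  apply/funext => x.
  have [df _] := sf 1%N; have [dg _] := sg 1%N.
  by rewrite -[LHS]/((derive1 (f \o g)) x) derive1_comp.
apply: diffnM; last by have [] := sg n.+1.
by apply: IHn => m; have [] := sf m.+1.
Qed.

End SmoothClass.

Opaque smoothR.
Arguments smooth_deriven {R} [f] n _.
Arguments smooth_is_derive {R} [f] x _.

Section OneVariable.
Variable R : realType.
Implicit Types (f g : R -> R) (x : R).

Lemma smooth_scale (a : R) f : smoothR f -> smoothR (fun x => a * f x).
Proof. by move=> sf; exact: (smoothRM _ _ (smoothR_cst a) sf). Qed.
Arguments smooth_scale a [f] _.

Lemma smooth_opp f : smoothR f -> smoothR (fun x => - f x).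
Proof.
move=> /(smooth_scale (-1)); congr smoothR.
by apply/funext => x; rewrite mulN1r.
Qed.

Lemma smooth_sub f g :
  smoothR f -> smoothR g -> smoothR (fun x => f x - g x).
Proof. by move=> sf /smooth_opp sg; exact: (smoothRD _ _ sf sg). Qed.

Lemma smooth_sum (I : Type) (r : seq I) (F : I -> R -> R) :
  (forall i, smoothR (F i)) -> smoothR (fun x => \sum_(i <- r) F i x).
Proof.
move=> sF; elim: r => [|i r IHr].
  by under [X in smoothR X]funext do rewrite big_nil; exact: smoothR_cst.
under [X in smoothR X]funext do rewrite big_cons.
exact: (smoothRD _ _ (sF i) IHr).
Qed.

Lemma smooth_exp f n : smoothR f -> smoothR (fun x => f x ^+ n).
Proof.
move=> sf; elim: n => [|n IHn]; first exact: smoothR_cst.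
by under [X in smoothR X]funext do rewrite exprS; exact: smoothRM.
Qed.

Lemma smooth_continuous f x : smoothR f -> {for x, continuous f}.
Proof.
by move=> sf; apply/differentiable_continuous/derivable1_diffP/smooth_derivable.
Qed.
Arguments smooth_continuous [f] x _.

Lemma smooth_locally_bounded f x : smoothR f ->
  exists2 e : R, 0 < e & exists C : R, forall y, `|y - x| < e -> `|f y| <= C.
Proof.
move=> sf; have /cvgrPdist_lt/(_ 1 ltr01) := smooth_continuous x sf.
move=> [e /= e0 He]; exists e => //; exists (1 + `|f x|) => y yx.
have := He y; rewrite /ball_ /= distrC => /(_ yx) H1.
rewrite -[f y](subrK (f x)); apply: (le_trans (ler_normD _ _)).
by rewrite lerD2r distrC ltW.
Qed.

Lemma deriven_affine f (a b : R) n : smoothR f ->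
  (derive1n n (fun x => f (a + b * x))) = (fun x => b ^+ n * (derive1n n f) (a + b * x)).
Proof.
elim: n f => [|n IHn] f sf; first by apply/funext => x; rewrite expr0 mul1r.
rewrite derive1nS IHn //; apply/funext => x.
have d1 : is_derive x 1 (fun x => a + b * x) b.
  have := is_deriveD (is_derive_cst a x 1) (is_deriveZ b (is_derive_id x 1)).
  by rewrite add0r /GRing.scale/= mulr1.
apply: is_derive_derive1.
have sfn := smooth_deriven n sf.
rewrite derive1nS exprS.
have -> : (fun x => b ^+ n * (derive1n n f) (a + b * x)) =
          (b ^+ n *: ((derive1n n f) \o (fun x => a + b * x)))%R by [].
have dn := @is_derive1_comp R _ (fun x => a + b * x) x _ _
  (smooth_is_derive (a + b * x) sfn) d1.
apply: (is_derive_eq (is_deriveZ (b ^+ n) dn)).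
by rewrite /GRing.scale/= [_ * b]mulrC mulrA [b ^+ n * b]mulrC.
Qed.

Lemma derivenD f g n : smoothR f -> smoothR g ->
  (derive1n n (fun x => f x + g x)) = (fun x => (derive1n n f) x + (derive1n n g) x).
Proof.
move=> sf sg; elim: n => [//|n IHn]; apply/funext => x.
rewrite !derive1nS IHn; apply: is_derive_derive1.
have d1 := smooth_is_derive x (smooth_deriven n sf).
have d2 := smooth_is_derive x (smooth_deriven n sg).
exact: is_deriveD.
Qed.

Lemma derivenZ f (a : R) n : smoothR f ->
  (derive1n n (fun x => a * f x)) = (fun x => a * (derive1n n f) x).
Proof.
move=> sf; elim: n => [//|n IHn]; apply/funext => x.
rewrite !derive1nS IHn; apply: is_derive_derive1.
have d1 := smooth_is_derive x (smooth_deriven n sf).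
exact: is_deriveZ.
Qed.

Lemma derivenB f g n : smoothR f -> smoothR g ->
  (derive1n n (fun x => f x - g x)) = (fun x => (derive1n n f) x - (derive1n n g) x).
Proof.
move=> sf sg; have sg' := smooth_scale (-1) sg.
have -> : (fun x => f x - g x) = (fun x => f x + -1 * g x).
  by apply/funext => x; rewrite mulN1r.
by rewrite derivenD// derivenZ//; apply/funext => x; rewrite mulN1r.
Qed.

Lemma deriven_near f g x n : (\forall y \near x, f y = g y) ->
  \forall y \near x, (derive1n n f) y = (derive1n n g) y.
Proof.
move=> fg; elim: n => [//|n IHn].
rewrite !derive1nS; near=> y; rewrite !derive1E; apply: near_eq_derive.
by near: y; apply: (near_join IHn).
Unshelve. all: by end_near. Qed.

Lemma mvt_le f (a b C : R) : smoothR f ->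
  (forall x, `|x - a| <= `|b - a| -> `|(derive1 f) x| <= C) ->
  `|f b - f a| <= C * `|b - a|.
Proof.
move=> sf.
have main (u v : R) : u <= v ->
    (forall x, u <= x <= v -> `|(derive1 f) x| <= C) -> `|f v - f u| <= C * `|v - u|.
  move=> uv HC.
  have [c /andP[c1 c2] ->] : exists2 c, u <= c <= v &
      f v - f u = (derive1 f) c * (v - u).
    have df x : x \in `]u, v[%R -> is_derive x 1 f (derive1 f x).
      by move=> _; exact: smooth_is_derive.
    have cf : {within `[u, v], continuous f}.
      by apply: derivable_within_continuous => x _; exact: smooth_derivable.
    by have [c] := MVT_segment uv df cf; rewrite in_itv/= => cuv ->; exists c.
  by rewrite normrM ler_wpM2r// HC// c1.
move=> HC; have [ab|/ltW ba] := leP a b.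
  apply: main => // x /andP[ax xb]; apply: HC.
  by rewrite !ger0_norm ?subr_ge0// lerD2r.
rewrite distrC [`|b - a|]distrC; apply: main => // x /andP[bx xa]; apply: HC.
by rewrite ![`|_ - a|]distrC !ger0_norm ?subr_ge0// lerD2l lerN2.
Qed.

Definition coef n f : R := (derive1n n f) 0 / n`!%:R.

Lemma coef_derive n f : coef n (derive1 f) = n.+1%:R * coef n.+1 f.
Proof.
rewrite /coef -derive1Sn factS natrM invfM mulrCA; congr (_ * _).
by rewrite mulrA mulfV ?mul1r// pnatr_eq0.
Qed.

Lemma taylor_le f n C r : smoothR f ->
  (forall x, `|x| <= r -> `|(derive1n n.+1 f) x| <= C) ->
  forall s, `|s| <= r ->
    `|f s - \sum_(j < n.+1) coef j f * s ^+ j| <= C * `|s| ^+ n.+1.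
Proof.
elim: n f => [|n IHn] f sf HC s sr.
  rewrite big_ord1 expr0 mulr1 /coef derive1n0 fact0 divr1 expr1.
  rewrite -{2}[s]subr0; apply: mvt_le => // x; rewrite !subr0 => xs.
  by apply: HC; exact: le_trans sr.
pose T (g : R -> R) m (s : R) := \sum_(j < m) coef j g * s ^+ j.
have dX j x : is_derive x 1 (fun s : R => s ^+ j) (j%:R * x ^+ j.-1).
  rewrite (_ : (fun s : R => s ^+ j) = (id : R -> R) ^+ j)%R; last by rewrite exprfctE.
  by apply: is_derive_eq; rewrite /GRing.scale/= mulr1.
have dT x : is_derive x 1 (T f n.+2) (T (derive1 f) n.+1 x).
  rewrite (_ : T f n.+2 =
      \sum_(j < n.+2) (coef j f \*: (fun s : R => s ^+ j)))%R; last first.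
    by apply/funext => y; rewrite fct_sumE.
  apply: is_derive_eq; rewrite big_ord_recl/= mul0r scaler0 add0r.
  apply: eq_bigr => j _; rewrite /bump/= coef_derive add1n /GRing.scale/=.
  by rewrite mulrCA mulrA.
have sT m g : smoothR (T g m).
  by apply: smooth_sum => j; apply: smooth_scale; apply: smooth_exp; exact: smooth_id.
pose r1 x := f x - T f n.+2 x.
have sr1 : smoothR r1 := smooth_sub sf (sT _ _).
have r10 : r1 0 = 0.
  rewrite /r1 /T big_ord_recl/= expr0 mulr1 big1 ?addr0 => [|j _].
    by rewrite /coef fact0 divr1 subrr.
  by rewrite exprS mul0r mulr0.
rewrite -/(T f n.+2 s) -/(r1 s).
have -> : r1 s = r1 s - r1 0 by rewrite r10 subr0.
rewrite [_ ^+ n.+2]exprSr mulrA -{3}[s]subr0.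
apply: mvt_le => // x; rewrite !subr0 => xs.
have -> : (derive1 r1) x = (derive1 f) x - T (derive1 f) n.+1 x.
  apply: is_derive_derive1; have d1 := smooth_is_derive x sf.
  exact: is_deriveB.
apply: (le_trans (IHn _ (smooth_derive sf) _ x (le_trans xs sr))).
  by move=> y yr; rewrite -derive1Sn; exact: HC.
have C0 : 0 <= C by apply: le_trans (HC 0 _); rewrite ?normr0//; exact: le_trans sr.
by rewrite ler_wpM2l// lerXn2r// ?nnegrE.
Qed.

(** The form in which differentiability is established below: all the estimates
    are quadratic in the increment, with constants that are uniform in parameters. *)
Lemma is_derive_quad f x d C r : 0 < r ->
  (forall h, 0 < `|h| -> `|h| < r ->
     `|f (x + h) - f x - h * d| <= C * `|h| ^+ 2) ->
  is_derive x 1 f d.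
Proof.
move=> r0 HC.
have Hc : h^-1 *: (f (h *: 1%R + x) - f x) @[h --> (0:R)^'] --> d.
  apply/cvgrPdist_le => e e0.
  have C0 : 0 <= `|C| by [].
  near=> h.
  have h0 : h != 0 by near: h; exact: nbhs_dnbhs_neq.
  have hr : `|h| < r by near: h; apply: dnbhs0_lt.
  have he : `|h| < e / (`|C| + 1) by near: h; apply: dnbhs0_lt; rewrite divr_gt0// ltr_wpDl.
  have hp : 0 < `|h| by rewrite normr_gt0.
  have := HC h hp hr.
  rewrite /GRing.scale/= mulr1 [h + x]addrC => H.
  rewrite -(ler_pM2l hp) -normrM mulrBr mulrA divff// mul1r distrC.
  apply: (le_trans H); rewrite expr2 mulrCA ler_wpM2l//.
  apply: (le_trans (ler_wpM2r _ (ler_norm C))) => //.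
  apply: (@le_trans _ _ ((`|C| + 1) * `|h|)); first by rewrite ler_wpM2r// lerDl.
  by rewrite mulrC -ler_pdivlMr ?ltr_wpDl// ltW.
split; first by apply/cvg_ex; exists d.
exact/cvg_lim.
Unshelve. all: by end_near. Qed.

End OneVariable.
Arguments smooth_scale {R} a [f] _.
Arguments smooth_continuous {R} [f] x _.

(** * Geometrically weighted sums *)

Section WeightedSum.
Variable R : realType.
Implicit Types u v : nat -> R.

Definition weight (i : nat) : R := 2^-1 ^+ i.+1.

(** Total on bounded sequences, where it is a linear functional of norm 1; all
    the infinite sums below are put in this form. *)
Definition wsum v : R := limn (series (fun i => weight i * v i)).

Definition bddseq v := exists C : R, forall i, `|v i| <= C.

Lemma weight_gt0 i : 0 < weight i.
Proof. by rewrite exprn_gt0 ?invr_gt0. Qed.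

Lemma cvg_weight : series weight @ \oo --> (1 : R).
Proof.
have half_lt1 : `|2^-1 : R| < 1.
  by rewrite ger0_norm ?invr_ge0// invf_lt1 ?ltr1n.
have := @cvg_geometric_series R 2^-1 2^-1 half_lt1.
rewrite (_ : 2^-1 / (1 - 2^-1) = 1); last by field.
rewrite (_ : geometric _ _ = weight)//.
by apply/funext => i; rewrite /= -exprS.
Qed.

Lemma wsum_cvg_norm v : bddseq v ->
  cvgn [normed series (fun i => weight i * v i)].
Proof.
move=> [C HC]; apply: (@series_le_cvg _ _ (C *: weight)%R) => [n|n|n|].
- exact: normr_ge0.
- by rewrite mulr_ge0 ?(ltW (weight_gt0 _))//; exact: le_trans (normr_ge0 _) (HC 0%N).
- change (`|weight n * v n| <= C * weight n).
  rewrite normrM gtr0_norm ?weight_gt0// mulrC.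
  by rewrite ler_pM2r ?weight_gt0.
- by apply: is_cvg_seriesZ; apply/cvg_ex; exists 1; exact: cvg_weight.
Qed.

Lemma wsum_cvg v : bddseq v -> cvgn (series (fun i => weight i * v i)).
Proof. by move=> /wsum_cvg_norm/normed_cvg. Qed.

Lemma wsum_le v C : (forall i, `|v i| <= C) -> `|wsum v| <= C.
Proof.
move=> HC; have bv : bddseq v by exists C.
apply: (le_trans (lim_series_norm (wsum_cvg_norm bv))).
have cw : cvgn (series weight) by apply/cvg_ex; exists 1; exact: cvg_weight.
have -> : C = limn (series (C *: weight)%R).
  by rewrite lim_seriesZ// (cvg_lim _ cvg_weight)// /GRing.scale/= mulr1.
apply: lim_series_le => [||n].
- exact: wsum_cvg_norm.
- exact: is_cvg_seriesZ.
- change (`|weight n * v n| <= C * weight n).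
  by rewrite normrM gtr0_norm ?weight_gt0// mulrC ler_pM2r ?weight_gt0.
Qed.

Lemma wsumD u v : bddseq u -> bddseq v ->
  wsum (fun i => u i + v i) = wsum u + wsum v.
Proof.
move=> bu bv; rewrite /wsum -lim_seriesD; [|exact: wsum_cvg..].
by congr (limn (series _)); apply/funext => i; rewrite mulrDr.
Qed.

Lemma wsumZ a v : bddseq v -> wsum (fun i => a * v i) = a * wsum v.
Proof.
move=> bv; rewrite /wsum -[RHS]/(a *: _) -lim_seriesZ; last exact: wsum_cvg.
by congr (limn (series _)); apply/funext => i; rewrite mulrCA.
Qed.

Lemma bddseqD u v : bddseq u -> bddseq v -> bddseq (fun i => u i + v i).
Proof.
move=> [C HC] [D HD]; exists (C + D) => i.
by apply: (le_trans (ler_normD _ _)); rewrite lerD.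
Qed.

Lemma bddseqZ a v : bddseq v -> bddseq (fun i => a * v i).
Proof. by move=> [C HC]; exists (`|a| * C) => i; rewrite normrM ler_wpM2l. Qed.

Lemma wsumB u v : bddseq u -> bddseq v ->
  wsum (fun i => u i - v i) = wsum u - wsum v.
Proof.
move=> bu bv; rewrite -mulN1r -wsumZ// -wsumD//; last exact: bddseqZ.
by congr wsum; apply/funext => i; rewrite mulN1r.
Qed.

Lemma bddseqB u v : bddseq u -> bddseq v -> bddseq (fun i => u i - v i).
Proof.
move=> bu /(bddseqZ (-1)) /(bddseqD bu); congr bddseq.
by apply/funext => i; rewrite mulN1r.
Qed.

Lemma wsum_lim v l :
  series (fun i => weight i * v i) @ \oo --> l -> wsum v = l.
Proof. by move/cvg_lim; apply. Qed.

Lemma wsum_fin v n : (forall i, (n <= i)%N -> v i = 0) ->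
  wsum v = \sum_(i < n) weight i * v i.
Proof.
move=> v0; apply: wsum_lim; apply: cvg_near_cst.
exists n => // m /= nm; apply/eqP; rewrite /series/=.
rewrite (@big_cat_nat _ _ _ n)//= big_mkord [X in _ + X]big_nat_cond.
by rewrite [X in _ + X]big1 ?addr0// => i /andP[/andP[/v0 -> _] _]; rewrite mulr0.
Qed.

Lemma wsum_single v n : (forall i, i <> n -> v i = 0) ->
  wsum v = weight n * v n.
Proof.
move=> v0; rewrite (@wsum_fin v n.+1) => [|i ni]; last first.
  by apply: v0 => e; rewrite e ltnn in ni.
rewrite big_ord_recr/= big1 ?add0r// => i _; rewrite v0 ?mulr0// => e.
by have := ltn_ord i; rewrite e ltnn.
Qed.

(** Gliding hump. If the family [u] is unbounded, its large values
    [u (b_i) (t_i)] and the weights [w_i] can be chosen one after the other in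
    such a way that in the sum over [j] of [w_j u (b_i) (t_j)] the term [j = i]
    outweighs the terms [j < i], which are bounded since [u] is pointwise
    bounded, and the terms [j > i], whose weights are chosen after [b_i]. *)
Lemma gliding_hump (B P : Type) (u : B -> P -> R) :
  (forall b, exists K : R, forall t, `|u b t| <= K) ->
  (forall (p : nat -> P) (w : nat -> R), (forall i, 0 <= w i <= 1) ->
     exists K : R, forall b, `|wsum (fun i => w i * u b (p i))| <= K) ->
  exists K : R, forall b t, `|u b t| <= K.
Proof.
move=> ub uw; apply: contrapT => nbd.
have /choice[S HS] := ub.
have S0 b (t : P) : 0 <= S b := le_trans (normr_ge0 _) (HS b t).
have /choice[M HM] : forall t, exists m, forall b, `|u b t| <= m.
  move=> t; have [i|K HK] := uw (fun=> t) (fun i => (i == 0%N)%:R).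
    by case: (i == 0%N); rewrite ?ler01 ?lexx.
  exists (2 * K) => b; have := HK b.
  rewrite (@wsum_single _ 0%N) => [|i /eqP/negbTE ->]; last by rewrite mul0r.
  rewrite eqxx mul1r /weight expr1 normrM ger0_norm ?invr_ge0//.
  by rewrite ler_pdivrMl.
have /choice[pk Hpk] : forall x : nat * (R * R), exists bt : B * P, 0 <= x.2.2 ->
    x.1%:R + 1 + x.2.1 <= weight x.1 * ((1 + x.2.2)^-1 * `|u bt.1 bt.2|).
  move=> [n [A D]] /=.
  pose K := (n%:R + 1 + A) * (1 + D) / weight n.
  have [b [t Hbt]] : exists b t, K < `|u b t|.
    apply: contrapT => nb; apply: nbd; exists K => b t.
    by rewrite leNgt; apply/negP => h; apply: nb; exists b, t.
  exists (b, t) => /= D0; have D1 : 0 < 1 + D by rewrite ltr_wpDr.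
  have wn := weight_gt0 n.
  rewrite mulrA [weight n / _]mulrC -ler_pdivrMl ?mulr_gt0 ?invr_gt0//.
  rewrite invfM invrK; apply: ltW; apply: le_lt_trans Hbt.
  by rewrite /K mulrC mulrA.
pose st := fix st n : R * R := if n is k.+1 then
  let: (A, D) := st k in let: (b, t) := pk (k, (A, D)) in
  (A + weight k * ((1 + D)^-1 * M t), D + S b) else (0, 0).
pose b i := (pk (i, st i)).1; pose t i := (pk (i, st i)).2.
pose w i := (1 + (st i).2)^-1.
have stS i : st i.+1 = ((st i).1 + weight i * (w i * M (t i)), (st i).2 + S (b i)).
  rewrite /= /w /t /b; case E : (st i) => [A D] /=.
  by case: (pk _).
have D0 i : 0 <= (st i).2.
  by elim: i => [//|i IHi]; rewrite stS/= addr_ge0// (S0 _ (t i)).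
have Dmon i j : (i < j)%N -> S (b i) <= (st j).2.
  elim: j => [//|j IHj]; rewrite ltnS leq_eqVlt stS/= => /orP[/eqP ->|/IHj h].
    by rewrite lerDr.
  by rewrite ler_wpDr// (S0 _ (t j)).
have w01 i : 0 <= w i <= 1.
  rewrite invr_ge0 addr_ge0//= invf_le1 ?lerDl//.
  by rewrite ltr_wpDr.
have [K HK] := uw t w w01.
pose i := Num.bound K.
have Ki : K < i%:R.
  have [K0|K0] := leP 0 K; first by have := archi_boundP K0.
  by apply: lt_le_trans K0 _; rewrite ler0n.
have := HK (b i); apply/negP; rewrite -ltNge; apply: (lt_le_trans Ki).
pose v j := w j * u (b i) (t j).
have bv : bddseq v.
  exists (S (b i)) => j; rewrite normrM ger0_norm; last by case/andP: (w01 j).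
  by rewrite -[leRHS]mul1r ler_pM//; case/andP: (w01 j).
pose v1 j := (j < i)%N%:R * v j; pose v2 j := (j == i)%:R * v j.
pose v3 j := (i < j)%N%:R * v j.
have bb (c : nat -> bool) : bddseq (fun j => (c j)%:R * v j).
  case: bv => C HC; exists C => j; case: (c j); rewrite ?mul1r ?mul0r ?normr0//.
  exact: le_trans (normr_ge0 _) (HC 0%N).
have vE : v = (fun j => v1 j + v2 j + v3 j).
  apply/funext => j; rewrite /v1 /v2 /v3.
  by case: ltngtP => _; rewrite ?mul1r ?mul0r ?addr0 ?add0r.
rewrite -/v vE wsumD; [|by apply: bddseqD; exact: bb|exact: bb].
rewrite wsumD; [|exact: bb|exact: bb].
have l1 : `|wsum v1| <= (st i).1.
  rewrite (@wsum_fin _ i) => [|j ij]; last by rewrite /v1 ltnNge ij mul0r.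
  have -> : (st i).1 = \sum_(j < i) weight j * (w j * M (t j)).
    by elim: (i) => [|k IHk]; rewrite ?big_ord0// stS big_ord_recr/= -IHk.
  apply: (le_trans (ler_norm_sum _ _ _)); apply: ler_sum => j _.
  rewrite /v1 ltn_ord mul1r normrM gtr0_norm ?weight_gt0//.
  rewrite ler_pM2l ?weight_gt0// /v normrM ger0_norm; last by case/andP: (w01 j).
  by rewrite ler_wpM2l//; case/andP: (w01 j).
have l3 : `|wsum v3| <= 1.
  apply: wsum_le => j; rewrite /v3; case: ltnP => ij; rewrite ?mul0r ?normr0//.
  rewrite mul1r /v normrM ger0_norm; last by case/andP: (w01 j).
  rewrite /w mulrC ler_pdivrMr ?mul1r ?ltr_wpDr//.
  by apply: (le_trans (HS _ _)); rewrite ler_wpDl// Dmon.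
have l2 : i%:R + 1 + (st i).1 <= `|wsum v2|.
  rewrite (@wsum_single _ i) => [|j /eqP/negbTE ji]; last by rewrite /v2 ji mul0r.
  rewrite /v2 eqxx mul1r normrM gtr0_norm ?weight_gt0// /v normrM.
  have /andP[wi0 _] := w01 i; rewrite (ger0_norm wi0).
  exact: (Hpk (i, st i) (D0 i)).
rewrite -[leRHS]normrN -[wsum v1]opprK.
have := lerB_normD (wsum v2) (wsum v1 + wsum v3).
have := ler_normD (wsum v1) (wsum v3).
rewrite addrA [wsum v2 + _]addrC normrN opprK; lra.
Qed.

End WeightedSum.

(** * Smoothness of weighted sums of functions *)

Section Termwise.
Variable R : realType.
Implicit Types (u : nat -> R -> R).

Lemma taylor2 (f : R -> R) (x C h : R) : smoothR f ->
  (forall y, `|y - x| <= `|h| -> `|derive1n 2 f y| <= C) ->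
  `|f (x + h) - f x - h * derive1 f x| <= C * `|h| ^+ 2.
Proof.
move=> sf HC.
pose g s := f (x + 1 * s).
have aff : smoothR (fun s => x + 1 * s).
  by apply: (smoothRD _ _ (smoothR_cst x)); apply/smooth_scale/smooth_id.
have sg : smoothR g := smooth_comp sf aff.
have := @taylor_le R g 1 C `|h| sg _ h (lexx _).
rewrite !big_ord_recl big_ord0 addr0 /coef /bump [lift _ _ : nat]/= fact0 !divr1 /g.
rewrite !deriven_affine// derive1n0 derive1n1 expr0 !expr1 !mul1r.
rewrite [h ^+ ord0]expr0 mulr1 !addr0.
rewrite [derive1 f x * h]mulrC opprD addrA; apply => y yh.
by rewrite expr1n !mul1r; apply: HC; rewrite addrAC subrr add0r.
Qed.

(** The condition under which sums can be differentiated term by term. *)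
Definition equismooth (I : Type) (u : I -> R -> R) :=
  (forall i, smoothR (u i)) /\
  forall m x0, exists2 e : R, 0 < e & exists C : R,
    forall i x, `|x - x0| < e -> `|derive1n m (u i) x| <= C.

Lemma equismooth_derive (I : Type) (u : I -> R -> R) :
  equismooth u -> equismooth (fun i => derive1 (u i)).
Proof.
move=> [su bu]; split=> [i|m x0]; first exact: smooth_derive.
have [e e0 [C HC]] := bu m.+1 x0; exists e => //; exists C => i x xx0.
by rewrite -derive1Sn; exact: HC.
Qed.

Lemma equismooth_bddseq u (x : R) : equismooth u -> bddseq (u^~ x).
Proof.
move=> [_ /(_ 0%N x)[e e0 [C HC]]]; exists C => i; apply: HC.
by rewrite subrr normr0.
Qed.

Lemma wsum_smooth u : equismooth u -> smoothR (fun x => wsum (u^~ x)).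
Proof.
move=> eu.
apply: (@smooth_coind R
  (fun F => exists2 u, equismooth u & F = fun x => wsum (u^~ x))); last first.
  by exists u.
move=> {eu} _ [v ev ->] {u}; move: v ev => u eu.
have eu' := equismooth_derive eu.
exists (fun x => wsum (fun i => derive1 (u i) x)); first by eexists; first exact: eu'.
move=> x; have [e e0 [C HC]] := eu.2 2 x.
apply: (@is_derive_quad _ _ _ _ C e e0) => h h0 he.
rewrite -wsumB; [|exact: equismooth_bddseq..].
rewrite -wsumZ; last exact: (equismooth_bddseq x eu').
rewrite -wsumB; first last.
- by apply: bddseqZ; exact: (equismooth_bddseq x eu').
- by apply: bddseqB; exact: equismooth_bddseq.
apply: wsum_le => i; apply: taylor2; first exact: eu.1.
by move=> y yh; apply: HC; apply: le_lt_trans he.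
Qed.

End Termwise.

(** * Bump functions *)

Section Bump.
Variable R : realType.

(** [p (1/x) exp (-1/x)], extended by 0 to [x <= 0]: a class of functions that is
    closed under differentiation. *)
Let flatp (p : {poly R}) (x : R) : R :=
  if 0 < x then p.[x^-1] * expR (- x^-1) else 0.

Let expR_decay n (y : R) : 0 <= y -> y ^+ n * expR (- y) <= n%:R ^+ n.
Proof.
move=> y0; case: n => [|n].
  by rewrite !expr0 mul1r expRN invf_le1 ?expR_gt0// -[leLHS]addr0
    (le_trans _ (expR_ge1Dx y))// lerD2l.
rewrite expRN ler_pdivrMr ?expR_gt0//.
(* [exp y = exp (y / n) ^ n >= (y / n) ^ n] *)
rewrite -[y in expR y](@mulfVK _ n.+1%:R) ?pnatr_eq0// [_ / _ * _]mulrC expRM_natl.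
rewrite -exprMn lerXn2r ?nnegrE ?mulr_ge0 ?expR_ge0//.
rewrite -ler_pdivrMl ?ltr0n// mulrC.
by apply: le_trans (expR_ge1Dx _); rewrite lerDr.
Qed.

Let flatp_bound p : exists C : R, forall x, 0 < x -> x < 1 ->
  `|p.[x^-1] * expR (- x^-1)| <= C * x ^+ 2.
Proof.
pose n := size p; pose A := \sum_(i < n) `|p`_i|.
exists (A * (n + 2)%:R ^+ (n + 2)) => x x0 x1.
set y := x^-1; have y0 : 0 < y by rewrite invr_gt0.
have y1 : 1 <= y by rewrite invf_ge1// ltW.
rewrite normrM [`|expR _|]ger0_norm ?expR_ge0//.
have pA : `|p.[y]| <= A * y ^+ n.
  rewrite horner_coef mulr_suml; apply: (le_trans (ler_norm_sum _ _ _)).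
  apply: ler_sum => i _; rewrite normrM ler_wpM2l// normrX gtr0_norm//.
  by rewrite ler_weXn2l// ltnW.
have -> : x ^+ 2 = (y ^+ 2)^-1 by rewrite /y exprVn invrK.
rewrite ler_pdivlMr ?exprn_gt0//.
have A0 : 0 <= A by apply: sumr_ge0.
apply: (@le_trans _ _ (A * (y ^+ (n + 2) * expR (- y)))).
  rewrite exprD (_ : A * _ = A * y ^+ n * expR (- y) * y ^+ 2); last by ring.
  by rewrite ler_pM2r ?exprn_gt0// ler_pM2r ?expR_gt0.
by rewrite ler_wpM2l// expR_decay// ltW.
Qed.

Let flatp_derive p (x : R) :
  is_derive x 1 (flatp p) (flatp ('X ^+ 2 * (p - p^`())%R) x).
Proof.
have [x0|x0|->] := ltgtP x 0.
- rewrite [flatp _ x]/flatp ltNge (ltW x0)/=.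
  apply: (@near_eq_is_derive _ _ _ (cst 0)).
    near=> y; rewrite /= /flatp ltNge ltW//=.
    by near: y; exact: lt_nbhsl.
- pose E (y : R) := p.[y^-1] * expR (- y^-1).
  apply: (@near_eq_is_derive _ _ _ E).
    near=> y; rewrite /flatp ifT//.
    by near: y; exact: lt_nbhsr.
  have xn0 : x != 0 by rewrite gt_eqF.
  have dV := is_deriveV xn0 (is_derive_id x 1).
  have d1 := is_derive1_comp (is_derive_poly p x^-1) dV.
  have d2 := @is_derive1_comp R expR (fun y => - y^-1) x _ _
    (is_derive_expR (- x^-1)) (is_deriveN dV).
  apply: (is_derive_eq (is_deriveM d1 d2)).
  rewrite /flatp x0 /GRing.scale/= !mulr1 -!exprVn hornerM hornerXn hornerD hornerN.
  by ring.
- have [C HC] := flatp_bound p.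
  rewrite /flatp ltxx; apply: (@is_derive_quad _ _ _ _ C 1 ltr01) => h h0 h1.
  rewrite /flatp ltxx add0r mulr0 !subr0.
  have C0 : 0 <= C.
    have h2 : (0:R) < 2^-1 by rewrite invr_gt0.
    have := HC 2^-1 h2; rewrite invf_lt1// ltr1n => /(_ isT).
    by move/(le_trans (normr_ge0 _)); rewrite pmulr_lge0// exprn_gt0.
  case: ifPn => hp; last by rewrite normr0 mulr_ge0// exprn_ge0.
  by rewrite real_normK ?num_real//; apply: HC => //; rewrite gtr0_norm in h1.
Unshelve. all: by end_near. Qed.

Let flatp_smooth p : smoothR (flatp p).
Proof.
apply: (@smooth_coind R (fun F => exists p, F = flatp p)); last by exists p.
move=> _ [{}p ->]; exists (flatp ('X ^+ 2 * (p - p^`())%R)); first by eexists.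
by move=> x; exact: flatp_derive.
Qed.

Let flat := flatp 1.

Let flat_gt0 x : 0 < x -> 0 < flat x.
Proof. by move=> x0; rewrite /flat /flatp x0 hornerE mul1r expR_gt0. Qed.

Let flat_le0 x : x <= 0 -> flat x = 0.
Proof. by move=> x0; rewrite /flat /flatp ltNge x0. Qed.

Let flat_mono x y : x <= y -> flat x <= flat y.
Proof.
move=> xy; have [x0|x0] := leP x 0.
  rewrite flat_le0//; have [y0|/flat_gt0/ltW//] := leP y 0.
  by rewrite flat_le0.
have y0 := lt_le_trans x0 xy.
rewrite /flat /flatp x0 y0 !hornerE ler_expR lerN2.
by rewrite lef_pV2.
Qed.

Lemma bump_exists : exists2 b : R -> R, smoothR b &
  (forall x, `|x| <= 1 -> b x = 1) /\ (forall x, 2 <= `|x| -> b x = 0).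
Proof.
(* [flat 3] is the value of [flat (x ^ 2 - 1)] at [x = 2], where [b0] vanishes *)
pose b0 x := flat (flat 3 - flat (x ^+ 2 - 1)).
have f30 : 0 < flat (flat 3) by apply/flat_gt0/flat_gt0.
exists (fun x => (flat (flat 3))^-1 * b0 x).
  have sfl : smoothR flat := @flatp_smooth 1.
  have sx : smoothR (fun x : R => x ^+ 2 - 1).
    have := (smooth_sub (smooth_exp (n := 2) (@smooth_id R)) (smoothR_cst 1)).
    exact.
  apply: smooth_scale; apply: (smooth_comp sfl).
  exact: (smooth_sub (smoothR_cst _) (smooth_comp sfl sx)).
split=> x Hx; rewrite /b0.
  rewrite [flat (_ - 1)]flat_le0 ?subr0 ?mulVf ?gt_eqF//.
  by rewrite subr_le0 -[x ^+ 2]real_normK ?num_real// exprn_ile1.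
rewrite [flat (_ - _)]flat_le0 ?mulr0// subr_le0; apply: flat_mono.
rewrite -[x ^+ 2]real_normK ?num_real// lerBrDr.
rewrite (_ : 3 + 1 = 2 ^+ 2); last by rewrite -natrX natr1.
by rewrite lerXn2r ?nnegrE.
Qed.

End Bump.

(** * Functions of two variables that are smooth along curves *)

Section Bismooth.
Variable R : realType.
Implicit Types (k : R -> R -> R) (a b : R -> R).

(** By Boman's theorem these are the smooth functions on the plane; this form of
    the definition makes composition trivial. *)
Definition bismooth k :=
  forall a b, smoothR a -> smoothR b -> smoothR (fun t => k (a t) (b t)).

Lemma bismooth_l k t : bismooth k -> smoothR (k^~ t).
Proof. by move=> sk; exact: sk _ _ (@smooth_id R) (smoothR_cst t). Qed.

Lemma bismooth_r k s : bismooth k -> smoothR (k s).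
Proof. by move=> sk; exact: sk _ _ (smoothR_cst s) (@smooth_id R). Qed.

Lemma bismooth_fst a : smoothR a -> bismooth (fun s _ => a s).
Proof. by move=> sa c d sc _; exact: smooth_comp. Qed.

Lemma bismooth_snd a : smoothR a -> bismooth (fun _ t => a t).
Proof. by move=> sa c d _ sd; exact: smooth_comp. Qed.

Lemma bismooth_swap k : bismooth k -> bismooth (fun s t => k t s).
Proof. by move=> sk a b sa sb; exact: sk. Qed.

Lemma bismoothD k1 k2 : bismooth k1 -> bismooth k2 ->
  bismooth (fun s t => k1 s t + k2 s t).
Proof. by move=> s1 s2 a b sa sb; exact: (smoothRD _ _ (s1 _ _ sa sb) (s2 _ _ sa sb)). Qed.

Lemma bismoothM k1 k2 : bismooth k1 -> bismooth k2 ->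
  bismooth (fun s t => k1 s t * k2 s t).
Proof. by move=> s1 s2 a b sa sb; exact: (smoothRM _ _ (s1 _ _ sa sb) (s2 _ _ sa sb)). Qed.

Lemma deriven0 n : derive1n n (fun=> 0 : R) = (fun=> 0).
Proof.
elim: n => [//|n IHn]; rewrite derive1nS IHn.
by apply/funext => x; exact: derive1_cst.
Qed.

(** The derivatives vanish outside [[-3, 3]]. *)
Lemma compact_support_bound a m : smoothR a -> (forall x, 2 <= `|x| -> a x = 0) ->
  exists C : R, forall x, `|derive1n m a x| <= C.
Proof.
move=> sa a0; have sm := smooth_deriven m sa.
have [||c _ Hc] := @EVT_max R (fun x => `|derive1n m a x|) (-3) 3.
- by rewrite lerNl (@le_trans _ _ 0) ?oppr_le0.
- apply: continuous_subspaceT => x; apply: (@continuous_comp _ _ _ (derive1n m a)).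
    exact: smooth_continuous.
  exact: norm_continuous.
exists `|derive1n m a c| => x; have [x3|x3] := leP `|x| 3.
  by apply: Hc; rewrite in_itv/= -ler_norml.
suff -> : derive1n m a x = 0 by rewrite normr0.
have a0x : \forall y \near x, a y = (fun=> 0 : R) y.
  near=> y; apply: a0; apply: (@le_trans _ _ (`|x| - `|x - y|)).
    rewrite lerBrDr (le_trans _ (ltW x3))// -lerBrDl.
    rewrite (_ : 3 - 2 = 1 :> R); last by ring.
    by near: y; exact: (@cvgr_dist_le _ _ _ _ _ id x cvg_id 1 ltr01).
  by rewrite lerBlDr -{1}[x](subrK y) addrC ler_normD.
by have /nbhs_singleton -> := deriven_near m a0x; rewrite deriven0.
Unshelve. all: by end_near. Qed.

(** The exponent [i * i] outgrows the linear functions of [i] that occur in the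
    derivatives of the rescaled bump functions below. *)
Definition fastdec (i : nat) : R := 2^-1 ^+ (i * i).

Lemma fastdec_gt0 i : 0 < fastdec i.
Proof. by rewrite exprn_gt0 ?invr_gt0. Qed.

(** Special curve lemma: rescaled copies of a bump function [r], placed around
    the times [2^-i] with disjoint supports and with rapidly decreasing factors,
    add up to a smooth function. *)
Lemma special_curve (r : R -> R) (x : nat -> R) :
  smoothR r -> (forall y, 2 <= `|y| -> r y = 0) ->
  (forall i, `|x i| <= fastdec i) ->
  exists2 a, smoothR a & forall i t, `|- 8 + 2 ^+ (i + 3) * t| < 1 ->
    a t = x i * r (- 8 + 2 ^+ (i + 3) * t).
Proof.
move=> sr r0 Hx.
(* The factor [2 ^ (i + 1)] cancels [weight i]. The argument of [r] vanishes at
   [t = 2 ^ -i]; for [|2 ^ (i + 3) t - 8| < 1] and [j <> i] the argument of the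
   [j]-th copy is outside [[-2, 2]]. *)
pose u i t := 2 ^+ i.+1 * x i * r (- 8 + 2 ^+ (i + 3) * t).
have aff (c d : R) : smoothR (fun t => c + d * t).
  by apply: (smoothRD _ _ (smoothR_cst c)); apply/smooth_scale/smooth_id.
have eu : equismooth u.
  split=> [i|m x0]; first exact/smooth_scale/(smooth_comp sr (aff _ _)).
  have [C HC] := compact_support_bound m sr r0.
  have C0 : 0 <= C := le_trans (normr_ge0 _) (HC 0).
  exists 1 => //; exists (2 ^+ ((m + 1) ^ 2 + 3 * m + 1) * C) => i t _.
  rewrite /u derivenZ; last exact: (smooth_comp sr (aff _ _)).
  rewrite deriven_affine// mulrA normrM; apply: ler_pM => //.
  rewrite -exprM 2!normrM !normrX normr_nat.
  apply: (@le_trans _ _ (2 ^+ i.+1 * fastdec i * 2 ^+ ((i + 3) * m))).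
    by rewrite ler_wpM2r ?exprn_ge0// ler_wpM2l ?exprn_ge0.
  rewrite /fastdec exprVn mulrAC -exprD ler_pdivrMr ?exprn_gt0// -exprD.
  rewrite ler_weXn2l ?ler1n//; nia.
exists (fun t => wsum (u^~ t)); first exact: wsum_smooth.
move=> i t Ht; rewrite (@wsum_single _ _ i) => [|j ji].
  by rewrite /u /weight !mulrA -exprMn mulVf ?pnatr_eq0// expr1n mul1r.
rewrite /u r0 ?mulr0//; set y := 2 ^+ (i + 3) * t in Ht.
have {Ht} /andP[y7 y9] : 7 < y < 9 by move: Ht; rewrite ltr_norml => /andP[]; lra.
have [ij|ji'|e] := ltngtP i j; last by rewrite e in ji.
  have -> : 2 ^+ (j + 3) * t = 2 ^+ (j - i) * y.
    by rewrite /y mulrA -exprD; congr (2 ^+ _ * _); lia.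
  have : (2:R) <= 2 ^+ (j - i) by rewrite -{1}[2]expr1 ler_weXn2l ?ler1n// subn_gt0.
  set z := _ ^+ _ => z2.
  have : 2 * y <= z * y by rewrite ler_wpM2r//; lra.
  by move=> H; rewrite ger0_norm; lra.
have : 2 ^+ (i - j) * (2 ^+ (j + 3) * t) = y.
  by rewrite /y mulrA -exprD; congr (2 ^+ _ * _); lia.
have : (2:R) <= 2 ^+ (i - j) by rewrite -{1}[2]expr1 ler_weXn2l ?ler1n// subn_gt0.
set z := _ ^+ _; set v := _ * t => z2 zv.
have v0 : 0 < v by rewrite -(pmulr_rgt0 _ (lt_le_trans _ z2))// zv; lra.
have : 2 * v <= z * v by rewrite ler_wpM2r// ltW.
by rewrite zv => H; rewrite ler0_norm; lra.
Qed.

(** If a partial derivative were unbounded near a point, it would be unbounded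
    along a smooth curve which runs through suitable points [(s i, t i)] at the
    times [2^-i], in the direction of the first axis and with positive speed. *)
Lemma bismooth_locally_bounded k n s0 t0 : bismooth k ->
  exists2 e : R, 0 < e & exists C : R, forall s t, `|s - s0| < e -> `|t - t0| < e ->
    `|derive1n n (k^~ t) s| <= C.
Proof.
move=> sk; apply: contrapT => nb.
pose speed i : R := fastdec i * 2 ^+ (i + 3).
have speed0 i : 0 < speed i by rewrite mulr_gt0 ?fastdec_gt0 ?exprn_gt0.
have /choice[st Hst] : forall i, exists st : R * R,
    [/\ `|st.1 - s0| <= fastdec i, `|st.2 - t0| <= fastdec i &
        i%:R < speed i ^+ n * `|derive1n n (k^~ st.2) st.1|].
  move=> i; apply: contrapT => ni; apply: nb; exists (fastdec i); first exact: fastdec_gt0.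
  exists (i%:R / speed i ^+ n) => s t Hs Ht; rewrite leNgt; apply/negP => H.
  apply: ni; exists (s, t); split; rewrite ?ltW//.
  by rewrite mulrC -ltr_pdivrMr ?exprn_gt0.
have [b sb [b1 b0]] := bump_exists R.
have sxb : smoothR (fun x => x * b x) := smoothRM _ _ (@smooth_id R) sb.
have xb0 x : 2 <= `|x| -> x * b x = 0 by move=> /b0 ->; rewrite mulr0.
have [|p sp Hp] := @special_curve b (fun i => (st i).1 - s0) sb b0.
  by move=> i; have [] := Hst i.
have [|q sq Hq] := @special_curve b (fun i => (st i).2 - t0) sb b0.
  by move=> i; have [] := Hst i.
have [|v sv Hv] := @special_curve _ fastdec sxb xb0.
  by move=> i; rewrite gtr0_norm// fastdec_gt0.
pose f t := k (s0 + (p t + v t)) (t0 + q t).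
have sf : smoothR f.
  apply: sk; first exact: (smoothRD _ _ (smoothR_cst s0) (smoothRD _ _ sp sv)).
  exact: (smoothRD _ _ (smoothR_cst t0) sq).
have [e e0 [C HC]] := smooth_locally_bounded 0 (smooth_deriven n sf).
(* an index for which the time is close to 0 and the derivative is large *)
pose i := maxn (Num.bound C) (Num.bound e^-1).
have Ci : C < i%:R.
  have [C0|C0] := leP 0 C; last by rewrite (lt_le_trans C0).
  by rewrite (lt_le_trans (archi_boundP C0))// ler_nat leq_maxl.
pose ti : R := 2^-1 ^+ i.
have ei : `|ti - 0| < e.
  rewrite subr0 gtr0_norm ?exprn_gt0 ?invr_gt0// /ti exprVn.
  rewrite invf_plt ?posrE ?exprn_gt0//.
  have h : e^-1 < (Num.bound e^-1)%:R by apply: archi_boundP; rewrite invr_ge0 ltW.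
  apply: (lt_le_trans h).
  apply: (@le_trans _ _ i%:R); first by rewrite ler_nat leq_maxr.
  by rewrite -natrX ler_nat ltnW// ltn_expl.
have := HC ti ei; apply/negP; rewrite -ltNge; apply: (lt_trans Ci).
have [_ _ Hi] := Hst i; apply: (lt_le_trans Hi).
have pt : 2 ^+ (i + 3) * ti = 8.
  by rewrite /ti exprD mulrAC -exprMn mulfV ?pnatr_eq0// expr1n mul1r -natrX.
pose A := (st i).1 - speed i * ti.
have near_f : \forall t \near ti, f t = k (A + speed i * t) (st i).2.
  near=> t.
  have Ht : `|- 8 + 2 ^+ (i + 3) * t| < 1.
    near: t; apply: (@cvgr_norm_lt _ _ _ _ _ _ 0); last by rewrite normr0.
    rewrite -[X in _ --> X](_ : - 8 + 2 ^+ (i + 3) * ti = 0); last first.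
      by rewrite pt addNr.
    by apply: cvgD; [exact: cvg_cst|apply: cvgMr; exact: cvg_id].
  rewrite /f (Hp i)// (Hq i)// (Hv i)// b1 ?(ltW Ht)// !mulr1 [t0 + _]addrC subrK.
  congr (k _ _); rewrite /A /speed -mulrA pt.
  by rewrite mulrDr !mulrA; ring.
have /nbhs_singleton -> := deriven_near n near_f.
rewrite (@deriven_affine R (k^~ (st i).2) A (speed i) n (bismooth_l sk)).
rewrite /A subrK normrM.
by rewrite ger0_norm// exprn_ge0// ltW.
Unshelve. all: by end_near. Qed.

End Bismooth.

(** * Partial derivatives of functions smooth along curves *)

Section PartialDerivative.
Variable R : realType.
Implicit Types (k : R -> R -> R) (f : R -> R).

(** Coefficients which extract the [n]-th Taylor coefficient from [N] samples. *)
Lemma moments n N : (n < N)%N -> exists c : 'I_N -> R,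
  forall j, (j < N)%N -> \sum_(i < N) c i * i%:R ^+ j = (j == n)%:R.
Proof.
move=> nN; pose V := Vandermonde N (\row_(j < N) j%:R : 'rV[R]_N).
have Vu : V \in unitmx.
  rewrite unitmxE det_Vandermonde unitfE; apply/prodf_neq0 => i _.
  apply/prodf_neq0 => j ij; rewrite !mxE subr_eq0 eqr_nat.
  by rewrite neq_ltn ij orbT.
pose d : 'cV[R]_N := \col_i (i == n :> nat)%:R.
exists (fun i => (invmx V *m d) i 0) => j jN.
have := congr1 (fun M : 'cV[R]_N => M (Ordinal jN) 0) (mulKVmx Vu d).
by rewrite !mxE/= => <-; apply: eq_bigr => i _; rewrite !mxE mulrC.
Qed.

(** The coefficients up to degree [n] are 0, by evaluation at 0 and division. *)
Lemma poly_littleo m n (b : nat -> R) :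
  (forall eta, 0 < eta -> exists2 d : R, 0 < d &
     forall s, 0 < `|s| -> `|s| < d ->
       `|\sum_(j < m) b j * s ^+ j| <= eta * `|s| ^+ n) ->
  forall j, (j <= n)%N -> (j < m)%N -> b j = 0.
Proof.
have b00 (c : nat -> R) m' : (forall eta, 0 < eta -> exists2 d : R, 0 < d &
    forall s, 0 < `|s| -> `|s| < d ->
      `|\sum_(j < m'.+1) c j * s ^+ j| <= eta) -> c 0%N = 0.
  move=> Hc; apply: contrapT => /eqP b0.
  have eta0 : 0 < `|c 0%N| / 3 by rewrite divr_gt0// normr_gt0.
  have [d d0 Hd] := Hc _ eta0.
  pose p s := \sum_(j < m'.+1) c j * s ^+ j.
  have sp : smoothR p.
    by apply: smooth_sum => i; apply/smooth_scale/smooth_exp/smooth_id.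
  have p0 : p 0 = c 0%N.
    rewrite /p big_ord_recl expr0 mulr1 big1 ?addr0// => i _.
    by rewrite exprS mul0r mulr0.
  have /cvgrPdist_le/(_ _ eta0)[d' /= d'0 Hd'] := smooth_continuous 0 sp.
  pose s := Num.min d d' / 2.
  have s0 : 0 < s by rewrite divr_gt0// lt_min d0.
  have sd : s < d.
    by rewrite ltr_pdivrMr// (@le_lt_trans _ _ d) ?ge_min ?lexx// ltr_pMr// ltr1n.
  have sd' : s < d'.
    by rewrite ltr_pdivrMr// (@le_lt_trans _ _ d') ?ge_min ?lexx ?orbT// ltr_pMr// ltr1n.
  have := Hd s; rewrite gtr0_norm// => /(_ s0 sd); rewrite -/(p s).
  have := Hd' s; rewrite /ball_/= sub0r normrN gtr0_norm// => /(_ sd').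
  rewrite p0; have := ler_distD (p s) (c 0%N) 0; rewrite !subr0.
  have : 0 < `|c 0%N| by rewrite normr_gt0.
  lra.
elim: n m b => [|n IHn] [//|m] b Hb.
  move=> j; rewrite leqn0 => /eqP -> _; apply: (b00 b m) => eta /Hb[d d0 Hd].
  by exists d => // s s0 /(Hd s s0); rewrite expr0 mulr1.
have b0 : b 0%N = 0.
  apply: (b00 b m) => eta eta0; have [d d0 Hd] := Hb _ eta0.
  exists (Num.min d 1) => [|s s0]; first by rewrite lt_min d0 ltr01.
  rewrite lt_min => /andP[sd s1]; apply: (le_trans (Hd s s0 sd)).
  by rewrite -[leRHS]mulr1 ler_wpM2l ?exprn_ile1// ltW.
move=> [//|j] jn jm; apply: (IHn m (fun j => b j.+1)) => // eta eta0.
have [d d0 Hd] := Hb _ eta0; exists d => // s s0 sd.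
have := Hd s s0 sd; rewrite big_ord_recl b0 mul0r add0r.
rewrite (_ : \sum_(i < m) _ = s * \sum_(j < m) b j.+1 * s ^+ j); last first.
  by rewrite mulr_sumr; apply: eq_bigr => i _; rewrite /bump/= exprS mulrCA.
by rewrite normrM exprS mulrCA ler_pM2l.
Qed.

(** In [k (m s) t = \sum_j coef j (k^~ t) (m s)^j + O(s^(n+2))] the combination
    of [m = 0, ..., n+1] given by [moments] only keeps the [n]-th term. On the
    diagonal [t = t0 + s] this expresses [coef n (k^~ t)], up to [O(s^2)],
    through the values of one smooth function of [s], whose Taylor expansion
    thus yields the derivative at [t0]. *)
Lemma bismooth_coef_derive k n : bismooth k -> exists2 k', bismooth k' &
  forall t : R, is_derive t 1 (fun t => coef n (k^~ t)) (coef n.+1 (k'^~ t)).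
Proof.
move=> sk; have [c Hc] := @moments n n.+2 (leqnSn _).
pose k' s t := \sum_(i < n.+2) c i * k (i%:R * s) (t + s).
exists k'.
  move=> a b sa sb; apply: smooth_sum => i; apply: smooth_scale.
  by apply: sk; [exact: smooth_scale|exact: smoothRD].
move=> t0; set a := fun t => coef n (k^~ t).
have [e e0 [C HC]] := bismooth_locally_bounded n.+2 0 t0 sk.
have C0 : 0 <= C.
  by apply: le_trans (HC 0 t0 _ _); rewrite ?subrr ?normr0.
pose rho := e / n.+2%:R / 2.
have rho0 : 0 < rho by rewrite !divr_gt0 ?ltr0n.
pose D := \sum_(i < n.+2) `|c i| * (C * n.+2%:R ^+ n.+2).
have D0 : 0 <= D.
  by apply: sumr_ge0 => i _; apply: mulr_ge0 => //; apply: mulr_ge0 => //;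
    exact: exprn_ge0.
(* the finite difference which approximates the [n]-th Taylor coefficient *)
have FD t h : `|t - t0| < e -> `|h| <= rho ->
    `|\sum_(i < n.+2) c i * k (i%:R * h) t - a t * h ^+ n| <= D * `|h| ^+ n.+2.
  move=> te hrho.
  have bnd (i : 'I_n.+2) : `|i%:R * h| <= e / 2.
    rewrite normrM normr_nat (@le_trans _ _ (n.+2%:R * rho))//.
      by rewrite ler_pM// ler_nat ltnW.
    by rewrite /rho mulrA mulrCA divff ?mulr1// pnatr_eq0.
  have -> : a t * h ^+ n =
      \sum_(i < n.+2) c i * \sum_(j < n.+2) coef j (k^~ t) * (i%:R * h) ^+ j.
    under [RHS]eq_bigr do rewrite mulr_sumr.
    rewrite exchange_big/= (bigD1 (Ordinal (leqnSn n.+1)))//= [X in _ + X]big1 ?addr0.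
      transitivity ((\sum_(i < n.+2) c i * i%:R ^+ n) * (a t * h ^+ n)).
        by rewrite Hc ?eqxx ?mul1r.
      by rewrite mulr_suml; apply: eq_bigr => i _; rewrite exprMn /a; ring.
    move=> j; rewrite -val_eqE/= => /negbTE jn; rewrite (eq_bigr (fun i : 'I_n.+2 =>
      c i * i%:R ^+ j * (coef j (k^~ t) * h ^+ j))); last first.
      by move=> i _; rewrite exprMn; ring.
    by rewrite -mulr_suml Hc// jn mul0r.
  rewrite -sumrB mulr_suml; apply: (le_trans (ler_norm_sum _ _ _)).
  apply: ler_sum => i _; rewrite -mulrBr normrM -[leRHS]mulrA ler_wpM2l//.
  apply: (le_trans (@taylor_le R (k^~ t) n.+1 C (e / 2) (bismooth_l sk) _ _ (bnd i))).
    move=> x xe; apply: HC => //; rewrite subr0 (le_lt_trans xe)//.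
    by rewrite ltr_pdivrMr// ltr_pMr// ltr1n.
  rewrite -[leRHS]mulrA; apply: ler_wpM2l => //; rewrite normrM normr_nat.
  rewrite [leLHS]exprMn; apply: ler_wpM2r; first exact: exprn_ge0.
  by rewrite lerXn2r ?nnegrE ?ler0n// ler_nat ltnW.
have sPsi : smoothR (k'^~ t0).
  apply: smooth_sum => i; apply: smooth_scale; apply: sk.
    exact/smooth_scale/smooth_id.
  exact: (smoothRD _ _ (smoothR_cst t0) (@smooth_id R)).
have [e2 e20 [C2 HC2]] := smooth_locally_bounded 0 (smooth_deriven n.+2 sPsi).
have expand s : `|s| < e -> `|s| <= rho -> `|s| <= e2 / 2 ->
    `|a (t0 + s) * s ^+ n - \sum_(j < n.+2) coef j (k'^~ t0) * s ^+ j| <=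
      (D + C2) * `|s| ^+ n.+2.
  move=> se srho se2.
  have H1 := @FD (t0 + s) s; rewrite addrAC subrr add0r in H1.
  have := @taylor_le R (k'^~ t0) n.+1 C2 (e2 / 2) sPsi _ s se2.
  rewrite mulrDl => H2; have {}H2 := H2 _; apply: (le_trans (ler_distD (k' s t0) _ _)).
  apply: lerD; first by rewrite distrC; exact: H1.
  apply: H2 => x xe; apply: HC2; rewrite subr0 (le_lt_trans xe)//.
  by rewrite ltr_pdivrMr// ltr_pMr// ltr1n.
(* [a] is a locally uniform limit of continuous functions *)
have cont eta : 0 < eta -> exists2 d : R, 0 < d &
    forall t, `|t - t0| < d -> `|a t - a t0| <= eta.
  move=> eta0; pose h := Num.min rho (Num.min 1 (eta / 3 / (D + 1))).
  have D1 : 0 < D + 1 by rewrite ltr_wpDl.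
  have h0 : 0 < h by rewrite !lt_min rho0 ltr01 !divr_gt0.
  have hrho : `|h| <= rho by rewrite gtr0_norm// ge_min lexx.
  have Dh : D * h ^+ 2 <= eta / 3.
    apply: (@le_trans _ _ ((D + 1) * h)).
      rewrite expr2 mulrA ler_pM2r//; apply: (@le_trans _ _ (D * 1)).
        by rewrite ler_wpM2l// !ge_min lexx orbT.
      by rewrite mulr1 lerDl.
    by rewrite mulrC -ler_pdivlMr// !ge_min lexx !orbT.
  pose g t := \sum_(i < n.+2) c i * k (i%:R * h) t.
  have sg : smoothR g by apply: smooth_sum => i; apply/smooth_scale/bismooth_r.
  have eta3 : 0 < eta / 3 * h ^+ n by rewrite mulr_gt0 ?divr_gt0// exprn_gt0.
  have /cvgrPdist_le/(_ _ eta3)[d /= d0 Hd] := smooth_continuous t0 sg.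
  exists (Num.min d e) => [|t]; first by rewrite lt_min d0.
  rewrite lt_min => /andP[td te].
  have hn0 : 0 < h ^+ n by exact: exprn_gt0.
  rewrite -(ler_pM2r hn0) -{1}(gtr0_norm hn0) -normrM mulrBl.
  have Q1 := FD t h te hrho.
  have Q2 : `|t0 - t0| < e by rewrite subrr normr0.
  have {}Q2 := FD t0 h Q2 hrho.
  rewrite [`|h|]gtr0_norm// -/(g _) in Q1 Q2.
  have DhE : D * h ^+ n.+2 <= eta / 3 * h ^+ n.
    by rewrite -addn2 exprD mulrCA mulrC ler_pM2r.
  have := Hd t; rewrite /ball_/= distrC => /(_ td) Q3.
  have := ler_distD (g t) (a t * h ^+ n) (a t0 * h ^+ n).
  have := ler_distD (g t0) (g t) (a t0 * h ^+ n).
  rewrite [`|a t * _ - g t|]distrC [`|g t - g t0|]distrC.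
  move: Q1 Q2 Q3 DhE; set X1 := `|_|; set X2 := `|_|; set X3 := `|_|.
  set X4 := `|_|; set X5 := `|_|; lra.
(* since [a] is continuous, the terms of degree at most [n] in the Taylor
   polynomial on the diagonal add up to [a t0 * s ^ n] *)
pose b j := coef j (k'^~ t0) - (j == n)%:R * a t0.
have bsum s : \sum_(j < n.+2) b j * s ^+ j =
    \sum_(j < n.+2) coef j (k'^~ t0) * s ^+ j - a t0 * s ^+ n.
  under eq_bigr do rewrite mulrBl.
  rewrite sumrB; congr (_ - _); rewrite (bigD1 (Ordinal (leqnSn n.+1)))//= eqxx mul1r.
  by rewrite big1 ?addr0// => j /negbTE jn; rewrite -val_eqE/= in jn; rewrite jn !mul0r.
have b0 j : (j <= n)%N -> b j = 0.
  move=> jn; apply: (@poly_littleo n.+2 n b) => //; last by rewrite ltnS leqW.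
  move=> eta eta0; have eta2 : 0 < eta / 2 by rewrite divr_gt0.
  have [d d0 Hd] := cont _ eta2.
  have DC : 0 <= `|D + C2| by [].
  pose d1 := Num.min (Num.min d e) (Num.min rho (Num.min (e2 / 2)
    (Num.min 1 (eta / 2 / (`|D + C2| + 1))))).
  have d10 : 0 < d1 by rewrite !lt_min d0 e0 rho0 ltr01 !divr_gt0// ltr_wpDl.
  exists d1 => // s s0; rewrite !lt_min => /and3P[/andP[sd se] srho /and3P[se2 s1 seta]].
  rewrite bsum distrC.
  have := expand s se (ltW srho) (ltW se2).
  have := Hd (t0 + s); rewrite addrAC subrr add0r => /(_ sd) Ha.
  have Q1 : `|a t0 * s ^+ n - a (t0 + s) * s ^+ n| <= eta / 2 * `|s| ^+ n.
    by rewrite -mulrBl normrM normrX distrC ler_wpM2r// exprn_ge0.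
  have Q2 : (D + C2) * `|s| ^+ n.+2 <= eta / 2 * `|s| ^+ n.
    rewrite -addn2 exprD mulrCA mulrC ler_wpM2r ?exprn_ge0//.
    apply: (@le_trans _ _ ((`|D + C2| + 1) * `|s|)); last first.
      by rewrite mulrC -ler_pdivlMr ?ltr_wpDl// ltW.
    rewrite expr2 mulrA ler_wpM2r//; apply: (@le_trans _ _ (`|D + C2| * 1)).
      by rewrite (le_trans (ler_wpM2r _ (ler_norm _)))// ler_wpM2l// ltW.
    by rewrite mulr1 lerDl.
  have := ler_distD (a (t0 + s) * s ^+ n) (a t0 * s ^+ n)
    (\sum_(j < n.+2) coef j (k'^~ t0) * s ^+ j).
  move: Q1 Q2; set X1 := `|_|; set X2 := `|_|; set X3 := `|_|; lra.
pose r := Num.min e (Num.min rho (e2 / 2)).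
have r0 : 0 < r by rewrite !lt_min e0 rho0 divr_gt0.
apply: (@is_derive_quad _ _ _ _ (D + C2) r r0) => h h0.
rewrite !lt_min => /and3P[he hrho he2].
have := expand h he (ltW hrho) (ltW he2).
rewrite -[X in `|_ - X|](subrK (a t0 * h ^+ n)) -bsum big_ord_recr/= big1 => [|i _]; last first.
  by rewrite b0 ?mul0r// -ltnS.
rewrite add0r {1}/b eqn_leq ltnn/= mul0r subr0 exprS => H.
rewrite -(ler_pM2r (_ : 0 < `|h| ^+ n)) ?exprn_gt0//.
rewrite -{1}normrX -normrM -mulrA -exprD addnC addn2.
by apply: le_trans H; rewrite le_eqVlt; apply/orP; left; apply/eqP; congr `|_|; ring.
Qed.

Lemma smooth_coef k n : bismooth k -> smoothR (fun t => coef n (k^~ t)).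
Proof.
move=> sk; apply: (@smooth_coind R
  (fun F => exists n k, bismooth k /\ F = fun t => coef n (k^~ t))); last by exists n, k.
move=> _ [{}n [{}k [{}sk ->]]].
have [k' sk' dk] := bismooth_coef_derive n sk.
by exists (fun t => coef n.+1 (k'^~ t)); first by exists n.+1, k'.
Qed.

Lemma bismooth_derive k : bismooth k -> bismooth (fun s t => derive1 (k^~ t) s).
Proof.
move=> sk a b sa sb.
pose k1 s t := k (a t + 1 * s) (b t).
have sk1 : bismooth k1.
  move=> c d sc sd; apply: sk; last exact: smooth_comp.
  exact: (smoothRD _ _ (smooth_comp sa sd) (smooth_scale 1 sc)).
have := smooth_coef (n := 1) sk1; congr smoothR; apply/funext => t.
rewrite /coef /k1 (@deriven_affine R (k^~ (b t))); last exact: bismooth_l.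
by rewrite expr1n mul1r mulr0 addr0 divr1.
Qed.

Lemma bismooth_deriven k n : bismooth k -> bismooth (fun s t => derive1n n (k^~ t) s).
Proof.
move=> sk; elim: n => [//|n /bismooth_derive].
congr bismooth; apply/funext => s; apply/funext => t.
Qed.

End PartialDerivative.

Arguments bismooth_deriven {R} [k] n _.

Section CompactBound.
Variable R : realType.
Implicit Types (k : R -> R -> R).

Lemma bismooth_compact_bounded k n (T t0 : R) : bismooth k ->
  exists2 e : R, 0 < e & exists C : R, forall s t, `|s| <= T -> `|t - t0| < e ->
    `|derive1n n (k^~ t) s| <= C.
Proof.
move=> sk.
have /compact_near_coveringP cpt := @segment_compact R (- T) T.
pose F := filter_prod (nbhs t0) (nbhs (pinfty_nbhs R)).
pose P (i : R * R) s := `|derive1n n (k^~ i.1) s| <= i.2.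
have := cpt _ (filter_prod (nbhs t0) (pinfty_nbhs R)) P _.
case=> [s0 _|[A B] /= [tA [M [_ MB]]] AB].
  have [e e0 [C HC]] := bismooth_locally_bounded n s0 t0 sk.
  exists ([set s | `|s - s0| < e], [set i | `|i.1 - t0| < e /\ C < i.2]) => /=.
    split.
      by exists e => //= y; rewrite /ball_/= distrC.
    exists ([set t | `|t - t0| < e], [set c | C < c]) => /=.
      split; first by exists e => //= y; rewrite /ball_/= distrC.
      by exists C; split=> //; exact: num_real.
    by move=> [t c] /= [].
  by move=> [s [t c]] /= [ss [tt Cc]]; apply: (le_trans (HC _ _ ss tt)); exact: ltW.
move: tA => [e /= e0 eA]; exists e => //; exists (M + 1) => s t sT te.
have := AB (t, M + 1) => /=; apply; last by rewrite /= in_itv/= -ler_norml.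
split=> /=; first by apply: eA; rewrite /ball_/= distrC.
by apply: MB; rewrite ltrDl.
Qed.

End CompactBound.

(** * Division with parameters *)

Section DyadicIntegral.
Variable R : realType.
Implicit Types (g f : R -> R) (k : R -> R -> R).

Definition dyadic i j : R := j%:R * 2^-1 ^+ i.

Definition dyadic_gap g i : R := \sum_(j < 2 ^ i)
  (g (dyadic i.+1 (2 * j).+1) - g (dyadic i.+1 (2 * j))).

(** The integral of [g] from 0 to 1, as the limit of the Riemann sums with step
    [2^-n]; the difference of two consecutive sums is [weight n] times a bounded
    sequence, so that these sums depend smoothly on parameters. *)
Definition dyadic_integral g : R := g 0 + wsum (dyadic_gap g).

Let riemann g n : R := 2^-1 ^+ n * \sum_(j < 2 ^ n) g (dyadic n j).

Let big_double m (F : nat -> R) :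
  \sum_(j < 2 * m) F j = \sum_(j < m) (F (2 * j)%N + F (2 * j).+1).
Proof.
elim: m => [|m IHm]; first by rewrite !big_ord0.
rewrite mulnS 2!big_ord_recr/= IHm [RHS]big_ord_recr/= addrA.
by rewrite mulnC.
Qed.

Let dyadicS i j : dyadic i.+1 (2 * j) = dyadic i j.
Proof.
by rewrite /dyadic natrM exprS mulrACA mulfV ?pnatr_eq0// mul1r.
Qed.

Let riemannS g n : riemann g n.+1 = riemann g n + weight R n * dyadic_gap g n.
Proof.
rewrite /riemann /dyadic_gap expnS.
rewrite (big_double (2 ^ n) (fun j => g (dyadic n.+1 j))) /weight sumrB.
under [in LHS]eq_bigr do rewrite dyadicS.
under [X in _ - X]eq_bigr do rewrite dyadicS.
rewrite big_split/= exprS.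
set x := \sum_(_ < _) _; set y := \sum_(_ < _) _; set z := 2^-1 ^+ n.
by field.
Qed.

Let riemannE g n : riemann g n = g 0 + series (fun i => weight R i * dyadic_gap g i) n.
Proof.
elim: n => [|n IHn].
  rewrite /riemann expr0 mul1r expn0 big_ord1 /series/= big_mkord big_ord0 addr0.
  by rewrite /dyadic mul0r.
by rewrite riemannS IHn /series/= !big_mkord big_ord_recr/= addrA.
Qed.

Let dyadic01 i j : (j <= 2 ^ i)%N -> 0 <= dyadic i j <= 1.
Proof.
move=> ji; rewrite /dyadic mulr_ge0 ?exprn_ge0 ?invr_ge0//.
by rewrite exprVn ler_pdivrMr ?exprn_gt0// mul1r -natrX ler_nat.
Qed.

Lemma dyadic_gap_le g i C : smoothR g ->
  (forall x, `|x| <= 2 -> `|derive1 g x| <= C) -> `|dyadic_gap g i| <= C.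
Proof.
move=> sg HC; have C0 : 0 <= C by apply: le_trans (HC 0 _); rewrite ?normr0.
apply: (le_trans (ler_norm_sum _ _ _)).
apply: (@le_trans _ _ (\sum_(j < 2 ^ i) C * 2^-1 ^+ i.+1)); last first.
  rewrite sumr_const card_ord -[leLHS]mulr_natr -mulrA natrX exprS -mulrA.
  by rewrite -exprMn mulVf ?pnatr_eq0// expr1n mulr1 -[leRHS]mulr1 ler_wpM2l// invf_le1// ler1n.
apply: ler_sum => j _.
have d : dyadic i.+1 (2 * j).+1 - dyadic i.+1 (2 * j) = 2^-1 ^+ i.+1.
  by rewrite /dyadic -mulrBl -natrB// subSnn mul1r.
have /andP[d0 d1] : 0 <= dyadic i.+1 (2 * j) <= 1.
  by apply: dyadic01; rewrite expnS leq_mul2l/= ltnW.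
have h0 : (0:R) <= 2^-1 ^+ i.+1 by rewrite exprn_ge0// invr_ge0.
have h1 : (2^-1:R) ^+ i.+1 <= 1 by rewrite exprn_ile1 ?invr_ge0// invf_le1// ler1n.
rewrite -[in leRHS]d -[X in _ * X]ger0_norm ?d//; rewrite -[in leRHS]d.
apply: mvt_le => // x; rewrite d (ger0_norm h0) => xd; apply: HC.
rewrite -[x](subrK (dyadic i.+1 (2 * j))).
apply: (le_trans (ler_normD _ _)); rewrite (ger0_norm d0).
by move: xd; set z := `|_ - _|; lra.
Qed.

Lemma dyadic_gap_bdd g : smoothR g -> bddseq (dyadic_gap g).
Proof.
move=> sg; have sk : bismooth (fun s _ => g s) := bismooth_fst sg.
have [e e0 [C HC]] := bismooth_compact_bounded 1 2 0 sk.
exists C => i; apply: dyadic_gap_le => // x x2.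
by apply: (HC x 0 x2); rewrite subrr normr0.
Qed.

Lemma dyadic_integral_derive f : smoothR f ->
  dyadic_integral (derive1 f) = f 1 - f 0.
Proof.
move=> sf; have sf' := smooth_derive sf.
have sk : bismooth (fun s _ => f s) := bismooth_fst sf.
have [e e0 [C HC]] := bismooth_compact_bounded 2 2 0 sk.
have {}HC x : `|x| <= 2 -> `|derive1n 2 f x| <= C.
  by move=> x2; apply: (HC x 0 x2); rewrite subrr normr0.
have C0 : 0 <= C by apply: le_trans (HC 0 _); rewrite ?normr0.
suff H : series (fun i => weight R i * dyadic_gap (derive1 f) i) @ \oo -->
    f 1 - f 0 - derive1 f 0.
  by rewrite /dyadic_integral (wsum_lim H) addrC subrK.
have -> : series (fun i => weight R i * dyadic_gap (derive1 f) i) =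
    (fun n => riemann (derive1 f) n - derive1 f 0).
  by apply/funext => n; rewrite riemannE addrC addrA addNr add0r.
apply: cvgB; last exact: cvg_cst.
have bnd n : `|f 1 - f 0 - riemann (derive1 f) n| <= C * 2^-1 ^+ n.
  have -> : f 1 - f 0 = \sum_(j < 2 ^ n) (f (dyadic n j.+1) - f (dyadic n j)).
    rewrite -(big_mkord xpredT (fun j => f (dyadic n j.+1) - f (dyadic n j))).
    rewrite telescope_sumr// /dyadic mul0r natrX -exprMn mulfV ?pnatr_eq0//.
    by rewrite expr1n.
  rewrite /riemann mulr_sumr -sumrB; apply: (le_trans (ler_norm_sum _ _ _)).
  apply: (@le_trans _ _ (\sum_(j < 2 ^ n) C * `|2^-1 ^+ n| ^+ 2)); last first.
    rewrite sumr_const card_ord -[leLHS]mulr_natr -mulrA ler_wpM2l//.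
    rewrite ger0_norm ?exprn_ge0 ?invr_ge0// expr2 -mulrA natrX.
    by rewrite -exprMn mulVf ?pnatr_eq0// expr1n mulr1.
  apply: ler_sum => j _.
  have d : dyadic n j.+1 = dyadic n j + 2^-1 ^+ n.
    by rewrite /dyadic -natr1 mulrDl mul1r.
  have /andP[d0 d1] : 0 <= dyadic n j <= 1 by apply: dyadic01; rewrite ltnW.
  have h0 : (0:R) <= 2^-1 ^+ n by rewrite exprn_ge0// invr_ge0.
  have h1 : (2^-1:R) ^+ n <= 1 by rewrite exprn_ile1 ?invr_ge0// invf_le1// ler1n.
  rewrite d; apply: taylor2 => // x xd; apply: HC.
  rewrite -[x](subrK (dyadic n j)).
  apply: (le_trans (ler_normD _ _)); rewrite (ger0_norm d0).
  by move: xd; rewrite (ger0_norm h0); set z := `|_ - _|; lra.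
apply/cvgrPdist_le => eps eps0.
have := @cvg_expr R 2^-1; rewrite ger0_norm ?invr_ge0// invf_lt1// ltr1n => /(_ isT).
move/cvgrPdist_le/(_ (eps / (C + 1))) => /(_ (divr_gt0 eps0 (ltr_wpDl C0 ltr01))) H.
near=> n; apply: (le_trans (bnd n)).
apply: (@le_trans _ _ ((C + 1) * 2^-1 ^+ n)).
  by rewrite ler_wpM2r ?exprn_ge0 ?invr_ge0// lerDl.
rewrite mulrC -ler_pdivlMr ?ltr_wpDl//.
have : `|0 - (2^-1 : R) ^+ n| <= eps / (C + 1) by near: n; exact: H.
by rewrite sub0r normrN ger0_norm// exprn_ge0// invr_ge0.
Unshelve. all: by end_near. Qed.

Lemma dyadic_integralZ (a : R) g : smoothR g ->
  dyadic_integral (fun x => a * g x) = a * dyadic_integral g.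
Proof.
move=> sg; rewrite /dyadic_integral mulrDr -wsumZ; last exact: dyadic_gap_bdd.
congr (_ + wsum _); apply/funext => i; rewrite mulr_sumr.
by apply: eq_bigr => j _; rewrite mulrBr.
Qed.

Lemma deriven_sum (I : Type) (r : seq I) (F : I -> R -> R) n :
  (forall i, smoothR (F i)) ->
  derive1n n (fun x => \sum_(i <- r) F i x) = (fun x => \sum_(i <- r) derive1n n (F i) x).
Proof.
move=> sF; elim: r => [|i r IHr].
  rewrite (_ : (fun x => _) = fun=> 0); last by apply/funext => x; rewrite big_nil.
  by rewrite deriven0; apply/funext => x; rewrite big_nil.
rewrite (_ : (fun x => _) = fun x => F i x + \sum_(j <- r) F j x); last first.
  by apply/funext => x; rewrite big_cons.
rewrite derivenD//; last exact: smooth_sum.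
by rewrite IHr; apply/funext => x; rewrite big_cons.
Qed.

Lemma smooth_dyadic_integral k : bismooth k ->
  smoothR (fun t => dyadic_integral (k^~ t)).
Proof.
move=> sk; apply: (smoothRD _ _ (bismooth_r (s := 0) sk)).
apply: wsum_smooth; split=> [i|m t0].
  by apply: smooth_sum => j; apply: smooth_sub; exact: bismooth_r.
pose km s t := derive1n m (k s) t.
have skm : bismooth km.
  by apply: bismooth_swap; apply: bismooth_deriven; exact: bismooth_swap.
have [e e0 [C HC]] := bismooth_compact_bounded 1 2 t0 skm.
exists e => //; exists C => i t te.
rewrite deriven_sum; last by move=> j; apply: smooth_sub; exact: bismooth_r.
rewrite (_ : \sum_(j < _) _ = dyadic_gap (km^~ t) i); last first.
  by apply: eq_bigr => j _; rewrite derivenB//; exact: bismooth_r.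
apply: dyadic_gap_le; first exact: bismooth_l.
by move=> x x2; have := HC x t x2 te; rewrite derive1n1.
Qed.

(** The quotient of [f s - f 0] by [s], extended by continuity to [s = 0]. *)
Definition hadamard f s : R := dyadic_integral (fun u => derive1 f (u * s)).

Lemma hadamardE f s : smoothR f -> f s = f 0 + s * hadamard f s.
Proof.
move=> sf; have sfs : smoothR (fun u => f (0 + s * u)).
  apply: (smooth_comp sf); apply: (smoothRD _ _ (smoothR_cst 0)).
  exact/smooth_scale/smooth_id.
have := dyadic_integral_derive sfs.
rewrite add0r mulr1 mulr0 addr0 => H.
rewrite -[LHS](subrK (f 0)) -H addrC; congr (_ + _).
rewrite -dyadic_integralZ.
  congr dyadic_integral; apply/funext => u.
  rewrite -[in LHS]derive1n1 deriven_affine// expr1 add0r derive1n1.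
  by rewrite [s * u]mulrC.
apply: (smooth_comp (smooth_derive sf)).
by under [X in smoothR X]funext do rewrite mulrC; exact/smooth_scale/smooth_id.
Qed.

Lemma bismooth_hadamard k : bismooth k -> bismooth (fun s t => hadamard (k^~ t) s).
Proof.
move=> sk a b sa sb.
pose k1 u t := derive1 (k^~ (b t)) (u * a t).
apply: (@smooth_dyadic_integral k1); move=> c d sc sd.
apply: (bismooth_derive sk); last exact: smooth_comp.
exact: (smoothRM _ _ sc (smooth_comp sa sd)).
Qed.

End DyadicIntegral.

(** * Curves of functions that are smooth in the weak sense *)

Section WeaklySmooth.
Variable R : realType.
Implicit Types (c : R -> R -> R) (p w : nat -> R).

(** The curve [c] in the space of smooth functions on the line becomes smooth
    under the functionals that are needed for the gliding hump argument. *)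
Definition weakly_smooth c :=
  (forall s, smoothR (c s)) /\
  forall n T p w, (forall i, `|p i| <= T) -> (forall i, 0 <= w i <= 1) ->
    smoothR (fun s => wsum (fun i => w i * derive1n n (c s) (p i))).

Lemma smooth_bound (f : R -> R) T : smoothR f ->
  exists C : R, forall x, `|x| <= T -> `|f x| <= C.
Proof.
move=> sf; have [e e0 [C HC]] := bismooth_compact_bounded 0 T 0 (bismooth_fst sf).
by exists C => x xT; apply: (HC x 0 xT); rewrite subrr normr0.
Qed.

Lemma smooth_bound1 (f : R -> R) x : smoothR f ->
  exists2 C : R, 0 <= C & forall y, `|y - x| <= 1 -> `|f y| <= C.
Proof.
move=> sf; have [C HC] := @smooth_bound f (`|x| + 1) sf.
exists C; first by apply: le_trans (HC x _); rewrite ?lerDl.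
move=> y yx; apply: HC; rewrite -[y](subrK x) addrC.
by apply: (le_trans (ler_normD _ _)); rewrite lerD2l.
Qed.

Lemma norm_le_dist (a b : R) : `|a| <= `|a - b| + `|b|.
Proof. by rewrite -{1}(subrK b a) ler_normD. Qed.

Lemma le_small (a b C : R) :
  (forall h, 0 < h -> h <= 1 -> a <= b + C * h) -> a <= b.
Proof.
move=> H; apply/ler_addgt0Pr => e e0.
pose h := Num.min 1 (e / (`|C| + 1)).
have C1 : 0 < `|C| + 1 by rewrite ltr_wpDl.
have h0 : 0 < h by rewrite lt_min ltr01 divr_gt0.
apply: (le_trans (H h h0 _)); first by rewrite ge_min lexx.
rewrite lerD2l; apply: (@le_trans _ _ ((`|C| + 1) * h)).
  by rewrite ler_pM2r// (le_trans (ler_norm C))// lerDl.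
by rewrite mulrC -ler_pdivlMr// ge_min lexx orbT.
Qed.

Lemma bismooth_weakly k : bismooth k -> weakly_smooth k.
Proof.
move=> sk; split=> [s|n T p w pT w01]; first exact: bismooth_r.
pose kn s t := derive1n n (k s) t.
have skn : bismooth kn.
  exact: (bismooth_swap (bismooth_deriven n (bismooth_swap sk))).
apply: wsum_smooth; split=> [i|m s0].
  exact: (smooth_scale (w i) (bismooth_l (t := p i) skn)).
pose km t s := derive1n m (kn^~ t) s.
have skm : bismooth km.
  exact: (bismooth_swap (bismooth_deriven m skn)).
have [e e0 [C HC]] := bismooth_compact_bounded 0 T s0 skm.
exists e => //; exists C => i s se.
rewrite (derivenZ (w i) m (bismooth_l (t := p i) skn)).
have /andP[wi0 wi1] := w01 i.
rewrite normrM ger0_norm// -[leRHS]mul1r ler_pM//.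
exact: (HC (p i) s (pT i) se).
Qed.

Lemma weakly_smooth_point c n t : weakly_smooth c ->
  smoothR (fun s => derive1n n (c s) t).
Proof.
move=> [_ lc].
have sw : smoothR (fun s => wsum (fun i => (i == 0%N)%:R * derive1n n (c s) t)).
  apply: (lc n `|t| (fun=> t) (fun i => (i == 0%N)%:R)) => // i.
  by case: (i == 0%N); rewrite ?ler01 ?lexx.
have := smooth_scale (weight R 0)^-1 sw; congr smoothR.
apply/funext => s; rewrite (@wsum_single _ _ 0%N) => [|i /eqP/negbTE ->].
  by rewrite eqxx mul1r mulKf// gt_eqF// weight_gt0.
by rewrite mul0r.
Qed.

Arguments weakly_smooth_point [c] n t _.

Lemma weakly_smoothD c c' : weakly_smooth c -> weakly_smooth c' ->
  weakly_smooth (fun s t => c s t + c' s t).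
Proof.
move=> [s1 l1] [s2 l2]; split=> [s|n T p w pT w01].
  exact: (smoothRD _ _ (s1 s) (s2 s)).
have := smoothRD _ _ (l1 n T p w pT w01) (l2 n T p w pT w01).
congr smoothR; apply/funext => s.
have bd d : (forall s, smoothR (d s)) -> bddseq (fun i => w i * derive1n n (d s) (p i)).
  move=> sd; have [C HC] := smooth_bound T (smooth_deriven n (sd s)).
  exists C => i; have /andP[wi0 wi1] := w01 i.
  by rewrite normrM ger0_norm// -[leRHS]mul1r ler_pM// HC.
rewrite -wsumD; [|exact: bd..].
by congr wsum; apply/funext => i; rewrite derivenD// mulrDr.
Qed.

Lemma weakly_smooth_derive_inner c : weakly_smooth c ->
  weakly_smooth (fun s => derive1 (c s)).
Proof.
move=> [sc lc]; split=> [s|n T p w pT w01]; first exact: smooth_derive.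
have := lc n.+1 T p w pT w01; congr smoothR.
by apply/funext => s; congr wsum; apply/funext => i; rewrite derive1Sn.
Qed.

Section OuterDerivative.
Variable c : R -> R -> R.
Hypothesis wc : weakly_smooth c.

Let F n p w (s : R) : R := wsum (fun i => w i * derive1n n (c s) (p i)).

Let Q (s : R) n (h t : R) : R := h^-1 * (derive1n n (c (s + h)) t - derive1n n (c s) t).

Let G n (s t : R) : R := derive1 (fun s => derive1n n (c s) t) s.

Let Fbdd n (T : R) p w (s : R) : (forall i, `|p i| <= T) -> (forall i, 0 <= w i <= 1) ->
  bddseq (fun i => w i * derive1n n (c s) (p i)).
Proof.
move=> pT w01; have [C HC] := smooth_bound T (smooth_deriven n (wc.1 s)).
exists C => i; have /andP[wi0 wi1] := w01 i.
by rewrite normrM ger0_norm// -[leRHS]mul1r ler_pM// HC.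
Qed.

Let FQ s n h (T : R) p w : (forall i, `|p i| <= T) -> (forall i, 0 <= w i <= 1) ->
  wsum (fun i => w i * Q s n h (p i)) = h^-1 * (F n p w (s + h) - F n p w s).
Proof.
move=> pT w01; rewrite -wsumB; [|exact: Fbdd pT w01..].
rewrite -wsumZ; last by apply: bddseqB; exact: Fbdd pT w01.
by congr wsum; apply/funext => i; rewrite /Q mulrCA mulrBr.
Qed.

Let Qbdd s n h (T : R) p w : (forall i, `|p i| <= T) -> (forall i, 0 <= w i <= 1) ->
  bddseq (fun i => w i * Q s n h (p i)).
Proof.
move=> pT w01.
have := bddseqZ h^-1 (bddseqB (Fbdd n (s + h) pT w01) (Fbdd n s pT w01)).
by congr bddseq; apply/funext => i; rewrite /Q -mulrBr mulrCA.
Qed.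

Let quotient (f : R -> R) (s C h : R) : smoothR f ->
  (forall y, `|y - s| <= 1 -> `|derive1n 2 f y| <= C) -> 0 < `|h| -> `|h| <= 1 ->
  `|h^-1 * (f (s + h) - f s) - derive1 f s| <= C * `|h|.
Proof.
move=> sf HC h0 h1.
have H : `|f (s + h) - f s - h * derive1 f s| <= C * `|h| ^+ 2.
  by apply: taylor2 => // y yh; apply: HC; exact: le_trans h1.
have hn0 : h != 0 by rewrite -normr_gt0.
rewrite -(ler_pM2l h0) -normrM mulrBr mulrA mulfV// mul1r.
by rewrite mulrCA -expr2.
Qed.

(* The second differences of [c] are bounded under all the functionals, hence
   uniformly on bounded sets together with their derivatives. *)
Let second_difference s n (T : R) : exists2 K : R, 0 <= K & forall h h' t,
  0 < `|h| -> `|h| <= 1 -> 0 < `|h'| -> `|h'| <= 1 -> `|t| <= T ->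
  `|Q s n h t - Q s n h' t| <= K * (`|h| + `|h'|).
Proof.
pose B := {b : R * R | [/\ 0 < `|b.1|, `|b.1| <= 1, 0 < `|b.2| & `|b.2| <= 1]}.
pose P := {t : R | `|t| <= T}.
pose u (b : B) (t : P) := (`|(sval b).1| + `|(sval b).2|)^-1 *
  (Q s n (sval b).1 (sval t) - Q s n (sval b).2 (sval t)).
have [b|p w w01|K HK] := @gliding_hump R B P u.
- have sQ h : smoothR (Q s n h).
    by apply/smooth_scale/smooth_sub; apply: smooth_deriven; exact: wc.1.
  have [C HC] := smooth_bound T (smooth_scale (`|(sval b).1| + `|(sval b).2|)^-1
    (smooth_sub (sQ (sval b).1) (sQ (sval b).2))).
  by exists C => -[t tT]; exact: HC.
- pose p' i := sval (p i); have pT i : `|p' i| <= T by exact: svalP (p i).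
  have sF : smoothR (F n p' w) := wc.2 n T p' w pT w01.
  have [C C0 HC] := smooth_bound1 s (smooth_deriven 2 sF).
  exists C => -[[h h'] [/= h0 h1 h'0 h'1]]; rewrite /u /=.
  have S0 : 0 < `|h| + `|h'| by rewrite addr_gt0.
  have -> : wsum (fun i => w i * ((`|h| + `|h'|)^-1 *
      (Q s n h (sval (p i)) - Q s n h' (sval (p i))))) =
      (`|h| + `|h'|)^-1 * (h^-1 * (F n p' w (s + h) - F n p' w s) -
        h'^-1 * (F n p' w (s + h') - F n p' w s)).
    rewrite -(FQ s n h pT w01) -(FQ s n h' pT w01) -wsumB; [|exact: Qbdd pT w01..].
    rewrite -wsumZ; last by apply: bddseqB; exact: Qbdd pT w01.
    by congr wsum; apply/funext => i; rewrite mulrCA mulrBr.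
  rewrite normrM gtr0_norm ?invr_gt0// ler_pdivrMl// mulrDl ![_ * C]mulrC.
  apply: (le_trans (ler_distD (derive1 (F n p' w) s) _ _)).
  apply: lerD; first exact: quotient.
  by rewrite distrC; exact: quotient.
exists `|K| => // h h' t h0 h1 h'0 h'1 tT.
have S0 : 0 < `|h| + `|h'| by rewrite addr_gt0.
have := HK (exist _ (h, h') (And4 h0 h1 h'0 h'1)) (exist _ t tT).
rewrite /u /= normrM gtr0_norm ?invr_gt0// ler_pdivrMl// => H.
by apply: (le_trans H); rewrite mulrC ler_pM2r// ler_norm.
Qed.

Let QG s n (T : R) : exists2 K : R, 0 <= K & forall h t,
  0 < `|h| -> `|h| <= 1 -> `|t| <= T -> `|Q s n h t - G n s t| <= K * `|h|.
Proof.
have [K K0 HK] := second_difference s n T; exists K => // h t h0 h1 tT.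
have sf := weakly_smooth_point n t wc.
have [C C0 HC] := smooth_bound1 s (smooth_deriven 2 sf).
apply: (@le_small _ _ (K + C)) => h' h'0 h'1.
have nh' : `|h'| = h' by rewrite gtr0_norm.
apply: (le_trans (ler_distD (Q s n h' t) _ _)).
have Q1 := HK h h' t h0 h1; rewrite nh' in Q1.
have {}Q1 := Q1 h'0 h'1 tT.
have := quotient sf HC; rewrite -/(G n s t) => /(_ h'); rewrite nh' => /(_ h'0 h'1) Q2.
have -> : K * `|h| + (K + C) * h' = K * (`|h| + h') + C * h' by ring.
exact: lerD.
Qed.

Let dG n (s t : R) : is_derive t 1 (G n s) (G n.+1 s t).
Proof.
pose T := `|t| + 1.
have tT : `|t| <= T by rewrite lerDl.
have [K0 K00 HK0] := QG s n T; have [K1 K10 HK1] := QG s n.+1 T.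
have [K2 K20 HK2] := QG s n.+2 T.
have sQ m h : smoothR (Q s m h).
  by apply/smooth_scale/smooth_sub; apply: smooth_deriven; exact: wc.1.
have dQ m h : derive1 (Q s m h) = Q s m.+1 h.
  apply/funext => x; rewrite -derive1n1 derivenZ; last first.
    by apply: smooth_sub; apply: smooth_deriven; exact: wc.1.
  by rewrite derivenB ?derive1n1 -?derive1nS//; apply: smooth_deriven; exact: wc.1.
have [C3 HC3] := smooth_bound T (sQ n.+2 1).
pose C := C3 + 2 * K2.
apply: (@is_derive_quad _ _ _ _ C 1 ltr01) => x x0 x1.
have xT : `|t + x| <= T by apply: (le_trans (ler_normD _ _)); rewrite lerD2l ltW.
apply: (@le_small _ _ (K0 + K0 + K1)) => h h0 h1.
have nh : `|h| = h by rewrite gtr0_norm.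
have nh0 : 0 < `|h| by rewrite nh.
have nh1 : `|h| <= 1 by rewrite nh.
have taylorQ : `|Q s n h (t + x) - Q s n h t - x * Q s n.+1 h t| <= C * `|x| ^+ 2.
  rewrite -dQ; apply: taylor2 => // y yx.
  rewrite derive1nS derive1n1 dQ dQ.
  have yT : `|y| <= T.
    rewrite -[y](subrK t) addrC; apply: (le_trans (ler_normD _ _)).
    by rewrite lerD2l (le_trans yx)// ltW.
  have n1 : 0 < `|1 : R| by rewrite normr1.
  have n1' : `|1 : R| <= 1 by rewrite normr1.
  have Kh : K2 * h <= K2 by rewrite -[leRHS]mulr1 ler_wpM2l.
  have chain (q qh g : R) : `|q| <= C3 -> `|q - g| <= K2 -> `|qh - g| <= K2 * h ->
      `|qh| <= C.
    have := norm_le_dist qh q; have := ler_distD g qh q.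
    rewrite (distrC g) /C; lra.
  have b1 := HK2 1 y n1 n1' yT; rewrite normr1 mulr1 in b1.
  have b2 := HK2 h y nh0 nh1 yT; rewrite nh in b2.
  exact: (chain _ _ _ (HC3 y yT) b1 b2).
have q1 := HK0 h (t + x) nh0 nh1 xT.
have q2 := HK0 h t nh0 nh1 tT.
have q3 := HK1 h t nh0 nh1 tT; rewrite nh in q1 q2 q3.
have {}q3 : `|x * (Q s n.+1 h t - G n.+1 s t)| <= K1 * h.
  rewrite normrM -[leRHS]mul1r ler_pM// ltW//.
have -> : G n s (t + x) - G n s t - x * G n.+1 s t =
    (Q s n h (t + x) - Q s n h t - x * Q s n.+1 h t) +
    ((Q s n h t - G n s t) - (Q s n h (t + x) - G n s (t + x)) +
     x * (Q s n.+1 h t - G n.+1 s t)) by ring.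
apply: (le_trans (ler_normD _ _)); apply: lerD => //.
rewrite !mulrDl; apply: (le_trans (ler_normD _ _)); apply: lerD => //.
by apply: (le_trans (ler_normB _ _)); exact: lerD.
Qed.

Let Gn n s : derive1n n (G 0 s) = G n s.
Proof.
elim: n => [//|n IHn]; rewrite derive1nS IHn.
by apply/funext => t; exact: (is_derive_derive1 (dG n s t)).
Qed.

Let sG n s : smoothR (G n s).
Proof.
apply: (@smooth_coind R (fun f => exists n, f = G n s)); last by exists n.
move=> _ [m ->]; exists (G m.+1 s); first by exists m.+1.
by move=> t; exact: dG.
Qed.

Lemma weakly_smooth_derive_outer : weakly_smooth (fun s t => derive1 (c^~ t) s).
Proof.
split=> [s|n T p w pT w01]; first exact: (@sG 0 s).
have sF : smoothR (F n p w) := wc.2 n T p w pT w01.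
have := smooth_derive sF; congr smoothR; apply/funext => s.
rewrite -/(G 0 s) Gn; apply/eqP; rewrite eq_sym -subr_eq0 -normr_le0.
have [K K0 HK] := QG s n T.
have [C C0 HC] := smooth_bound1 s (smooth_deriven 2 sF).
apply: (@le_small _ _ (K + C)) => h h0 h1; rewrite add0r.
have nh : `|h| = h by rewrite gtr0_norm.
have nh0 : 0 < `|h| by rewrite nh.
have nh1 : `|h| <= 1 by rewrite nh.
have bG : bddseq (fun i => w i * G n s (p i)).
  have [D HD] := smooth_bound T (@sG n s).
  exists D => i; have /andP[wi0 wi1] := w01 i.
  by rewrite normrM ger0_norm// -[leRHS]mul1r ler_pM// HD.
apply: (le_trans (ler_distD (h^-1 * (F n p w (s + h) - F n p w s)) _ _)).
rewrite mulrDl; apply: lerD; last by have := quotient sF HC nh0 nh1; rewrite nh.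
rewrite -(FQ s n h pT w01) distrC -wsumB//; last exact: Qbdd pT w01.
apply: wsum_le => i; have /andP[wi0 wi1] := w01 i.
rewrite -mulrBr normrM ger0_norm// -[leRHS]mul1r ler_pM//.
by have := HK h (p i) nh0 nh1 (pT i); rewrite nh.
Qed.

Lemma is_derive_diag (s : R) :
  is_derive s 1 (fun s => c s s) (derive1 (c^~ s) s + derive1 (c s) s).
Proof.
have [K K0 HK] := QG s 0 (`|s| + 1).
have [C C0 HC] := smooth_bound1 s (smooth_derive (@sG 0 s)).
have [D D0 HD] := smooth_bound1 s (smooth_deriven 2 (wc.1 s)).
apply: (@is_derive_quad _ _ _ _ (K + C + D) 1 ltr01) => h h0 h1.
have hn0 : h != 0 by rewrite -normr_gt0.
have sT : `|s + h| <= `|s| + 1 by apply: (le_trans (ler_normD _ _)); rewrite lerD2l ltW.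
have -> : c (s + h) (s + h) - c s s - h * (derive1 (c^~ s) s + derive1 (c s) s) =
    h * (Q s 0 h (s + h) - G 0 s (s + h)) + h * (G 0 s (s + h) - G 0 s s) +
    (c s (s + h) - c s s - h * derive1 (c s) s).
  by rewrite /Q /G !derive1n0; field.
rewrite 2!mulrDl; apply: (le_trans (ler_normD _ _)); apply: lerD; last first.
  by apply: taylor2 => [|y yh]; [exact: wc.1|apply: HD; rewrite (le_trans yh)// ltW].
have hh X : `|h| * (X * `|h|) = X * `|h| ^+ 2 by rewrite mulrCA -expr2.
apply: (le_trans (ler_normD _ _)); apply: lerD; rewrite normrM -hh ler_wpM2l//.
  by apply: HK => //; exact: ltW.
rewrite -[X in _ * `|X|](_ : s + h - s = h); last by rewrite addrAC subrr add0r.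
apply: mvt_le => // x; rewrite [s + h - s]addrAC subrr add0r => xh.
by apply: HC; rewrite (le_trans xh)// ltW.
Qed.

End OuterDerivative.

(** By [is_derive_diag] the derivative of a diagonal is again the diagonal of a
    weakly smooth curve. *)
Lemma weakly_smooth_diag c : weakly_smooth c -> smoothR (fun s => c s s).
Proof.
move=> wc; apply: (@smooth_coind R
  (fun f => exists2 c, weakly_smooth c & f = fun s => c s s)); last by exists c.
move=> _ {c wc} [c wc ->].
exists (fun s => derive1 (c^~ s) s + derive1 (c s) s); last first.
  by move=> s; exact: is_derive_diag.
exists (fun s t => derive1 (c^~ t) s + derive1 (c s) t).
  2: by [].
apply: weakly_smoothD; first exact: weakly_smooth_derive_outer.
exact: weakly_smooth_derive_inner.
Qed.

End WeaklySmooth.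

(** * The cartesian closed category of Frölicher spaces *)

Section Frolicher.
Variable R : realType.
Implicit Types (X Y Z : frolicher R).

Lemma fcurve_flineP (c : R -> fline R) : fcurve c <-> smoothR (c : R -> R).
Proof. by split=> [/(_ id erefl)|sc _ ->]. Qed.

Lemma fcurve_compP Y (c : R -> Y) :
  fcurve c <-> forall h : Csm Y, smoothR (fun t => h (c t) : R).
Proof.
rewrite fcurveP; split=> [H h|H f /ffunP ff].
  by apply: H; apply/ffunP => d dd; apply/fcurve_flineP; exact: smapP.
have sf : is_smooth (f : Y -> fline R).
  by move=> d dd; apply/fcurve_flineP; exact: ff.
exact: (H (SMap sf)).
Qed.

Lemma id_smooth X : is_smooth (fun x : X => x).
Proof. by []. Qed.

Lemma smooth_gen_by_funs X T (F : set (T -> R)) (k : X -> gen_by_funs F) :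
  (forall f, F f -> is_smooth (fun x => f (k x) : fline R)) -> is_smooth k.
Proof. by move=> H c cc f Ff; apply/fcurve_flineP; exact: (H f Ff c cc). Qed.

Lemma fcurve_fprodP X Y (c : R -> fprod X Y) :
  fcurve c <-> fcurve (fun t => (c t).1) /\ fcurve (fun t => (c t).2).
Proof.
split=> [cc|[c1 c2] _ [[f /ffunP ff ->]|[f /ffunP ff ->]]]; [|exact: ff..].
split; apply/fcurveP => f ff.
  by apply: (cc (f \o fst)); left; exists f.
by apply: (cc (f \o snd)); right; exists f.
Qed.

Lemma fst_smooth X Y : is_smooth (fun p : fprod X Y => p.1 : X).
Proof. by move=> c /fcurve_fprodP[]. Qed.

Lemma snd_smooth X Y : is_smooth (fun p : fprod X Y => p.2 : Y).
Proof. by move=> c /fcurve_fprodP[]. Qed.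

Lemma pair_smooth X Y Z (f : Z -> X) (g : Z -> Y) :
  is_smooth f -> is_smooth g -> is_smooth (fun z => (f z, g z) : fprod X Y).
Proof. by move=> sf sg c cc; apply/fcurve_fprodP; split; [exact: sf|exact: sg]. Qed.

Lemma smooth_compose X Y Z (g : Y -> Z) (f : X -> Y) :
  is_smooth g -> is_smooth f -> is_smooth (fun x => g (f x)).
Proof. by move=> sg sf; exact: (comp_smooth sg sf). Qed.

Lemma fcurve_feuclidP n (c : R -> feuclid R n) :
  fcurve c <-> forall i, smoothR (fun t => c t 0 i).
Proof. by split=> [cc i|cc _ [i ->]]; [exact: (cc (fun x => x 0 i) (ex_intro _ i erefl))|exact: cc]. Qed.

Lemma smooth_feuclid X n (f : X -> feuclid R n) :
  (forall i, is_smooth (fun x => f x 0 i : fline R)) -> is_smooth f.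
Proof. by move=> H; apply: smooth_gen_by_funs => _ [i ->]. Qed.

Lemma coord_smooth n i : is_smooth (fun x : feuclid R n => x 0 i : fline R).
Proof. by move=> c /fcurve_feuclidP/(_ i) ?; apply/fcurve_flineP. Qed.

Lemma smooth_add X (f g : X -> fline R) : is_smooth f -> is_smooth g ->
  is_smooth (fun x => (f x : R) + g x : fline R).
Proof.
move=> sf sg c cc; apply/fcurve_flineP; apply: smoothRD; apply/fcurve_flineP.
  exact: sf.
exact: sg.
Qed.

Lemma smooth_mul X (f g : X -> fline R) : is_smooth f -> is_smooth g ->
  is_smooth (fun x => (f x : R) * g x : fline R).
Proof.
move=> sf sg c cc; apply/fcurve_flineP; apply: smoothRM; apply/fcurve_flineP.
  exact: sf.
exact: sg.
Qed.

(** The curves of the function space are the smooth families. Test functions of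
    the function space are provided by the functionals in the definition of
    [weakly_smooth]. *)
Lemma fcurve_fexpP X Y (c : R -> fexp X Y) :
  fcurve c <-> is_smooth (fun sx : fprod (fline R) X => c sx.1 sx.2 : Y).
Proof.
split=> [cc|sc f]; last exact.
move=> d /fcurve_fprodP[/fcurve_flineP sa cx]; apply/fcurve_compP => h /=.
pose a t : R := (d t).1; pose x t : X := (d t).2.
apply: (@weakly_smooth_diag R (fun s t => h (c (a s) (x t)))).
split=> [s|n T p w pT w01].
  by have /fcurve_compP/(_ h) := smapP (c (a s)) cx.
pose Phi (eta : fexp X Y) : R :=
  wsum (fun i => w i * derive1n n (fun t => h (eta (x t)) : R) (p i)).
suff sPhi : smoothR (Phi \o c) by exact: (smooth_comp sPhi sa).
apply: cc => c0 sc0; apply: (bismooth_weakly _).2 pT w01.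
move=> s t ss st.
have cu : fcurve (fun u => (s u, x (t u)) : fprod (fline R) X).
  apply/fcurve_fprodP; split; first exact/fcurve_flineP.
  apply/fcurve_compP => k; have /fcurve_compP/(_ k) sk := cx.
  exact: (smooth_comp sk st).
by have /fcurve_compP/(_ h) := sc0 _ cu.
Qed.

Lemma smooth_uncurry X Y Z (g : Z -> fexp X Y) : is_smooth g ->
  is_smooth (fun p : fprod Z X => g p.1 p.2 : Y).
Proof.
move=> sg c /fcurve_fprodP[c1 c2]; have /fcurve_fexpP := sg _ c1.
move=> /(_ (fun t => (t : R, (c t).2))); apply; apply/fcurve_fprodP; split=> //.
by apply/fcurve_flineP; exact: smooth_id.
Qed.

Lemma smooth_curry X Y Z (g : Z -> fexp X Y) :
  is_smooth (fun p : fprod Z X => g p.1 p.2 : Y) -> is_smooth g.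
Proof.
move=> sg c cc; apply/fcurve_fexpP => d /fcurve_fprodP[/fcurve_flineP d1 d2].
apply: (sg (fun t => (c (d t).1, (d t).2))); apply/fcurve_fprodP; split=> //.
apply/fcurve_compP => k; have /fcurve_compP/(_ k) sk := cc.
exact: (smooth_comp sk d1).
Qed.

Lemma smooth_eval X Y Z (g : Z -> fexp X Y) (f : Z -> X) : is_smooth g ->
  is_smooth f -> is_smooth (fun z => g z (f z)).
Proof.
move=> /smooth_uncurry sg sf.
exact: (smooth_compose sg (pair_smooth (@id_smooth Z) sf)).
Qed.

Lemma eval_smooth X Y (x : X) : is_smooth (fun g : fexp X Y => g x).
Proof. by apply: smooth_eval; [exact: id_smooth|exact: cst_smooth]. Qed.

Lemma slice_smooth X Y Z (f : fprod X Y -> Z) y :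
  is_smooth f -> is_smooth (fun x => f (x, y)).
Proof.
move=> sf; apply: (smooth_compose sf).
exact: (pair_smooth (@id_smooth X) (@cst_smooth _ _ _ y)).
Qed.

Lemma slice_smooth_r X Y Z (f : fprod X Y -> Z) x :
  is_smooth f -> is_smooth (fun y => f (x, y)).
Proof.
move=> sf; apply: (smooth_compose sf).
exact: (pair_smooth (@cst_smooth _ _ _ x) (@id_smooth Y)).
Qed.

(** The quotient is an integral of the partial derivative, and smooth along curves
    since the parameters may be moved along a curve. *)
Lemma hadamard_smooth Y (f : fprod (fline R) Y -> fline R) : is_smooth f ->
  exists2 g : fprod (fline R) Y -> fline R, is_smooth g &
    forall s y, f (s, y) = (f (0, y) : R) + s * g (s, y) :> R.
Proof.
move=> sf.
exists (fun sy => hadamard (fun s => f (s, sy.2)) sy.1).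
  move=> c /fcurve_fprodP[/fcurve_flineP c1 c2]; apply/fcurve_flineP.
  have := @bismooth_hadamard R (fun s t => f (s, (c t).2)).
  move=> /(_ _ _ id c1 (@smooth_id R)); apply.
  move=> a b sa sb.
  have cu : fcurve (fun u => (a u, (c (b u)).2) : fprod (fline R) Y).
    apply/fcurve_fprodP; split; first exact/fcurve_flineP.
    apply/fcurve_compP => k; have /fcurve_compP/(_ k) sk := c2.
    exact: (smooth_comp sk sb).
  by have /fcurve_flineP := sf _ cu.
move=> s y; apply: (@hadamardE R (fun s => f (s, y))).
have cu : fcurve (fun s => (s, y) : fprod (fline R) Y).
  apply/fcurve_fprodP; split; first by apply/fcurve_flineP; exact: smooth_id.
  by apply: (@cst_smooth R (fline R)); apply/fcurve_flineP; exact: smooth_id.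
by have /fcurve_flineP := sf _ cu.
Qed.

End Frolicher.

(** * Ideals containing a power of the maximal ideal *)

Section Nilpotent.
Variables (R : realType) (n : nat).
Notation E := (feuclid R n).
Implicit Types (J : set (Csm E)) (Y : frolicher R).

Definition coordinate i : Csm E := SMap (@coord_smooth R n i).

Lemma ideal0 J : is_ideal J -> J 0. Proof. by case. Qed.

Lemma idealD J f g : is_ideal J -> J f -> J g -> J (f + g).
Proof. by case=> _ + _; apply. Qed.

Lemma idealMl J f g : is_ideal J -> J g -> J (f * g).
Proof. by case=> _ _; apply. Qed.

Lemma idealN J f : is_ideal J -> J f -> J (- f).
Proof. by move=> iJ; rewrite -mulN1r; exact: idealMl. Qed.

Lemma idealB J f g : is_ideal J -> J f -> J g -> J (f - g).
Proof. by move=> iJ Jf /(idealN iJ); exact: idealD. Qed.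

Lemma ideal_sum J (I : Type) (r : seq I) (F : I -> Csm E) :
  is_ideal J -> (forall i, J (F i)) -> J (\sum_(i <- r) F i).
Proof.
move=> iJ JF; elim/big_rec: _ => [|i f _ Jf]; first exact: ideal0.
exact: idealD.
Qed.

Definition colon J i : set (Csm E) := [set f | J (coordinate i * f)].

Lemma colon_ideal J i : is_ideal J -> is_ideal (colon J i).
Proof.
move=> iJ; split=> [|f g Jf Jg|f g Jg]; rewrite /colon /=.
- by rewrite mulr0; exact: ideal0.
- by rewrite mulrDr; exact: idealD.
- by rewrite mulrCA; exact: idealMl.
Qed.

(** All the products of [k] coordinates are in [J]. *)
Fixpoint nil_ideal k J : Prop :=
  if k is k'.+1 then forall i, nil_ideal k' (colon J i) else J 1.

Lemma Csm_sumE X (I : Type) (r : seq I) (F : I -> Csm X) (x : X) :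
  (\sum_(i <- r) F i) x = \sum_(i <- r) (F i x : R) :> R.
Proof.
elim: r => [|i r IHr]; first by rewrite !big_nil.
by rewrite !big_cons -IHr.
Qed.

Lemma Csm_eq X (f g : Csm X) : (forall x, f x = g x :> R) -> f = g.
Proof. by move=> fg; apply: smap_eq; apply/funext. Qed.

Lemma CsmDE X (f g : Csm X) (x : X) : (f + g) x = f x + g x :> R.
Proof. by []. Qed.

Lemma CsmBE X (f g : Csm X) (x : X) : (f - g) x = f x - g x :> R.
Proof. by rewrite -[LHS]/((f x : R) + -1 * g x) mulN1r. Qed.

Lemma CsmME X (f g : Csm X) (x : X) : (f * g) x = f x * g x :> R.
Proof. by []. Qed.

Lemma CsmZE X (a : R) (f : Csm X) (x : X) : (a *: f) x = a * f x :> R.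
Proof. by []. Qed.

(** The coordinates are moved from 0 to [x] one after the other; [f i] is [H] with
    the coordinates before [i] moved, as a function of the [i]-th one. *)
Lemma hadamard_euclid Y (H : fprod E Y -> fline R) : is_smooth H ->
  exists2 g : 'I_n -> fprod E Y -> fline R, forall i, is_smooth (g i) &
    forall x y, H (x, y) = (H (0, y) : R) + \sum_i x 0 i * g i (x, y) :> R.
Proof.
move=> sH.
pose f i (p : fprod (fline R) (fprod E Y)) : fline R :=
  H (\row_j (if (j < i)%N then p.2.1 0 j else if (j == i :> nat) then p.1 else 0), p.2.2).
have sf i : is_smooth (f i).
  apply: (smooth_compose sH); apply: pair_smooth; last first.
    exact: (smooth_compose (@snd_smooth _ E Y) (@snd_smooth _ _ _)).
  apply: smooth_feuclid => j.
  have -> : (fun p : fprod (fline R) (fprod E Y) => (\row_j (if (j < i)%N then p.2.1 0 j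
      else if (j == i :> nat) then p.1 else 0) : 'rV[R]_n) 0 j : fline R) =
    (fun p => if (j < i)%N then p.2.1 0 j else if (j == i :> nat) then p.1 else 0).
    by apply/funext => p; rewrite mxE.
  case: (j < i)%N; last case: (j == i :> nat).
  - apply: (smooth_compose (@coord_smooth R n j)).
    exact: (smooth_compose (@fst_smooth _ E Y) (@snd_smooth _ _ _)).
  - exact: fst_smooth.
  - exact: cst_smooth.
have /choice[g Hg] : forall i : 'I_n, exists g : fprod (fline R) (fprod E Y) -> fline R,
    is_smooth g /\ forall s z, f i (s, z) = (f i (0, z) : R) + s * g (s, z) :> R.
  by move=> i; have [g sg gE] := hadamard_smooth (sf i); exists g.
exists (fun i (p : fprod E Y) => g i (p.1 0 i, p)) => [i|x y].
  apply: (smooth_compose (Hg i).1); apply: pair_smooth; last exact: id_smooth.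
  exact: (smooth_compose (@coord_smooth R n i) (@fst_smooth _ _ _)).
pose T i : R := H (\row_j (if (j < i)%N then x 0 j else 0), y).
have T0 : T 0%N = H (0, y).
  by rewrite /T; congr (H (_, _)); apply/rowP => j; rewrite !mxE.
have Tn : T n = H (x, y).
  by rewrite /T; congr (H (_, _)); apply/rowP => j; rewrite !mxE ltn_ord.
rewrite -Tn -T0 -[LHS](subrK (T 0%N)) addrC; congr (_ + _).
rewrite -telescope_sumr// big_mkord; apply: eq_bigr => i _.
have -> : T i.+1 = f i (x 0 i, (x, y)).
  rewrite /T /f/=; congr (H (_, _)); apply/rowP => j; rewrite !mxE ltnS leq_eqVlt.
  by case: ltngtP => // /val_inj ->.
rewrite (Hg i).2 addrC addrA -[X in - T i + X](_ : T i = _) ?addNr ?add0r//.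
by rewrite /T /f/=; congr (H (_, _)); apply/rowP => j; rewrite !mxE; case: ltnP => // _; case: ifP.
Qed.

Fixpoint mon_index k : finType :=
  if k is k'.+1 then (unit + 'I_n * mon_index k')%type else void.

(** The products of less than [k] coordinates. *)
Fixpoint monomial k : mon_index k -> Csm E :=
  if k is k'.+1 return mon_index k -> Csm E then
    fun t => match t with inl _ => 1 | inr (i, s) => coordinate i * monomial s end
  else fun=> 0.

(** Iterated Hadamard expansion of a family of functions. The coefficients are
    smooth functions of the parameter, and the remainder is in [J] for every value
    of the parameter. *)
Lemma nil_expand k J : is_ideal J -> nil_ideal k J ->
  forall Y (H : fprod E Y -> fline R), is_smooth H ->
  exists a : mon_index k -> Csm Y, forall y (Hy : Csm E),
    (forall x, Hy x = H (x, y) :> R) ->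
    J (Hy - \sum_t (a t y : R) *: monomial t).
Proof.
elim: k J => [|k IHk] J iJ nJ Y H sH.
  exists (fun=> 0) => y Hy _; rewrite big1 ?subr0 => [|[]//].
  by rewrite -[Hy]mulr1; exact: idealMl.
have [g sg HE] := hadamard_euclid sH.
have /choice[a Ha] : forall i, exists a : mon_index k -> Csm Y, forall y (Hy : Csm E),
    (forall x, Hy x = g i (x, y) :> R) ->
    colon J i (Hy - \sum_t (a t y : R) *: monomial t).
  by move=> i; exact: (IHk _ (colon_ideal i iJ) (nJ i) Y (g i) (sg i)).
have sH0 : is_smooth (fun y => H (0, y)) := slice_smooth_r (0 : E) sH.
exists (fun t => match t with inl _ => SMap sH0 | inr (i, s) => a i s end) => y Hy HyE.
pose gy i : Csm E := SMap (slice_smooth y (sg i)).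
rewrite (_ : Hy - _ = \sum_i coordinate i * (gy i - \sum_t (a i t y : R) *: monomial t)).
  by apply: ideal_sum => // i; exact: Ha.
apply: Csm_eq => x.
rewrite CsmBE !Csm_sumE big_sumType/= HyE HE.
rewrite [X in _ - (X + _)](bigD1 tt)//= [X in _ - (_ + X + _)]big1 ?addr0 => [|[]]//.
rewrite mulr1 opprD addrA [_ + \sum_i _]addrC addrK.
rewrite (eq_bigr (fun p : 'I_n * mon_index k =>
  (a p.1 p.2 y : R) * ((x 0 p.1 : R) * monomial p.2 x))); last by case.
rewrite -(pair_bigA _ (fun i s => (a i s y : R) * ((x 0 i : R) * monomial s x))).
rewrite -sumrB; apply: eq_bigr => i _.
rewrite mulN1r Csm_sumE mulrBr mulr_sumr; congr (_ - _).
by apply: eq_bigr => t _; rewrite mulrCA.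
Qed.

Lemma nil_pow k J (m : Csm E) : is_ideal J -> nil_ideal k J -> m 0 = 0 :> R -> J (m ^+ k).
Proof.
elim: k J => [|k IHk] J iJ nJ m0; first by rewrite expr0.
have sm : is_smooth (fun p : fprod E (fline R) => m p.1).
  exact: (smooth_compose (smapP m) (@fst_smooth _ _ _)).
have [g sg mE] := hadamard_euclid sm.
pose g0 i : Csm E := SMap (slice_smooth (0 : fline R) (sg i)).
have {}mE : m = \sum_i coordinate i * g0 i.
  by apply: Csm_eq => x; rewrite (mE x 0) m0 add0r Csm_sumE.
rewrite exprS {1}mE mulr_suml; apply: ideal_sum => // i; rewrite -mulrA.
have := idealMl (g0 i) (colon_ideal i iJ) (IHk _ (colon_ideal i iJ) (nJ i) m0).
exact.
Qed.

End Nilpotent.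

(** A function with [f 0 <> 0] is inverted by a geometric series, which is finite
    modulo the ideal. *)
Lemma nil_weil (R : realType) (W : pres R) k :
  (forall f, pideal W f -> f 0 = 0 :> R) -> nil_ideal k (pideal W) -> is_weil W.
Proof.
move=> W0 Wk; have iW := pidealP W; split=> // [f f0|].
  pose c : R := f 0; pose m : Csm _ := 1 - c^-1 *: f.
  have m0 : m 0 = 0 :> R by rewrite /m/= -[LHS]/(1 + -1 * (c^-1 * c) : R) mulVf ?mulr1 ?subrr//; apply/eqP.
  exists (c^-1 *: \sum_(i < k) m ^+ i).
  have -> : f * (c^-1 *: \sum_(i < k) m ^+ i) - 1 = - m ^+ k.
    have -> : f * (c^-1 *: \sum_(i < k) m ^+ i) = (1 - m) * \sum_(i < k) m ^+ i.
      by rewrite /m subKr; apply: Csm_eq => x; rewrite /= mulrCA mulrA.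
    by rewrite -[1 - m]opprB mulNr -subrX1 opprB addrAC subrr add0r.
  by apply: idealN => //; exact: nil_pow.
pose T := mon_index (pdim W) k.
exists #|T|, (fun i => monomial R (enum_val i : T)) => f.
have sf : is_smooth (fun p : fprod (feuclid R (pdim W)) (fline R) => f p.1).
  exact: (smooth_compose (smapP f) (@fst_smooth _ _ _)).
have [a Ha] := nil_expand iW Wk sf.
exists (fun i => a (enum_val i) 0).
have := Ha 0 f (fun=> erefl); congr (pideal W (f - _)).
by rewrite (reindex_onto (@enum_val T predT) enum_rank)//= => [|i _];
  [apply: eq_bigl => i; rewrite enum_valK eqxx|rewrite enum_rankK].
Qed.

(** * Weil prolongations *)

Local Open Scope quotient_scope.
Arguments pull {R X} V W phi u.

Section Prolongation.
Variable R : realType.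
Implicit Types (X Y Z : frolicher R) (V W : pres R).

(** Membership in the ideal of [W], for functions that need not be bundled. *)
Definition in_ideal W (k : 'rV[R]_(pdim W) -> R) : Prop :=
  exists2 K : Csm (feuclid R (pdim W)), pideal W K & forall x, K x = k x :> R.

Lemma in_idealE W (K : Csm (feuclid R (pdim W))) k :
  (forall x, K x = k x :> R) -> in_ideal k <-> pideal W K.
Proof.
move=> Kk; split=> [[K' IK' K'k]|IK]; last by exists K.
by rewrite (_ : K = K')//; apply: Csm_eq => x; rewrite K'k.
Qed.

Lemma in_ideal_ext W (k k' : 'rV[R]_(pdim W) -> R) :
  (forall x, k x = k' x) -> in_ideal k -> in_ideal k'.
Proof. by move=> kk' [K IK Kk]; exists K => // x; rewrite Kk. Qed.

Lemma in_idealB W (k k' : 'rV[R]_(pdim W) -> R) :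
  in_ideal k -> in_ideal k' -> in_ideal (fun x => k x - k' x).
Proof.
move=> [K IK Kk] [K' IK' Kk']; exists (K - K'); first exact: (idealB (pidealP W)).
by move=> x; rewrite CsmBE Kk Kk'.
Qed.

Lemma in_idealD W (k k' : 'rV[R]_(pdim W) -> R) :
  in_ideal k -> in_ideal k' -> in_ideal (fun x => k x + k' x).
Proof.
move=> [K IK Kk] [K' IK' Kk']; exists (K + K'); first exact: (idealD (pidealP W)).
by move=> x; rewrite CsmDE Kk Kk'.
Qed.

Lemma in_ideal0 W : @in_ideal W (fun=> 0).
Proof. by exists 0; first exact: (ideal0 (pidealP W)). Qed.

Lemma in_idealM W (f : Csm (feuclid R (pdim W))) k :
  in_ideal k -> in_ideal (fun x => (f x : R) * k x).
Proof.
move=> [K IK Kk]; exists (f * K); first exact: (idealMl _ (pidealP W)).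
by move=> x; rewrite CsmME Kk.
Qed.

Definition equivW X W (f g : feuclid R (pdim W) -> X) : Prop :=
  f 0 = g 0 /\ forall h : Csm X, in_ideal (fun x => (h (f x) : R) - h (g x)).

Lemma equivW_fmap X Y W (F : X -> Y) (f g : feuclid R (pdim W) -> X) :
  is_smooth F -> equivW f g -> equivW (fun x => F (f x)) (fun x => F (g x)).
Proof.
move=> sF [e H]; split=> [|h]; first by rewrite e.
exact: (H (Csm_comp h (SMap sF))).
Qed.

Lemma cls_eqP X W (f g : feuclid R (pdim W) -> X) : is_smooth f -> is_smooth g ->
  cls W f = cls W g <-> equivW f g.
Proof.
move=> sf sg; rewrite /cls; split.
  move=> /eqmodP/asboolP[]; rewrite !mk_smapE// => e H; split=> // h.
  apply: (in_idealE _).2 (H h) => x.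
  by rewrite CsmBE /= !mk_smapE.
move=> [e H]; apply/eqmodP/asboolP; rewrite !mk_smapE//; split=> // h.
by apply: (in_idealE _).1 (H h) => x; rewrite CsmBE /= !mk_smapE.
Qed.

Lemma cls_rep X W (u : X ⊗ W) : cls W (rep u) = u.
Proof.
rewrite /cls /rep.
have -> : mk_smap (repr u : feuclid R (pdim W) -> X) = repr u.
  by apply: smap_eq; rewrite mk_smapE//; exact: smapP.
exact: reprK.
Qed.

Lemma rep_cls X W (f : feuclid R (pdim W) -> X) : is_smooth f ->
  equivW (rep (cls W f)) f.
Proof. by move=> sf; apply/cls_eqP; [exact: smapP| |exact: cls_rep]. Qed.

Lemma foot_cls X W (f : feuclid R (pdim W) -> X) : is_smooth f ->
  foot (cls W f) = f 0.
Proof. by move=> /rep_cls[]. Qed.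

Lemma fmap_cls X Y W (F : X -> Y) (f : feuclid R (pdim W) -> X) :
  is_smooth F -> is_smooth f -> fmap F (cls W f) = cls W (fun x => F (f x)).
Proof.
move=> sF sf; apply/cls_eqP; first exact: (smooth_compose sF (smapP _)).
  exact: smooth_compose.
by apply: equivW_fmap => //; exact: rep_cls.
Qed.

Definition whom_axiom V W (phi : 'rV[R]_(pdim W) -> 'rV[R]_(pdim V)) : Prop :=
  [/\ is_smooth (phi : feuclid R (pdim W) -> feuclid R (pdim V)), phi 0 = 0 &
      forall f : Csm (feuclid R (pdim V)), pideal V f -> @in_ideal W (fun x => f (phi x))].

Lemma equivW_pull X V W phi (f g : feuclid R (pdim V) -> X) :
  @whom_axiom V W phi -> equivW f g ->
  @equivW X W (fun x => f (phi x)) (fun x => g (phi x)).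
Proof.
move=> [sphi phi0 iphi] [e H]; split=> [|h]; first by rewrite phi0.
have [K IK KE] := H h; have := iphi _ IK.
by apply: in_ideal_ext => x; rewrite KE.
Qed.

Lemma pull_cls X V W phi (f : feuclid R (pdim V) -> X) :
  @whom_axiom V W phi -> is_smooth f ->
  pull V W phi (cls V f) = cls W (fun x => f (phi x)).
Proof.
move=> wphi sf; have [sphi _ _] := wphi; apply/cls_eqP.
- exact: (smooth_compose (smapP _) sphi).
- exact: (smooth_compose sf sphi).
- by apply: equivW_pull => //; exact: rep_cls.
Qed.

Lemma whom_axiom_gen n (G : set (Csm (feuclid R n))) W
    (phi : 'rV[R]_(pdim W) -> 'rV[R]_n) :
  is_smooth (phi : feuclid R (pdim W) -> feuclid R n) -> phi 0 = 0 ->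
  (forall f, G f -> @in_ideal W (fun x => f (phi x))) ->
  @whom_axiom (pres_gen G) W phi.
Proof.
move=> sphi phi0 HG; split=> // f If.
apply: (If [set f | @in_ideal W (fun x => f (phi x))]); last exact: HG.
split=> [|f1 f2 H1 H2|f1 f2 H2].
- exact: in_ideal0.
- exact: in_idealD.
- exact: (in_idealM (Csm_comp f1 (SMap sphi)) H2).
Qed.

Definition linear_functional W (l : walg W -> R) := forall a f g,
  l (\pi_(walg W) (a *: f + g)) = a * l (\pi_(walg W) f) + l (\pi_(walg W) g).

Lemma pi_walgP W (f g : Csm (feuclid R (pdim W))) :
  \pi_(walg W) f = \pi_(walg W) g <-> pideal W (f - g).
Proof. by split=> [/eqmodP/asboolP|?]; last exact/eqmodP/asboolP. Qed.

Lemma prol_fun_cls X W (h : Csm X) (f : smap (feuclid R (pdim W)) X) :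
  prol_fun h (cls W f) = \pi_(walg W) (Csm_comp h f).
Proof.
apply/pi_walgP; have [_ /(_ h)] := rep_cls (smapP f).
by apply: (in_idealE _).1 => x; rewrite CsmBE.
Qed.

Lemma fcurve_prolP X W (c : R -> X ⊗ W) : fcurve c <->
  forall (h : Csm X) (l : walg W -> R), linear_functional l ->
    smoothR (fun t => l (prol_fun h (c t))).
Proof.
split=> [cc h l Hl|H k [h [l [fl ->]]]].
  apply: (cc (l \o prol_fun h)); exists h, l; split=> // d dl; exact: dl.
apply: (fl (fun t => prol_fun h (c t))) => m lm; exact: H.
Qed.

Lemma linear_functional_sum W l (I : Type) (r : seq I) (a : I -> R) F :
  @linear_functional W l ->
  l (\pi_(walg W) (\sum_(i <- r) a i *: F i)) = \sum_(i <- r) a i * l (\pi_(walg W) (F i)).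
Proof.
move=> Hl; elim: r => [|i r IHr]; last by rewrite !big_cons Hl IHr.
rewrite !big_nil; have := Hl (-1) 0 0.
by rewrite scaler0 addr0 mulN1r addNr.
Qed.

Definition nilpotent W := exists k, nil_ideal k (pideal W).

(** For a Weil algebra presented with a nilpotent maximal ideal, smooth families
    of maps have smooth families of classes: by [nil_expand] the class depends
    on finitely many coefficients only. *)
Lemma cls_smooth X Y W (e : fprod (feuclid R (pdim W)) Y -> X) :
  nilpotent W -> is_smooth e ->
  is_smooth (fun y => cls W (fun x => e (x, y)) : X ⊗ W).
Proof.
move=> [k Wk] se c cc; apply/fcurve_prolP => h l Hl.
have sH : is_smooth (fun p => h (e p)) := smooth_compose (smapP h) se.
have [a Ha] := nil_expand (pidealP W) Wk sH.
have sm i : smoothR (fun t => (a i (c t) : R) * l (\pi_(walg W) (monomial R i))).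
  apply: (smoothRM _ _ _ (smoothR_cst _)).
  by apply/(fline_smoothP (a i)).1; first exact: smapP.
have := @smooth_sum R _ (index_enum (mon_index (pdim W) k)) _ sm.
congr smoothR; apply/funext => t /=.
rewrite -linear_functional_sum//; congr l.
pose f : smap _ _ := SMap (slice_smooth (c t) se).
rewrite -[X in prol_fun h X]/(cls W f) prol_fun_cls; apply/esym/pi_walgP.
exact: Ha.
Qed.

(** The foot point is read off by the linear functional [f |-> f 0] on [W]. *)
Lemma foot_smooth X W : (forall f, pideal W f -> f 0 = 0 :> R) ->
  is_smooth (@foot R X W).
Proof.
move=> W0 c /fcurve_prolP cc; apply/fcurve_compP => h.
pose l (a : walg W) : R := repr a 0.
have lE f : l (\pi_(walg W) f) = f 0.
  have /W0 : pideal W (repr (\pi_(walg W) f) - f) by apply/pi_walgP; rewrite reprK.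
  by rewrite CsmBE => /eqP; rewrite subr_eq0 => /eqP.
have Hl : linear_functional l by move=> a f g; rewrite !lE.
by have := cc h l Hl; congr smoothR; apply/funext => t; rewrite /prol_fun lE.
Qed.

Lemma pull_smooth X V W phi : @whom_axiom V W phi -> is_smooth (@pull R X V W phi).
Proof.
move=> wphi; have [sphi _ iphi] := wphi.
move=> c /fcurve_prolP cc; apply/fcurve_prolP => h l Hl.
pose phi' : smap (feuclid R (pdim W)) (feuclid R (pdim V)) := SMap sphi.
pose l' (a : walg V) : R := l (\pi_(walg W) (Csm_comp (repr a) phi')).
have lE f : l' (\pi_(walg V) f) = l (\pi_(walg W) (Csm_comp f phi')).
  congr l; apply/pi_walgP.
  have /iphi : pideal V (repr (\pi_(walg V) f) - f) by apply/pi_walgP; rewrite reprK.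
  by apply: (in_idealE _).1 => x; rewrite !CsmBE.
have Hl' : linear_functional l'.
  by move=> a f g; rewrite !lE -Hl; congr (l (\pi_(walg W) _)); apply: Csm_eq.
have := cc h l' Hl'; congr smoothR; apply/funext => t.
rewrite {1}/prol_fun lE; congr l; apply/esym.
pose g : smap _ _ := SMap (smooth_compose (smapP (rep (c t))) sphi).
rewrite -[X in prol_fun h X]/(cls W g) prol_fun_cls.
by congr (\pi_(walg W) _); apply: Csm_eq.
Qed.

End Prolongation.

(** * The Weil algebras of [D^p], [D(2)] and [D^2 + D] *)

Section Concrete.
Variable R : realType.
Implicit Types (X Y Z : frolicher R) (V W : pres R).

Lemma gen_vanish n (G : set (Csm (feuclid R n))) :
  (forall g, G g -> g 0 = 0 :> R) -> forall f, pideal (pres_gen G) f -> f 0 = 0 :> R.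
Proof.
move=> G0 f If; apply: (If [set f | f 0 = 0 :> R]); last exact: G0.
split=> [//|f1 f2 e1 e2|f1 f2 e2] /=; first by rewrite e1 e2 addr0.
by rewrite e2 mulr0.
Qed.

Lemma nil_idealP n k (J : set (Csm (feuclid R n))) : nil_ideal k J <->
  forall s : seq 'I_n, size s = k -> J (\prod_(i <- s) coordinate R i).
Proof.
elim: k J => [|k IHk] J.
  split=> [J1 s /size0nil ->|H]; first by rewrite big_nil.
  by have := H [::] erefl; rewrite big_nil.
split=> [H [//|i s] [sk]|H i].
  by have /IHk/(_ s sk) := H i; rewrite big_cons.
by apply/IHk => s sk; have := H (i :: s); rewrite /= sk big_cons; exact.
Qed.

(** A product of more than [pdim W] coordinates has a repeated factor. *)
Lemma squares_nilpotent W : (forall i, pideal W (coordinate R i ^+ 2)) -> nilpotent W.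
Proof.
move=> sq; exists (pdim W).+1; apply/nil_idealP => s sW.
have iW := pidealP W.
have : ~~ uniq s.
  apply/negP => us; have := max_card (mem s).
  by rewrite card_ord (card_uniqP us) sW ltnn.
elim: s {sW} => [//|i s IHs] /=; rewrite big_cons negb_and negbK.
case/orP => [si|/IHs Js]; last exact: idealMl.
rewrite (perm_big _ (perm_to_rem si)) big_cons mulrA -expr2 mulrC.
exact: idealMl.
Qed.

Lemma Dn_square p (i : 'I_p) : pideal (Dn p) (coordinate R i ^+ 2).
Proof. by move=> J iJ; apply; exists i => x; rewrite !expr2. Qed.

Lemma D2_square i : pideal (D2 R) (coordinate R i ^+ 2).
Proof. by move=> J iJ; apply; left; exists i => x; rewrite !expr2. Qed.

Lemma D2plusD_square i : pideal (D2plusD R) (coordinate R i ^+ 2).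
Proof. by move=> J iJ; apply; apply: Or31; exists i => x; rewrite !expr2. Qed.

Lemma Dn_nilpotent p : nilpotent (Dn p : pres R).
Proof. by apply: squares_nilpotent => i; exact: Dn_square. Qed.

Lemma D2_nilpotent : nilpotent (D2 R).
Proof. by apply: squares_nilpotent => i; exact: D2_square. Qed.

Lemma D2plusD_nilpotent : nilpotent (D2plusD R).
Proof. by apply: squares_nilpotent => i; exact: D2plusD_square. Qed.

Lemma Dn_vanish p f : pideal (Dn p : pres R) f -> f 0 = 0 :> R.
Proof. by apply: gen_vanish => g [i ->]; rewrite mxE expr0n. Qed.

Lemma D2_vanish f : pideal (D2 R) f -> f 0 = 0 :> R.
Proof.
by apply: gen_vanish => g [[i ->]|->]; rewrite !mxE ?expr0n ?mul0r.
Qed.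

Lemma D2plusD_vanish f : pideal (D2plusD R) f -> f 0 = 0 :> R.
Proof.
by apply: gen_vanish => g [[i ->]|->|->]; rewrite !mxE ?expr0n ?mul0r.
Qed.

Lemma Dn_weil p : is_weil (Dn p : pres R).
Proof. by have [k] := Dn_nilpotent p; apply: nil_weil; exact: Dn_vanish. Qed.

Lemma D2_weil : is_weil (D2 R).
Proof. by have [k] := D2_nilpotent; apply: nil_weil; exact: D2_vanish. Qed.

Lemma D2plusD_weil : is_weil (D2plusD R).
Proof. by have [k] := D2plusD_nilpotent; apply: nil_weil; exact: D2plusD_vanish. Qed.

Lemma is_smooth_ext X Y (f g : X -> Y) : (forall x, f x = g x) ->
  is_smooth f -> is_smooth g.
Proof. by move=> /funext ->. Qed.

Lemma smooth_vec1 X (f : X -> fline R) : is_smooth f ->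
  is_smooth (fun x => vec [:: f x : R] : feuclid R 1).
Proof.
move=> sf; apply: smooth_feuclid => i.
by apply: (is_smooth_ext _ sf) => x; rewrite mxE ord1.
Qed.

Lemma smooth_vec2 X (f g : X -> fline R) : is_smooth f -> is_smooth g ->
  is_smooth (fun x => vec [:: f x : R; g x : R] : feuclid R 2).
Proof.
move=> sf sg; apply: smooth_feuclid => -[[|[|i]] i2]; last by case: (notF i2).
  by apply: (is_smooth_ext _ sf) => x; rewrite mxE.
by apply: (is_smooth_ext _ sg) => x; rewrite mxE.
Qed.

Lemma smooth_vec3 X (f g h : X -> fline R) : is_smooth f -> is_smooth g ->
  is_smooth h -> is_smooth (fun x => vec [:: f x : R; g x : R; h x : R] : feuclid R 3).
Proof.
move=> sf sg sh; apply: smooth_feuclid => -[[|[|[|i]]] i3]; last by case: (notF i3).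
- by apply: (is_smooth_ext _ sf) => x; rewrite mxE.
- by apply: (is_smooth_ext _ sg) => x; rewrite mxE.
- by apply: (is_smooth_ext _ sh) => x; rewrite mxE.
Qed.

Lemma vec1E (x : 'rV[R]_1) : vec [:: x 0 0] = x.
Proof. by apply/rowP => i; rewrite mxE ord1. Qed.

Lemma vec2E (x : 'rV[R]_2) : vec [:: x 0 0; x 0 1] = x.
Proof.
by apply/rowP => -[[|[|//]] i2]; rewrite mxE /=; congr (x _ _); apply: val_inj.
Qed.

Lemma vec3E (x : 'rV[R]_3) : vec [:: x 0 0; x 0 1; x 0 2] = x.
Proof.
by apply/rowP => -[[|[|[|//]]] i3]; rewrite mxE /=; congr (x _ _); apply: val_inj.
Qed.

Lemma Csm1_smooth (K : Csm (feuclid R 1)) : smoothR (fun s => K (vec [:: s]) : R).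
Proof.
apply/fcurve_flineP.
apply: (smooth_compose (smapP K) (smooth_vec1 (@id_smooth R (fline R))) (c := id)).
by apply/fcurve_flineP; exact: smooth_id.
Qed.

Lemma Csm2_bismooth (K : Csm (feuclid R 2)) : bismooth (fun s t => K (vec [:: s; t]) : R).
Proof.
move=> a b sa sb; apply/fcurve_flineP; apply: (smapP K).
apply: (smooth_vec2 (@fst_smooth R (fline R) (fline R))
  (@snd_smooth R (fline R) (fline R)) (c := fun t => (a t, b t))).
by apply/fcurve_fprodP; split; exact/fcurve_flineP.
Qed.

Lemma smooth_of_bismooth (A : R -> R -> R) : bismooth A ->
  is_smooth (fun x : feuclid R 2 => A (x 0 0) (x 0 1) : fline R).
Proof.
by move=> sA c /fcurve_feuclidP cc; apply/fcurve_flineP; apply: sA; exact: cc.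
Qed.

Lemma smooth_of_smoothR (A : R -> R) : smoothR A ->
  is_smooth (fun x : feuclid R 1 => A (x 0 0) : fline R).
Proof.
move=> sA c /fcurve_feuclidP cc; apply/fcurve_flineP.
exact: (smooth_comp sA (cc 0)).
Qed.

Lemma smooth_divide (f : R -> R) : smoothR f -> exists2 g : R -> R, smoothR g &
  forall s, f s = f 0 + s * g s.
Proof.
move=> sf; exists (hadamard f); last by move=> s; exact: hadamardE.
exact: (bismooth_l (t := 0) (bismooth_hadamard (bismooth_fst sf))).
Qed.

Lemma bismooth_divide k : bismooth k -> exists2 g : R -> R -> R, bismooth g &
  forall s t, k s t = k 0 t + s * g s t.
Proof.
move=> sk; exists (fun s t => hadamard (k^~ t) s); first exact: bismooth_hadamard.
by move=> s t; apply: (@hadamardE R (k^~ t)); exact: bismooth_l.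
Qed.

Lemma is_derive_quadratic (f : R -> R) (c a : R) : smoothR f ->
  is_derive (0 : R) 1 (fun s => c + a * s + f s * s ^+ 2) a.
Proof.
move=> sf; have di := is_derive_id (0 : R) 1; have df := smooth_is_derive 0 sf.
rewrite (_ : (fun s => _) = (cst c + a \*: id + f * (id * id))%R); last first.
  by apply/funext => s; rewrite expr2.
apply: (is_derive_eq (is_deriveD (is_deriveD (is_derive_cst c (0 : R) 1)
  (is_deriveZ a di)) (is_deriveM df (is_deriveM di di)))).
rewrite /GRing.scale/= (_ : (id * id)%R 0 = 0 :> R); last exact: mul0r.
by rewrite !mul0r !addr0 mulr0 add0r mulr1 addr0.
Qed.

(** This and the lemmas [expand2], [expandD2], [expand3] reduce functions modulo
    the ideals to polynomials. The coefficients are unique; see [indep1], [indep2]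
    and [indepD2] for the first three algebras. *)
Lemma expand1 (K : Csm (feuclid R 1)) : @in_ideal R (Dn 1)
  (fun x => (K x : R) - (K 0 + derive1 (fun s => K (vec [:: s]) : R) 0 * x 0 0)).
Proof.
pose f (s : R) : R := K (vec [:: s]); have sf : smoothR f := @Csm1_smooth K.
have [g sg fE] := smooth_divide sf; have [h sh gE] := smooth_divide sg.
have fq s : f s = f 0 + g 0 * s + h s * s ^+ 2 by rewrite fE gE; ring.
have f'0 : derive1 f 0 = g 0.
  apply: is_derive_derive1; rewrite (funext fq); exact: is_derive_quadratic.
pose A : Csm (feuclid R 1) := SMap (smooth_of_smoothR sh).
exists (A * coordinate R 0 ^+ 2); first exact: (idealMl _ (pidealP _) (Dn_square _)).
move=> x; rewrite -/f f'0 !expr2 /=.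
have -> : K x = f (x 0 0) by rewrite /f vec1E.
have -> : K 0 = f 0 by congr (K _); apply/rowP => i; rewrite !mxE ord1.
by rewrite fq; ring.
Qed.

Lemma Dn1_ideal (K : Csm (feuclid R 1)) : pideal (Dn 1) K ->
  K 0 = 0 :> R /\ derive1 (fun s => K (vec [:: s]) : R) 0 = 0.
Proof.
move=> IK; split; first exact: (Dn_vanish IK).
have [A ->] : exists A, K = A * coordinate R 0 ^+ 2.
  apply: (IK [set K | exists A, K = A * coordinate R 0 ^+ 2]) => [|g [i gE]].
    split=> /= [|_ _ [A1 ->] [A2 ->]|f _ [A ->]].
    - by exists 0; rewrite mul0r.
    - by exists (A1 + A2); rewrite mulrDl.
    - by exists (f * A); rewrite mulrA.
  by exists 1; apply: Csm_eq => x; rewrite mul1r gE ord1 expr2.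
apply: is_derive_derive1; rewrite (_ : (fun s => _) =
  (fun s => 0 + 0 * s + (A (vec [:: s]) : R) * s ^+ 2)).
  by apply: is_derive_quadratic; exact: Csm1_smooth.
by apply/funext => s; rewrite !expr2 /= mxE mul0r !add0r.
Qed.

Lemma indep1 (c a : R) : @in_ideal R (Dn 1) (fun x => c + a * x 0 0) -> c = 0 /\ a = 0.
Proof.
move=> [K /Dn1_ideal[K0 K1] KE]; rewrite KE mxE mulr0 addr0 in K0.
split=> //; rewrite -K1; apply/esym/is_derive_derive1.
have -> : (fun s => K (vec [:: s]) : R) = (cst c + a \*: id)%R.
  by apply/funext => s; rewrite KE mxE.
have := is_deriveD (is_derive_cst c (0 : R) 1) (is_deriveZ a (is_derive_id (0 : R) 1)).
by rewrite /GRing.scale/= add0r mulr1.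
Qed.

Definition mixed (k : R -> R -> R) : R := derive1 (fun s => derive1 (k s) 0) 0.

Lemma mixedE (k A B : R -> R -> R) (c a b m : R) : bismooth A -> bismooth B ->
  (forall s t, k s t = c + a * s + b * t + m * (s * t) + A s t * s ^+ 2 + B s t * t ^+ 2) ->
  mixed k = m.
Proof.
move=> sA sB kE.
have sA1 : smoothR (fun s => derive1 (A s) 0).
  exact: (bismooth_r (s := 0) (bismooth_derive (bismooth_swap sA))).
have inner s : derive1 (k s) 0 = b + m * s + derive1 (A s) 0 * s ^+ 2.
  have sAs := bismooth_r (s := s) sA.
  apply: is_derive_derive1.
  have -> : k s = (s ^+ 2 \*: A s + (fun t => (c + a * s) + (b + m * s) * t + B s t * t ^+ 2))%R.
    apply/funext => t; rewrite kE -[RHS]/(s ^+ 2 * A s t +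
      ((c + a * s) + (b + m * s) * t + B s t * t ^+ 2)); ring.
  apply: (is_derive_eq (is_deriveD (is_deriveZ (s ^+ 2) (smooth_is_derive 0 sAs))
    (is_derive_quadratic (c + a * s) (b + m * s) (bismooth_r (s := s) sB)))).
  by rewrite /GRing.scale/= [LHS]addrC; congr (_ + _); rewrite mulrC.
rewrite /mixed (_ : (fun s => _) = fun s => b + m * s + derive1 (A s) 0 * s ^+ 2).
  by apply: is_derive_derive1; exact: is_derive_quadratic.
by apply/funext => s; exact: inner.
Qed.

Lemma bismooth_expand k : bismooth k -> exists A B (c a b m : R),
  [/\ bismooth A, bismooth B & forall s t,
      k s t = c + a * s + b * t + m * (s * t) + A s t * s ^+ 2 + B s t * t ^+ 2].
Proof.
move=> sk; have [g sg kE] := bismooth_divide sk.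
have [A sA gE] := bismooth_divide sg.
have [b sb k0E] := smooth_divide (bismooth_r (s := 0) sk).
have [b1 sb1 bE] := smooth_divide sb.
have [e se g0E] := smooth_divide (bismooth_r (s := 0) sg).
have [e1 se1 eE] := smooth_divide se.
exists A, (fun s t => b1 t + s * e1 t), (k 0 0), (g 0 0), (b 0), (e 0); split.
- exact: sA.
- apply: bismoothD; first exact: (bismooth_snd sb1).
  exact: (bismoothM (bismooth_fst (@smooth_id R)) (bismooth_snd se1)).
- by move=> s t; rewrite kE k0E bE gE g0E eE; ring.
Qed.

Lemma mixedC k : bismooth k -> mixed (fun s t => k t s) = mixed k.
Proof.
move=> /bismooth_expand[A [B [c [a [b [m [sA sB kE]]]]]]].
rewrite (mixedE sA sB kE); apply: (@mixedE _ _ _ c b a m (bismooth_swap sB) (bismooth_swap sA)) => s t.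
by rewrite kE; ring.
Qed.

Lemma Dn2_ideal (K : Csm (feuclid R 2)) : pideal (Dn 2) K ->
  exists A B : Csm (feuclid R 2), K = A * coordinate R 0 ^+ 2 + B * coordinate R 1 ^+ 2.
Proof.
move=> IK; apply: (IK [set K | exists A B : Csm (feuclid R 2),
  K = A * coordinate R 0 ^+ 2 + B * coordinate R 1 ^+ 2]) => [|g [i gE]].
  split=> /= [|_ _ [A1 [B1 ->]] [A2 [B2 ->]]|f _ [A [B ->]]].
  - by exists 0, 0; rewrite !mul0r addr0.
  - by exists (A1 + A2), (B1 + B2); rewrite !mulrDl addrACA.
  - by exists (f * A), (f * B); rewrite mulrDr !mulrA.
have [i0|i1] : i = 0 \/ i = 1.
  by case: i {gE} => [[|[|//]] ?]; [left|right]; apply: val_inj.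
  exists 1, 0; apply: Csm_eq => x.
  by rewrite mul1r mul0r addr0 gE i0 expr2.
exists 0, 1; apply: Csm_eq => x.
by rewrite mul1r mul0r add0r gE i1 expr2.
Qed.

Lemma in_ideal_mixed k : @in_ideal R (Dn 2) k -> mixed (fun s t => k (vec [:: s; t])) = 0.
Proof.
move=> [K /Dn2_ideal[A [B ->]] KE].
apply: (@mixedE _ _ _ 0 0 0 0 (@Csm2_bismooth A) (@Csm2_bismooth B)) => s t.
by rewrite -KE !expr2 /= !mxE /=; ring.
Qed.

Lemma expand2 (K : Csm (feuclid R 2)) : exists c a b m : R,
  @in_ideal R (Dn 2) (fun x => (K x : R) -
    (c + a * x 0 0 + b * x 0 1 + m * (x 0 0 * x 0 1))).
Proof.
have [A [B [c [a [b [m [sA sB kE]]]]]]] := bismooth_expand (@Csm2_bismooth K).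
exists c, a, b, m.
pose A' : Csm (feuclid R 2) := SMap (smooth_of_bismooth sA).
pose B' : Csm (feuclid R 2) := SMap (smooth_of_bismooth sB).
exists (A' * coordinate R 0 ^+ 2 + B' * coordinate R 1 ^+ 2).
  by apply: (idealD (pidealP _)); apply: (idealMl _ (pidealP _)); exact: Dn_square.
move=> x; rewrite !expr2 /=.
have -> : K x = K (vec [:: x 0 0; x 0 1]) by rewrite vec2E.
by rewrite kE; ring.
Qed.

Lemma in_idealDn2_D2 k : @in_ideal R (Dn 2) k -> @in_ideal R (D2 R) k.
Proof.
move=> [K IK KE]; exists K => //; apply: IK; first exact: (pidealP (D2 R)).
by move=> g [i gE] J iJ; apply; left; exists i.
Qed.

End Concrete.

Section Coefficients.
Variable R : realType.
Implicit Types (X Y Z : frolicher R) (V W : pres R).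

Lemma in_square p (i : 'I_p) : @in_ideal R (Dn p) (fun x => x 0 i ^+ 2).
Proof. by exists (coordinate R i ^+ 2); [exact: Dn_square|move=> x; rewrite !expr2]. Qed.

Lemma in_ideal_cstM W (a : R) k : @in_ideal R W k -> in_ideal (fun x => a * k x).
Proof. exact: (in_idealM (Csm_cst _ a)). Qed.

Lemma in_ideal_sum W (I : Type) (r : seq I) (k : I -> 'rV[R]_(pdim W) -> R) :
  (forall i, in_ideal (k i)) -> @in_ideal R W (fun x => \sum_(i <- r) k i x).
Proof.
move=> Hk; elim: r => [|i r IHr].
  by apply: in_ideal_ext (in_ideal0 W) => x; rewrite big_nil.
by apply: in_ideal_ext (in_idealD (Hk i) IHr) => x; rewrite big_cons.
Qed.

Lemma vec1_0 : vec [:: 0 : R] = 0 :> 'rV_1.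
Proof. by apply/rowP => -[[|i] i1]; rewrite !mxE. Qed.

Lemma vec2_0 : vec [:: 0 : R; 0] = 0 :> 'rV_2.
Proof. by apply/rowP => -[[|[|i]] i2]; rewrite !mxE. Qed.

Lemma vec3_0 : vec [:: 0 : R; 0; 0] = 0 :> 'rV_3.
Proof. by apply/rowP => -[[|[|[|i]]] i3]; rewrite !mxE. Qed.

Definition axis0 (d : 'rV[R]_1) : 'rV[R]_2 := vec [:: d 0 0; 0].
Definition axis1 (d : 'rV[R]_1) : 'rV[R]_2 := vec [:: 0; d 0 0].
Definition diagonal (d : 'rV[R]_1) : 'rV[R]_2 := vec [:: d 0 0; d 0 0].
Definition sd_psi (d : 'rV[R]_2) : 'rV[R]_3 := vec [:: d 0 0; d 0 1; d 0 0 * d 0 1].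
Definition sd_phi (d : 'rV[R]_2) : 'rV[R]_3 := vec [:: d 0 0; d 0 1; 0].
Definition sd_axis (d : 'rV[R]_1) : 'rV[R]_3 := vec [:: 0; 0; d 0 0].
Definition fst_coord (d : 'rV[R]_2) : 'rV[R]_1 := vec [:: d 0 0].
Definition snd_coord (d : 'rV[R]_2) : 'rV[R]_1 := vec [:: d 0 1].

Lemma ord2P (i : 'I_2) : i = 0 \/ i = 1.
Proof. by case: i => [[|[|i]] i2]; [left|right|case: (notF i2)]; apply: val_inj. Qed.

Lemma ord3P (i : 'I_3) : [\/ i = 0, i = 1 | i = 2].
Proof.
by case: i => [[|[|[|i]]] i3]; [apply: Or31|apply: Or32|apply: Or33|case: (notF i3)];
  apply: val_inj.
Qed.

Let in0 W k : (forall x, k x = 0) -> @in_ideal R W k.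
Proof. by move=> k0; apply: in_ideal_ext (in_ideal0 W) => x; rewrite k0. Qed.

Let sq p (i : 'I_p) k : (forall x : 'rV[R]_p, k x = x 0 i ^+ 2) -> @in_ideal R (Dn p) k.
Proof. by move=> kE; apply: in_ideal_ext (in_square i) => x; rewrite kE. Qed.

Let sqM (A : Csm (feuclid R 2)) (i : 'I_2) k :
  (forall x : 'rV[R]_2, k x = (A x : R) * x 0 i ^+ 2) -> @in_ideal R (Dn 2) k.
Proof.
by move=> kE; apply: in_ideal_ext (@in_idealM R (Dn 2) A _ (in_square i)) => x; rewrite kE.
Qed.

Local Ltac vanish E := by apply: in0 => x; rewrite E !mxE /= ?expr0n ?mul0r ?mulr0.

Lemma axis0_whom : @whom_axiom R (D2 R) (Dn 1) axis0.
Proof.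
apply: whom_axiom_gen; [by apply: smooth_vec2; [exact: coord_smooth|exact: cst_smooth]
  |by rewrite /axis0 !mxE; exact: vec2_0|].
move=> g [[i]|gE]; last vanish gE.
have [->|->] := ord2P i => gE; last vanish gE.
by apply: (sq (i := 0)) => x; rewrite gE !mxE.
Qed.

Lemma axis1_whom : @whom_axiom R (D2 R) (Dn 1) axis1.
Proof.
apply: whom_axiom_gen; [by apply: smooth_vec2; [exact: cst_smooth|exact: coord_smooth]
  |by rewrite /axis1 !mxE; exact: vec2_0|].
move=> g [[i]|gE]; last vanish gE.
have [->|->] := ord2P i => gE; first vanish gE.
by apply: (sq (i := 0)) => x; rewrite gE !mxE.
Qed.

Lemma diagonal_whom : @whom_axiom R (D2 R) (Dn 1) diagonal.
Proof.
apply: whom_axiom_gen; [by apply: smooth_vec2; exact: coord_smooth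
  |by rewrite /diagonal !mxE; exact: vec2_0|].
move=> g [[i]|] gE; apply: (sq (i := 0)) => x; last by rewrite gE !mxE/= expr2.
by have [i0|i1] := ord2P i; rewrite gE ?i0 ?i1 !mxE.
Qed.

Lemma sd_psi_whom : @whom_axiom R (D2plusD R) (Dn 2) sd_psi.
Proof.
apply: whom_axiom_gen; [apply: smooth_vec3; last apply: smooth_mul; exact: coord_smooth
  |by rewrite /sd_psi !mxE ?mulr0; exact: vec3_0|].
move=> g [[i]|gE|gE].
- have [->|->|->] := ord3P i => gE.
  + by apply: (sq (i := 0)) => x; rewrite gE !mxE.
  + by apply: (sq (i := 1)) => x; rewrite gE !mxE.
  + apply: (@sqM (coordinate R 0 * coordinate R 0) 1) => x.
    by rewrite gE !mxE/= !expr2; ring.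
- by apply: (@sqM (coordinate R 1) 0) => x; rewrite gE !mxE/= !expr2; ring.
- by apply: (@sqM (coordinate R 0) 1) => x; rewrite gE !mxE/= !expr2; ring.
Qed.

Lemma sd_phi_whom : @whom_axiom R (D2plusD R) (Dn 2) sd_phi.
Proof.
apply: whom_axiom_gen; [by apply: smooth_vec3; [exact: coord_smooth|exact: coord_smooth|exact: cst_smooth]
  |by rewrite /sd_phi !mxE ?mulr0; exact: vec3_0|].
move=> g [[i]|gE|gE]; [|vanish gE|vanish gE].
have [->|->|->] := ord3P i => gE; last vanish gE.
- by apply: (sq (i := 0)) => x; rewrite gE !mxE.
- by apply: (sq (i := 1)) => x; rewrite gE !mxE.
Qed.

Lemma sd_axis_whom : @whom_axiom R (D2plusD R) (Dn 1) sd_axis.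
Proof.
apply: whom_axiom_gen; [by apply: smooth_vec3; [exact: cst_smooth|exact: cst_smooth|exact: coord_smooth]
  |by rewrite /sd_axis !mxE ?mulr0; exact: vec3_0|].
move=> g [[i]|gE|gE]; [|vanish gE|vanish gE].
have [->|->|->] := ord3P i => gE; [vanish gE|vanish gE|].
by apply: (sq (i := 0)) => x; rewrite gE !mxE.
Qed.

Lemma fst_coord_whom : @whom_axiom R (Dn 1) (Dn 2) fst_coord.
Proof.
apply: whom_axiom_gen; [by apply: smooth_vec1; exact: coord_smooth
  |by rewrite /fst_coord mxE; exact: vec1_0|].
by move=> g [i gE]; apply: (sq (i := 0)) => x; rewrite gE ord1 !mxE.
Qed.

Lemma snd_coord_whom : @whom_axiom R (Dn 1) (Dn 2) snd_coord.
Proof.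
apply: whom_axiom_gen; [by apply: smooth_vec1; exact: coord_smooth
  |by rewrite /snd_coord mxE; exact: vec1_0|].
by move=> g [i gE]; apply: (sq (i := 1)) => x; rewrite gE ord1 !mxE.
Qed.

Lemma incl_whom : @whom_axiom R (Dn 2) (D2 R) id.
Proof.
by split=> [||f If]; [exact: id_smooth|by []|apply: in_idealDn2_D2; exists f].
Qed.

Lemma scale_whom (a : R) : @whom_axiom R (Dn 1) (Dn 1) (fun d => a *: d).
Proof.
apply: whom_axiom_gen; [|by rewrite scaler0|].
  apply: smooth_feuclid => i.
  apply: (is_smooth_ext (f := fun x : feuclid R 1 => a * x 0 i : fline R)).
    by move=> x; rewrite mxE.
  by apply: smooth_mul; [exact: cst_smooth|exact: coord_smooth].
move=> g [i gE]; apply: in_ideal_ext (in_ideal_cstM (a ^+ 2) (in_square i)) => x.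
by rewrite gE mxE exprMn.
Qed.

Lemma expandD2 (K : Csm (feuclid R 2)) : exists c a b : R, @in_ideal R (D2 R)
  (fun x => (K x : R) - (c + a * x 0 0 + b * x 0 1)).
Proof.
have [c [a [b [m H]]]] := expand2 K; exists c, a, b.
have xy : @in_ideal R (D2 R) (fun x => m * (x 0 0 * x 0 1)).
  apply: in_ideal_cstM; exists (coordinate R 0 * coordinate R 1) => //.
  by move=> J iJ; apply; right.
by apply: in_ideal_ext (in_idealD (in_idealDn2_D2 H) xy) => x; ring.
Qed.

Let proj3 (x : 'rV[R]_3) : 'rV[R]_2 := vec [:: x 0 0; x 0 1].

Let proj3_whom : @whom_axiom R (Dn 2) (D2plusD R) proj3.
Proof.
apply: whom_axiom_gen.
- by apply: smooth_vec2; exact: coord_smooth.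
- by rewrite /proj3 !mxE; exact: vec2_0.
- move=> g [i gE]; pose j : 'I_3 := inord i.
  exists (coordinate R j ^+ 2); first exact: D2plusD_square.
  move=> x; rewrite gE !expr2 /= !mxE.
  suff -> : x 0 j = [:: x 0 0; x 0 1]`_i by [].
  have [i0|i1] := ord2P i.
    by rewrite i0 /=; congr (x _ _); apply: val_inj; rewrite /= inordK i0.
  by rewrite i1 /=; congr (x _ _); apply: val_inj; rewrite /= inordK i1.
Qed.

(** The part of [K] that depends on the first two coordinates is expanded over
    [D^2]; the rest is divisible by the third one, whose products with all the
    coordinates are in the ideal. *)
Lemma expand3 (K : Csm (feuclid R 3)) : exists c a b m e : R, @in_ideal R (D2plusD R)
  (fun x => (K x : R) -
    (c + a * x 0 0 + b * x 0 1 + m * (x 0 0 * x 0 1) + e * x 0 2)).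
Proof.
pose f (p : fprod (fline R) (feuclid R 2)) : fline R := K (vec [:: p.2 0 0; p.2 0 1; p.1]).
have sf : is_smooth f.
  apply: (smooth_compose (smapP K)); apply: smooth_vec3; last exact: fst_smooth.
    exact: (smooth_compose (@coord_smooth R 2 0) (@snd_smooth R (fline R) (feuclid R 2))).
  exact: (smooth_compose (@coord_smooth R 2 1) (@snd_smooth R (fline R) (feuclid R 2))).
have [g sg fE] := hadamard_smooth sf.
pose K0 : Csm (feuclid R 2) := SMap (slice_smooth_r (0 : fline R) sf).
have [c [a [b [m H0]]]] := expand2 K0.
have [s3 _ i3] := proj3_whom.
have {}H0 : @in_ideal R (D2plusD R) (fun x => (K0 (proj3 x) : R) -
    (c + a * (proj3 x) 0 0 + b * (proj3 x) 0 1 + m * ((proj3 x) 0 0 * (proj3 x) 0 1))).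
  have [H IH HE] := H0; apply: in_ideal_ext (i3 H IH) => x; exact: HE.
pose G (p : fprod (feuclid R 3) (fline R)) : fline R := g (p.1 0 2, proj3 p.1).
have sG : is_smooth G.
  apply: (smooth_compose sg); apply: pair_smooth.
    exact: (smooth_compose (@coord_smooth R 3 2) (@fst_smooth R (feuclid R 3) (fline R))).
  exact: (smooth_compose s3 (@fst_smooth R (feuclid R 3) (fline R))).
have [gi sgi GE] := hadamard_euclid sG.
exists c, a, b, m, (G (0, 0)).
have x2i (i : 'I_3) : @in_ideal R (D2plusD R) (fun x => x 0 2 * x 0 i).
  exists (coordinate R 2 * coordinate R i) => // J iJ HJ.
  have [i0|i1|i2] := ord3P i.
  - by rewrite mulrC i0; apply: HJ; apply: Or32.
  - by rewrite mulrC i1; apply: HJ; apply: Or33.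
  - by apply: HJ; apply: Or31; exists 2 => x; rewrite i2 expr2.
have rest : @in_ideal R (D2plusD R) (fun x => \sum_i (gi i (x, 0) : R) * (x 0 2 * x 0 i)).
  pose gK i : Csm (feuclid R 3) := SMap (slice_smooth (0 : fline R) (sgi i)).
  by apply: in_ideal_sum => i; exact: (@in_idealM R (D2plusD R) (gK i) _ (x2i i)).
apply: in_ideal_ext (in_idealD H0 rest) => x.
have -> : \sum_i (gi i (x, 0) : R) * (x 0 2 * x 0 i) = x 0 2 * (G (x, 0) - G (0, 0)).
  rewrite GE addrAC subrr add0r mulr_sumr; apply: eq_bigr => i _; ring.
have -> : K x = f (x 0 2, proj3 x) by rewrite /f /= !mxE /= vec3E.
rewrite fE -[g _]/(G (x, 0)) -[f _]/(K0 (proj3 x) : R) /proj3 !mxE /=; ring.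
Qed.

End Coefficients.

(** * Coefficients of infinitesimal elements *)

Section TangentCoefficient.
Variable R : realType.
Implicit Types (X Y Z : frolicher R) (V W : pres R).

Lemma derive1_mod (K : Csm (feuclid R 1)) (c a : R) :
  @in_ideal R (Dn 1) (fun x => (K x : R) - (c + a * x 0 0)) ->
  derive1 (fun s => K (vec [:: s]) : R) 0 = a.
Proof.
move=> H; have H1 := expand1 K; set d := derive1 _ 0 in H1 *.
have [|_ /eqP] := @indep1 R (c - K 0) (a - d).
  by apply: in_ideal_ext (in_idealB H1 H) => x; ring.
by rewrite subr_eq0 => /eqP.
Qed.

Lemma mixed_poly (c a b m : R) :
  mixed (fun s t => c + a * s + b * t + m * (s * t)) = m.
Proof.
have z : bismooth (fun _ _ : R => 0 : R) by move=> *; exact: smoothR_cst.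
by apply: (@mixedE R _ _ _ c a b m z z) => s t; ring.
Qed.

Lemma mixed_mod (K : Csm (feuclid R 2)) (c a b m : R) :
  @in_ideal R (Dn 2) (fun x => (K x : R) - (c + a * x 0 0 + b * x 0 1 + m * (x 0 0 * x 0 1))) ->
  mixed (fun s t => K (vec [:: s; t]) : R) = m.
Proof.
move=> H; have [A [B [c' [a' [b' [m' [sA sB kE]]]]]]] := bismooth_expand (@Csm2_bismooth R K).
rewrite (mixedE sA sB kE); have := in_ideal_mixed H.
rewrite (@mixedE R _ A B (c' - c) (a' - a) (b' - b) (m' - m) sA sB) => [/eqP|s t].
  by rewrite subr_eq0 => /eqP.
by rewrite kE !mxE /=; ring.
Qed.

(** The derivative of a test function along a tangent vector, and the mixed
    derivative of a test function along an element over [D^2]. *)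
Definition dcoef X (h : Csm X) (t : X ⊗ Dn 1) : R :=
  derive1 (fun s => h (rep t (vec [:: s])) : R) 0.

Definition mixed_coef X (h : Csm X) (g : X ⊗ Dn 2) : R :=
  mixed (fun s t => h (rep g (vec [:: s; t])) : R).

Lemma dcoef_mod X (h : Csm X) (f : feuclid R 1 -> X) (c a : R) : is_smooth f ->
  @in_ideal R (Dn 1) (fun x => (h (f x) : R) - (c + a * x 0 0)) ->
  dcoef h (cls (Dn 1) f) = a.
Proof.
move=> sf H; have [_ /(_ h) H1] := @rep_cls R X (Dn 1) f sf.
apply: (@derive1_mod (Csm_comp h (rep (cls (Dn 1) f))) c a).
by apply: in_ideal_ext (in_idealD H1 H) => x /=; ring.
Qed.

Lemma dcoef_cls X (h : Csm X) (f : feuclid R 1 -> X) : is_smooth f ->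
  dcoef h (cls (Dn 1) f) = derive1 (fun s => h (f (vec [:: s])) : R) 0.
Proof.
move=> sf; pose K : Csm (feuclid R 1) := Csm_comp h (SMap sf).
exact: (@dcoef_mod _ h f (K 0) _ sf (expand1 K)).
Qed.

Lemma mixed_coef_mod X (h : Csm X) (f : feuclid R 2 -> X) (c a b m : R) : is_smooth f ->
  @in_ideal R (Dn 2) (fun x => (h (f x) : R) -
    (c + a * x 0 0 + b * x 0 1 + m * (x 0 0 * x 0 1))) ->
  mixed_coef h (cls (Dn 2) f) = m.
Proof.
move=> sf H; have [_ /(_ h) H1] := @rep_cls R X (Dn 2) f sf.
apply: (@mixed_mod (Csm_comp h (rep (cls (Dn 2) f))) c a b).
by apply: in_ideal_ext (in_idealD H1 H) => x /=; ring.
Qed.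

Lemma mixed_coef_cls X (h : Csm X) (f : feuclid R 2 -> X) : is_smooth f ->
  mixed_coef h (cls (Dn 2) f) = mixed (fun s t => h (f (vec [:: s; t])) : R).
Proof.
move=> sf; pose K : Csm (feuclid R 2) := Csm_comp h (SMap sf).
have [c [a [b [m H]]]] := expand2 K.
by rewrite (mixed_coef_mod sf H) (mixed_mod H).
Qed.

Lemma pull_in_ideal V W phi (K : Csm (feuclid R (pdim V))) (P : 'rV[R]_(pdim V) -> R) :
  @whom_axiom R V W phi -> in_ideal (fun x => (K x : R) - P x) ->
  @in_ideal R W (fun x => (K (phi x) : R) - P (phi x)).
Proof.
by move=> [_ _ iphi] [H IH HE]; apply: in_ideal_ext (iphi H IH) => x; rewrite HE.
Qed.

Lemma dcoef_diagonal X (h : Csm X) (g : X ⊗ D2 R) :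
  dcoef h (pull (D2 R) (Dn 1) (@diagonal R) g) =
  dcoef h (pull (D2 R) (Dn 1) (@axis0 R) g) + dcoef h (pull (D2 R) (Dn 1) (@axis1 R) g).
Proof.
pose f := rep g; pose K : Csm (feuclid R 2) := Csm_comp h f.
have sf := smapP f; have [c [a [b H]]] := expandD2 K.
have pE phi (wphi : @whom_axiom R (D2 R) (Dn 1) phi) m :
    (forall x, c + a * phi x 0 0 + b * phi x 0 1 = c + m * x 0 0) ->
    dcoef h (pull (D2 R) (Dn 1) phi g) = m.
  move=> E; rewrite -[g]cls_rep pull_cls//; apply: (@dcoef_mod _ h _ c m).
    by have [sphi _ _] := wphi; exact: smooth_compose sf sphi.
  by apply: in_ideal_ext (pull_in_ideal wphi H) => x; rewrite E.
rewrite (pE _ (@diagonal_whom R) (a + b)) => [|x]; last by rewrite !mxE /=; ring.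
rewrite (pE _ (@axis0_whom R) a) => [|x]; last by rewrite !mxE /=; ring.
by rewrite (pE _ (@axis1_whom R) b) => [//|x]; rewrite !mxE /=; ring.
Qed.

(** In the normal form [c + a x0 + b x1 + m x0 x1 + e x2], pulling back along
    [sd_psi] adds [e] to the coefficient [m], while [sd_phi] drops [e]. *)
Lemma dcoef_sd_axis X (h : Csm X) (g : X ⊗ D2plusD R) :
  dcoef h (pull (D2plusD R) (Dn 1) (@sd_axis R) g) =
  mixed_coef h (pull (D2plusD R) (Dn 2) (@sd_psi R) g) -
  mixed_coef h (pull (D2plusD R) (Dn 2) (@sd_phi R) g).
Proof.
pose f := rep g; pose K : Csm (feuclid R 3) := Csm_comp h f.
have sf := smapP f; have [c [a [b [m [e H]]]]] := expand3 K.
rewrite -[g]cls_rep !pull_cls//; [|exact: sd_phi_whom|exact: sd_psi_whom|exact: sd_axis_whom].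
rewrite (@dcoef_mod _ h _ c e); first last.
- apply: in_ideal_ext (pull_in_ideal (@sd_axis_whom R) H) => x.
  by rewrite !mxE /=; ring.
- by have [s _ _] := @sd_axis_whom R; exact: smooth_compose sf s.
rewrite (@mixed_coef_mod _ h _ c a b (m + e)); first last.
- apply: in_ideal_ext (pull_in_ideal (@sd_psi_whom R) H) => x.
  by rewrite !mxE /=; ring.
- by have [s _ _] := @sd_psi_whom R; exact: smooth_compose sf s.
rewrite (@mixed_coef_mod _ h _ c a b m); first last.
- apply: in_ideal_ext (pull_in_ideal (@sd_phi_whom R) H) => x.
  by rewrite !mxE /=; ring.
- by have [s _ _] := @sd_phi_whom R; exact: smooth_compose sf s.
by ring.
Qed.

Lemma dcoef_scale X (h : Csm X) (a : R) (t : X ⊗ Dn 1) :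
  dcoef h (tscale a t) = a * dcoef h t.
Proof.
pose f := rep t; pose K : Csm (feuclid R 1) := Csm_comp h f.
have sf := smapP f; have [s _ _] := scale_whom a.
rewrite /tscale -[t in LHS]cls_rep pull_cls//; last exact: scale_whom.
apply: (@dcoef_mod _ h _ (K 0) (a * dcoef h t)); first exact: smooth_compose sf s.
apply: in_ideal_ext (pull_in_ideal (scale_whom a) (expand1 K)) => x.
by rewrite mxE mulrCA mulrA.
Qed.

Lemma dcoef_fmap X Y (F : X -> Y) (h : Csm Y) (t : X ⊗ Dn 1) (sF : is_smooth F) :
  dcoef h (fmap F t) = dcoef (Csm_comp h (SMap sF)) t.
Proof. by rewrite /fmap dcoef_cls//; exact: smooth_compose sF (smapP _). Qed.

(** Two curves in [C^oo(Z)] which agree up to first order at every point of [Z]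
    differ by [x^2] times a smooth curve, so that they have the same class: all
    elements over [D] are represented by affine curves, and [Dder] is
    differentiation at the points of [Z]. *)
Lemma DderE Z (v : fexp Z (fline R) ⊗ Dn 1) z :
  Dder v z = dcoef (SMap (@eval_smooth R Z (fline R) z)) v :> R.
Proof.
suff [b [a Hv]] : exists b, exists a : Csm Z,
    v = cls (Dn 1) (fun x => a + x 0 0 *: b : fexp Z (fline R)).
  have [a' {a b Hv}] : exists a : Csm Z,
      v = cls (Dn 1) (fun x => a + x 0 0 *: Dder v : fexp Z (fline R)).
    exact: (@xgetPex _ (0 : {classic Csm Z}) [set b | exists a : Csm Z,
      v = cls (Dn 1) (fun x => a + x 0 0 *: b : fexp Z (fline R))] (ex_intro _ b (ex_intro _ a Hv))).
  move: (Dder v) => b ->.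
  have saff : is_smooth (fun x : feuclid R 1 => a' + x 0 0 *: b : fexp Z (fline R)).
    apply: smooth_curry => /=; apply: smooth_add.
      exact: (smooth_compose (smapP a') (@snd_smooth R (feuclid R 1) Z)).
    apply: smooth_mul; last exact: (smooth_compose (smapP b) (@snd_smooth R (feuclid R 1) Z)).
    exact: (smooth_compose (@coord_smooth R 1 0) (@fst_smooth R (feuclid R 1) Z)).
  apply: esym; apply: (@dcoef_mod (fexp Z (fline R)) (SMap (@eval_smooth R Z (fline R) z))
    _ (a' z) (b z) saff).
  apply: (@in_ideal_ext R (Dn 1) _ _ _ (@in_ideal0 R (Dn 1))) => x.
  by rewrite -[LHS]/(0 : R) /=; apply/esym/eqP; rewrite subr_eq0; apply/eqP; congr (_ + _); rewrite mulrC.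
have se : is_smooth (fun p : fprod (feuclid R 1) Z => rep v p.1 p.2).
  exact: (smooth_uncurry (smapP (rep v))).
have [g /(_ ord0) sg eE] := hadamard_euclid se.
have [g2 /(_ ord0) sg2 gE] := hadamard_euclid sg.
pose a : Csm Z := SMap (slice_smooth_r (0 : feuclid R 1) se).
pose b : Csm Z := SMap (slice_smooth_r (0 : feuclid R 1) sg).
pose q (p : fprod (fline R) (feuclid R 1)) : Csm Z :=
  a + p.2 0 0 *: b + (p.1 : R) *: (SMap (slice_smooth_r p.2 sg2) : Csm Z).
have sq : is_smooth (q : fprod (fline R) (feuclid R 1) -> fexp Z (fline R)).
  apply: smooth_curry => /=; pose P := fprod (fline R) (feuclid R 1).
  have s1 := @fst_smooth R P Z; have s2 := @snd_smooth R P Z.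
  have s11 := smooth_compose (@fst_smooth R (fline R) (feuclid R 1)) s1.
  have s12 := smooth_compose (@snd_smooth R (fline R) (feuclid R 1)) s1.
  apply: smooth_add; first apply: smooth_add.
  - exact: (smooth_compose (smapP a) s2).
  - by apply: smooth_mul; [exact: (smooth_compose (@coord_smooth R 1 0) s12)
      |exact: (smooth_compose (smapP b) s2)].
  - by apply: smooth_mul; [exact: s11|exact: (smooth_compose sg2 (pair_smooth s12 s2))].
have q0 x : q (0, x) = a + x 0 0 *: b by rewrite /q /= scale0r addr0.
have qv (x : feuclid R 1) : q (x 0 0 ^+ 2, x) = rep v x.
  apply: Csm_eq => z'; apply: etrans (esym (eE x z')).
  by rewrite big_ord1 gE big_ord1 /q /=; ring.
exists b, a; rewrite -[LHS]cls_rep; apply/cls_eqP.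
- exact: smapP.
- apply: (@is_smooth_ext R (feuclid R 1) (fexp Z (fline R)) _ _ q0).
  exact: (slice_smooth_r (0 : fline R) sq).
split; first by apply: Csm_eq => z'; rewrite mxE scale0r addr0.
move=> h; have [m sm mE] := hadamard_smooth (smooth_compose (smapP h) sq).
pose mx : Csm (feuclid R 1) := SMap (smooth_compose sm
  (pair_smooth (smooth_mul (@coord_smooth R 1 0) (@coord_smooth R 1 0)) (@id_smooth R _))).
apply: in_ideal_ext (@in_idealM R (Dn 1) mx _ (@in_square R 1 0)) => x.
rewrite -qv mE q0 /= expr2; ring.
Qed.

End TangentCoefficient.

(** * Gluing along limit cones of Weil algebras *)

Local Open Scope quotient_scope.

Section Cones.
Variable R : realType.
Implicit Types (X Y Z : frolicher R) (U V W : pres R).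

Lemma whom_axiom_smooth V W phi : @whom_axiom R V W phi ->
  is_smooth (phi : feuclid R (pdim W) -> feuclid R (pdim V)).
Proof. by case. Qed.

Lemma whom_axiom_map0 V W phi : @whom_axiom R V W phi -> phi 0 = 0.
Proof. by case. Qed.

Lemma whom_axiom_ideal V W phi (H : @whom_axiom R V W phi) f : pideal V f ->
  pideal W (Csm_comp f (SMap (whom_axiom_smooth H))).
Proof. by have [_ _ iphi] := H; move=> /iphi; apply: (in_idealE _).1. Qed.

Definition whom_of V W phi (H : @whom_axiom R V W phi) : whom V W :=
  @WHom R V W (SMap (whom_axiom_smooth H)) (whom_axiom_map0 H) (whom_axiom_ideal H).

Lemma whom_axiom_comp U V W phi psi : @whom_axiom R U V phi -> @whom_axiom R V W psi ->
  @whom_axiom R U W (fun x => phi (psi x)).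
Proof.
move=> [sphi phi0 iphi] [spsi psi0 ipsi]; split.
- exact: (smooth_compose sphi spsi).
- by rewrite psi0.
- move=> f /iphi[K /ipsi[L IL LE] KE]; exists L => // x.
  by rewrite LE KE.
Qed.

Lemma pull_pull X U V W phi psi (u : X ⊗ U) : @whom_axiom R U V phi ->
  @whom_axiom R V W psi ->
  pull V W psi (pull U V phi u) = pull U W (fun x => phi (psi x)) u.
Proof.
move=> Hphi Hpsi; have [sphi _ _] := Hphi.
have Hc := whom_axiom_comp Hphi Hpsi; have su := smapP (rep u).
rewrite -[u]cls_rep (pull_cls Hc su) (pull_cls Hphi su).
by rewrite (pull_cls Hpsi (smooth_compose su sphi)).
Qed.

Lemma walg_map_pi V W (phi : whom V W) f :
  walg_map phi (\pi_(walg V) f) = \pi_(walg W) (Csm_comp f phi).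
Proof.
apply/pi_walgP.
have /(whomP phi) : pideal V (repr (\pi_(walg V) f) - f) by apply/pi_walgP; rewrite reprK.
congr (pideal W _); apply: Csm_eq => x.
by rewrite -[LHS]/((repr (\pi_(walg V) f) - f) (phi x)) !CsmBE.
Qed.

(** The cones over two arrows [A -> B], both induced by [rho]. All the limits used
    below are of this kind: they express that the object of [C] is the union of
    two copies of the object of [A], which intersect in the object of [B]. *)
Section Cospan.
Variables (A B C : pres R) (Aw : is_weil A) (Bw : is_weil B) (Cw : is_weil C).
Variables (rho : 'rV[R]_(pdim B) -> 'rV[R]_(pdim A)).
Variables (ph0 ph1 : 'rV[R]_(pdim A) -> 'rV[R]_(pdim C)).
Hypotheses (Hrho : whom_axiom rho) (H0 : whom_axiom ph0) (H1 : whom_axiom ph1).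
Hypothesis Hcomm : forall f : Csm (feuclid R (pdim C)),
  in_ideal (fun x => (f (ph0 (rho x)) : R) - f (ph1 (rho x))).
Hypothesis Hex : forall f0 f1 : Csm (feuclid R (pdim A)),
  in_ideal (fun x => (f0 (rho x) : R) - f1 (rho x)) ->
  exists f : Csm (feuclid R (pdim C)),
    in_ideal (fun x => (f (ph0 x) : R) - f0 x) /\
    in_ideal (fun x => (f (ph1 x) : R) - f1 x).
Hypothesis Huniq : forall f : Csm (feuclid R (pdim C)),
  in_ideal (fun x => f (ph0 x) : R) -> in_ideal (fun x => f (ph1 x) : R) -> pideal C f.

Definition cospan_obj (v : option bool) : pres R := if v is Some _ then A else B.

Definition cospan_proj (v : option bool) : whom C (cospan_obj v) :=
  match v with
  | Some true => whom_of H0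
  | Some false => whom_of H1
  | None => whom_of (whom_axiom_comp H0 Hrho)
  end.

Lemma cospan_weil v : is_weil (cospan_obj v). Proof. by case: v. Qed.

Lemma cospan_commutes (e : bool) a :
  @walg_map R (cospan_obj (Some e)) (cospan_obj None) (whom_of Hrho)
    (walg_map (cospan_proj (Some e)) a) = walg_map (cospan_proj None) a.
Proof.
rewrite -[a]reprK; move: (repr a) => f {a}.
rewrite (walg_map_pi (cospan_proj (Some e))) (walg_map_pi (cospan_proj None)) walg_map_pi.
case: e; apply/pi_walgP.
  by apply: (in_idealE _).1 (in_ideal0 B) => x; rewrite CsmBE; exact: subrr.
apply: (in_idealE _).1 (in_idealB (in_ideal0 B) (Hcomm f)) => x.
by rewrite CsmBE sub0r; apply/esym; exact: opprB.
Qed.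

Definition cospan_cone : wcone R :=
  @WCone R (option bool) bool Some (fun=> None) cospan_obj (fun=> whom_of Hrho)
    C cospan_proj cospan_weil Cw cospan_commutes.

Lemma cospan_limit : is_alg_limit cospan_cone.
Proof.
move=> a Ha.
have [f0 E0] : exists f, a (Some true) = \pi_(walg A) f by exists (repr (a (Some true))); rewrite reprK.
have [f1 E1] : exists f, a (Some false) = \pi_(walg A) f by exists (repr (a (Some false))); rewrite reprK.
have /= Ha0 := Ha true; have /= Ha1 := Ha false.
have [|f [ff0 ff1]] := Hex (f0 := f0) (f1 := f1).
  have /pi_walgP : \pi_(walg B) (Csm_comp f0 (whom_of Hrho)) =
      \pi_(walg B) (Csm_comp f1 (whom_of Hrho)).
    by rewrite -!walg_map_pi -E0 -E1 Ha0 Ha1.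
  by apply: (in_idealE _).2 => x; rewrite CsmBE.
have P0 : walg_map (whom_of H0) (\pi_(walg C) f) = a (Some true).
  rewrite walg_map_pi E0; apply/pi_walgP; apply: (in_idealE _).1 ff0 => x.
  by rewrite CsmBE.
have P1 : walg_map (whom_of H1) (\pi_(walg C) f) = a (Some false).
  rewrite walg_map_pi E1; apply/pi_walgP; apply: (in_idealE _).1 ff1 => x.
  by rewrite CsmBE.
exists (\pi_(walg C) f); split=> [[[]|]//=|b Hb].
  by rewrite -Ha0 -P0; apply/esym/(@cospan_commutes true).
rewrite -[b]reprK; apply/pi_walgP; set g := repr b.
have Q0 : walg_map (whom_of H0) (\pi_(walg C) f) = walg_map (whom_of H0) (\pi_(walg C) g).
  by rewrite P0 reprK; apply/esym/(Hb (Some true)).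
have Q1 : walg_map (whom_of H1) (\pi_(walg C) f) = walg_map (whom_of H1) (\pi_(walg C) g).
  by rewrite P1 reprK; apply/esym/(Hb (Some false)).
apply: Huniq.
  move: Q0; rewrite !walg_map_pi => /pi_walgP; apply: (in_idealE _).2 => x.
  by rewrite !CsmBE.
move: Q1; rewrite !walg_map_pi => /pi_walgP; apply: (in_idealE _).2 => x.
by rewrite !CsmBE.
Qed.

Lemma cospan_glue X (microX : microlinear X) Y (g0 g1 : Y -> X ⊗ A) :
  is_smooth g0 -> is_smooth g1 ->
  (forall y, pull A B rho (g0 y) = pull A B rho (g1 y)) ->
  exists2 h : Y -> X ⊗ C, is_smooth h &
    forall y, pull C A ph0 (h y) = g0 y /\ pull C A ph1 (h y) = g1 y.
Proof.
move=> sg0 sg1 gg.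
pose sB : is_smooth (fun y => pull A B rho (g0 y)) :=
  smooth_compose (@pull_smooth R X A B rho Hrho) sg0.
pose g (v : option bool) : smap Y (X ⊗ cospan_obj v) :=
  match v with
  | Some true => SMap sg0
  | Some false => SMap sg1
  | None => SMap sB
  end.
have [|h [Hh _]] := microX _ cospan_limit Y g; first by case=> y; rewrite /= ?gg.
exists h; first exact: smapP.
by move=> y; split; [exact: (Hh (Some true) y)|exact: (Hh (Some false) y)].
Qed.

End Cospan.

Lemma indepD2 (c a b : R) : @in_ideal R (D2 R) (fun x => c + a * x 0 0 + b * x 0 1) ->
  [/\ c = 0, a = 0 & b = 0].
Proof.
move=> [K IK KE].
have [|c0 a0] := @indep1 R c a.
  have [_ _ /(_ K IK)] := @axis0_whom R; apply: in_ideal_ext => x.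
  by rewrite KE !mxE /=; ring.
have [|_ b0] := @indep1 R c b; last by [].
have [_ _ /(_ K IK)] := @axis1_whom R; apply: in_ideal_ext => x.
by rewrite KE !mxE /=; ring.
Qed.

Lemma in_ideal_xy (m : R) : @in_ideal R (D2 R) (fun x => m * (x 0 0 * x 0 1)).
Proof.
apply: in_ideal_cstM; pose K := coordinate R 0 * coordinate R 1 : Csm (feuclid R 2).
by exists K => // J iJ; apply; right.
Qed.

Lemma indep2 (c a b m : R) :
  @in_ideal R (Dn 2) (fun x => c + a * x 0 0 + b * x 0 1 + m * (x 0 0 * x 0 1)) ->
  [/\ c = 0, a = 0, b = 0 & m = 0].
Proof.
move=> H; have [|c0 a0 b0] := @indepD2 c a b.
  apply: in_ideal_ext (in_idealB (in_idealDn2_D2 H) (in_ideal_xy m)) => x.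
  by ring.
split=> //; rewrite -(mixed_poly c a b m); have := in_ideal_mixed H.
by move=> <-; congr mixed; apply/funext => s; apply/funext => t; rewrite !mxE.
Qed.

(** Two functions on [D] with the same value at 0 are the restrictions of the
    function [f0 (x0) + f1 (x1) - f0 (0)] to the two axes. *)
Lemma glueD2 X (microX : microlinear X) Y (g0 g1 : Y -> X ⊗ Dn 1) :
  is_smooth g0 -> is_smooth g1 ->
  (forall y, pull (Dn 1) (Dn 0) (fun=> 0) (g0 y) = pull (Dn 1) (Dn 0) (fun=> 0) (g1 y)) ->
  exists2 h : Y -> X ⊗ D2 R, is_smooth h &
    forall y, pull (D2 R) (Dn 1) (@axis0 R) (h y) = g0 y /\
              pull (D2 R) (Dn 1) (@axis1 R) (h y) = g1 y.
Proof.
have z : @whom_axiom R (Dn 1) (Dn 0) (fun=> 0).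
  apply: whom_axiom_gen => [|//|f [i fE]]; first exact: cst_smooth.
  by apply: in_ideal_ext (in_ideal0 _) => x; rewrite fE mxE expr0n.
apply: (cospan_glue (Dn_weil R 1) (Dn_weil R 0) (D2_weil R) z (@axis0_whom R) (@axis1_whom R)) => //.
- move=> f; apply: in_ideal_ext (in_ideal0 _) => x.
  by have [_ -> _] := @axis0_whom R; have [_ -> _] := @axis1_whom R; rewrite subrr.
- move=> f0 f1 [K IK KE]; have f01 : f0 0 = f1 0 :> R.
    by apply/eqP; rewrite -subr_eq0 -(KE 0); apply/eqP; exact: (Dn_vanish IK).
  have s0 : is_smooth (fun x : feuclid R 2 => f0 (vec [:: x 0 0]) : fline R).
    by apply: (smooth_compose (smapP f0)); apply: smooth_vec1; exact: coord_smooth.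
  have s1 : is_smooth (fun x : feuclid R 2 => f1 (vec [:: x 0 1]) : fline R).
    by apply: (smooth_compose (smapP f1)); apply: smooth_vec1; exact: coord_smooth.
  exists ((SMap s0 : Csm (feuclid R 2)) + SMap s1 - Csm_cst _ (f0 0)).
  split; apply: in_ideal_ext (in_ideal0 _) => x; rewrite CsmBE CsmDE /= !mxE /=.
    by rewrite vec1E vec1_0 -f01; ring.
  by rewrite vec1E vec1_0; ring.
- move=> f; have [c [a [b H]]] := expandD2 f => i0 i1.
  have [|c0 a0] := @indep1 R c a.
    apply: in_ideal_ext (in_idealB i0 (pull_in_ideal (@axis0_whom R) H)) => x.
    by rewrite !mxE /=; ring.
  have [|_ b0] := @indep1 R c b.
    apply: in_ideal_ext (in_idealB i1 (pull_in_ideal (@axis1_whom R) H)) => x.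
    by rewrite !mxE /=; ring.
  apply: (in_idealE _).1 H => x; rewrite c0 a0 b0; ring.
Qed.

(** Two functions on [D^2] which agree on [D(2)] differ by a multiple of [x0 x1],
    which is what [sd_psi] substitutes for the third coordinate. *)
Lemma glueD2plusD X (microX : microlinear X) Y (g0 g1 : Y -> X ⊗ Dn 2) :
  is_smooth g0 -> is_smooth g1 ->
  (forall y, pull (Dn 2) (D2 R) id (g0 y) = pull (Dn 2) (D2 R) id (g1 y)) ->
  exists2 h : Y -> X ⊗ D2plusD R, is_smooth h &
    forall y, pull (D2plusD R) (Dn 2) (@sd_psi R) (h y) = g0 y /\
              pull (D2plusD R) (Dn 2) (@sd_phi R) (h y) = g1 y.
Proof.
apply: (cospan_glue (Dn_weil R 2) (D2_weil R) (D2plusD_weil R) (@incl_whom R)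
  (@sd_psi_whom R) (@sd_phi_whom R)) => //.
- move=> f; have [c [a [b [m [e H]]]]] := expand3 f.
  have := in_idealB (in_idealDn2_D2 (pull_in_ideal (@sd_psi_whom R) H))
    (in_idealDn2_D2 (pull_in_ideal (@sd_phi_whom R) H)).
  move=> /in_idealD/(_ (in_ideal_xy e)); apply: in_ideal_ext => x.
  by rewrite !mxE /=; ring.
- move=> f0 f1 H; have [c [a [b [m E0]]]] := expand2 f0.
  have [c' [a' [b' [m' E1]]]] := expand2 f1.
  have [|/eqP + /eqP + /eqP] := @indepD2 (c - c') (a - a') (b - b').
    have := in_idealB (in_idealB (in_idealB H (in_idealDn2_D2 E0)) (in_ideal_xy (m - m')))
      (in_idealB (in_ideal0 _) (in_idealDn2_D2 E1)).
    by apply: in_ideal_ext => x; ring.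
  rewrite !subr_eq0 => /eqP cc /eqP aa /eqP bb.
  pose K : Csm (feuclid R 3) := Csm_cst _ c + a *: coordinate R 0 + b *: coordinate R 1
    + m' *: (coordinate R 0 * coordinate R 1) + (m - m') *: coordinate R 2.
  have KE x : K x = c + a * x 0 0 + b * x 0 1 + m' * (x 0 0 * x 0 1) + (m - m') * x 0 2 :> R by [].
  exists K; split.
    apply: in_ideal_ext (in_idealB (in_ideal0 _) E0) => x.
    by rewrite KE !mxE /=; ring.
  apply: in_ideal_ext (in_idealB (in_ideal0 _) E1) => x.
  by rewrite KE !mxE /= cc aa bb; ring.
- move=> f; have [c [a [b [m [e H]]]]] := expand3 f => i0 i1.
  have [|_ _ _ me] := @indep2 c a b (m + e).
    apply: in_ideal_ext (in_idealB i0 (pull_in_ideal (@sd_psi_whom R) H)) => x.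
    by rewrite !mxE /=; ring.
  have [|c0 a0 b0 m0] := @indep2 c a b m.
    apply: in_ideal_ext (in_idealB i1 (pull_in_ideal (@sd_phi_whom R) H)) => x.
    by rewrite !mxE /=; ring.
  move: me; rewrite m0 add0r => e0.
  apply: (in_idealE _).1 H => x; rewrite c0 a0 b0 m0 e0; ring.
Qed.

End Cones.

(** * Weil exponentiability *)

Section WeilExponentiable.
Variable R : realType.
Implicit Types (X Y Z M : frolicher R) (V W : pres R).

Lemma smooth_row_mx X m n (f : X -> feuclid R m) (g : X -> feuclid R n) :
  is_smooth f -> is_smooth g ->
  is_smooth (fun x => row_mx (f x) (g x) : feuclid R (m + n)).
Proof.
move=> sf sg; apply: smooth_feuclid => i.
case: (split_ordP i) => j ->.
  apply: (is_smooth_ext (f := fun x => f x 0 j : fline R)) => [x|].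
    by rewrite row_mxEl.
  exact: (smooth_compose (@coord_smooth R m j) sf).
apply: (is_smooth_ext (f := fun x => g x 0 j : fline R)) => [x|].
  by rewrite row_mxEr.
exact: (smooth_compose (@coord_smooth R n j) sg).
Qed.

Lemma smooth_reindex m n (s : 'I_m -> 'I_n) :
  is_smooth (fun d : feuclid R n => \row_j d 0 (s j) : feuclid R m).
Proof.
apply: smooth_feuclid => i.
apply: (is_smooth_ext (f := fun d : feuclid R n => d 0 (s i) : fline R)) => [d|].
  by rewrite mxE.
exact: coord_smooth.
Qed.

Lemma lsubmx_smooth m n :
  is_smooth (fun d : feuclid R (m + n) => lsubmx d : feuclid R m).
Proof.
apply: smooth_feuclid => i; apply: (is_smooth_ext (f :=
  fun d : feuclid R (m + n) => d 0 (lshift n i) : fline R)) => [d|].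
  by rewrite mxE.
exact: coord_smooth.
Qed.

Lemma rsubmx_smooth m n :
  is_smooth (fun d : feuclid R (m + n) => rsubmx d : feuclid R n).
Proof.
apply: smooth_feuclid => i; apply: (is_smooth_ext (f :=
  fun d : feuclid R (m + n) => d 0 (rshift m i) : fline R)) => [d|].
  by rewrite mxE.
exact: coord_smooth.
Qed.

Lemma fmap_pull X Y V W phi (F : X -> Y) (u : X ⊗ V) : @whom_axiom R V W phi ->
  is_smooth F -> fmap F (pull V W phi u) = pull V W phi (fmap F u).
Proof.
move=> Hphi sF; have su := smapP (rep u); have [sphi _ _] := Hphi.
rewrite -[u]cls_rep (pull_cls Hphi su) (fmap_cls sF su).
rewrite (fmap_cls sF (smooth_compose su sphi)).
by rewrite (pull_cls Hphi (smooth_compose sF su)).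
Qed.

Lemma fmap_fmap X Y Z W (F : X -> Y) (G : Y -> Z) (u : X ⊗ W) : is_smooth F ->
  is_smooth G -> fmap G (fmap F u) = fmap (fun x => G (F x)) u.
Proof.
move=> sF sG; have su := smapP (rep u).
rewrite -[u]cls_rep (fmap_cls sF su) (fmap_cls sG (smooth_compose sF su)).
by rewrite (fmap_cls (smooth_compose sG sF) su).
Qed.

Lemma fmap_id X W (F : X -> X) (u : X ⊗ W) : is_smooth F -> (forall x, F x = x) ->
  fmap F u = u.
Proof.
move=> sF FE; rewrite -{2}[u]cls_rep -[u in LHS]cls_rep (fmap_cls sF (smapP (rep u))).
by congr (cls W _); apply/funext => x; rewrite FE.
Qed.

Lemma tensor_rsubmx V W : @whom_axiom R W (tensor V W) (fun d => rsubmx d).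
Proof.
split=> [||f If]; [exact: rsubmx_smooth|exact: linear0|].
by exists (Csm_comp f (SMap (@rsubmx_smooth (pdim V) (pdim W)))) => // J _; apply; right; exists f.
Qed.

Lemma foot_Dn_smooth X p : is_smooth (@foot R X (Dn p)).
Proof. by apply: foot_smooth; exact: Dn_vanish. Qed.

(** Families of elements of [X ⊗ W] lift to families of maps: this is the
    exponential law for the trivial algebra [Dn 0] in place of the first
    factor, combined with cartesian closedness. *)
Lemma weil_lift X W (wX : weil_exponentiable X) Y (g : Y -> X ⊗ W) :
  is_weil W -> is_smooth g ->
  exists2 e : fprod (feuclid R (pdim W)) Y -> X, is_smooth e &
    forall y, g y = cls W (fun x => e (x, y)).
Proof.
move=> Ww sg; have [F [G [_ _ HF]]] := wX (Dn 0) W (Dn_weil R 0) Ww Y.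
have Hr := @tensor_rsubmx (Dn 0) W.
pose g' : fexp Y (X ⊗ tensor (Dn 0) W) :=
  SMap (smooth_compose (@pull_smooth R X _ _ _ Hr) sg).
have sE := smapP (rep (F g')).
exists (fun p => foot (rep (F g') p.1 p.2 : X ⊗ Dn 0)).
  apply: (smooth_compose (@foot_Dn_smooth X 0)); exact: (smooth_uncurry sE).
move=> y; pose f0 : smap (feuclid R (0 + pdim W)) X :=
  SMap (smooth_compose (smapP (rep (g y))) (@rsubmx_smooth 0 (pdim W))).
have Ey : fmap (@foot R X (Dn 0)) (curry_last (V := Dn 0) (W := W) f0) =
    fmap (fun k : fexp Y (X ⊗ Dn 0) => foot (k y)) (F g').
  rewrite -(fmap_fmap (F g') (@eval_smooth R Y (X ⊗ Dn 0) y) (@foot_Dn_smooth X 0)).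
  by rewrite (HF g' y f0 erefl).
apply/esym; apply: etrans (esym Ey) _; rewrite /curry_last.
have se : is_smooth (fun p : fprod (feuclid R 0) (feuclid R (pdim W)) => f0 (row_mx p.1 p.2)).
  by apply: (smooth_compose (smapP f0)); apply: smooth_row_mx; [exact: fst_smooth|exact: snd_smooth].
rewrite (fmap_cls (@foot_Dn_smooth X 0) (cls_smooth (Dn_nilpotent R 0) se)).
rewrite -[RHS]cls_rep; congr (cls W _); apply/funext => x.
by rewrite (foot_cls (W := Dn 0) (slice_smooth (x : feuclid R (pdim W)) se)) /= row_mxKr.
Qed.

Lemma weil_lift_fexp X W (wX : weil_exponentiable X) Y (g : Y -> X ⊗ W) :
  is_weil W -> is_smooth g ->
  exists v : fexp Y X ⊗ W, forall y, fmap (fun k : fexp Y X => k y) v = g y.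
Proof.
move=> Ww sg; have [e se gE] := weil_lift wX Ww sg.
pose E (x : feuclid R (pdim W)) : fexp Y X := SMap (slice_smooth_r x se).
have sE : is_smooth E by apply: smooth_curry; apply: (is_smooth_ext _ se) => -[].
by exists (cls W E) => y; rewrite (fmap_cls (@eval_smooth R Y X y) sE) gE.
Qed.

(** [Dn 0] presents the algebra of real numbers, so that the canonical map for it
    has an inverse, given by foot points. *)
Lemma curry_Dn0_inj X W (a a' : X ⊗ tensor (Dn 0) W) :
  curry_last (V := Dn 0) (W := W) (rep a) = curry_last (V := Dn 0) (W := W) (rep a') -> a = a'.
Proof.
have E (b : X ⊗ tensor (Dn 0) W) : b = pull W (tensor (Dn 0) W) (fun d => rsubmx d)
    (fmap (@foot R X (Dn 0)) (curry_last (V := Dn 0) (W := W) (rep b))).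
  move: (esym (cls_rep b)) => Eb; apply: (etrans Eb) => {Eb}.
  move: (rep b : smap (feuclid R (0 + pdim W)) X) => k.
  have se : is_smooth (fun p : fprod (feuclid R 0) (feuclid R (pdim W)) => k (row_mx p.1 p.2)).
    by apply: (smooth_compose (smapP k)); apply: smooth_row_mx; [exact: fst_smooth|exact: snd_smooth].
  rewrite (fmap_cls (@foot_Dn_smooth X 0) (cls_smooth (Dn_nilpotent R 0) se)).
  have -> : (fun x => foot (cls (Dn 0) (fun x0 : feuclid R 0 => k (row_mx (x0, x).1 (x0, x).2)))) =
      (fun x => k (row_mx 0 x)).
    by apply/funext => x; rewrite (foot_cls (W := Dn 0) (slice_smooth (x : feuclid R (pdim W)) se)).
  have s0 := slice_smooth_r (0 : feuclid R 0) se.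
  rewrite (pull_cls (@tensor_rsubmx (Dn 0) W) s0); congr cls; apply/funext => x /=.
  by rewrite -{1}[x]hsubmxK; congr (k (row_mx _ _)); apply/rowP; case.
by move=> kk; rewrite (E a) (E a') kk.
Qed.

(** Under the exponential isomorphism an element of [X^Y ⊗ W] corresponds to a map
    defined on [Y]; the first factor is again the trivial algebra [Dn 0]. *)
Lemma weil_pointwise X W (wX : weil_exponentiable X) Y (v v' : fexp Y X ⊗ W) :
  is_weil W ->
  (forall y, fmap (fun k : fexp Y X => k y) v = fmap (fun k : fexp Y X => k y) v') -> v = v'.
Proof.
move=> Ww vv; have [F [G [_ GK HF]]] := wX (Dn 0) W (Dn_weil R 0) Ww Y.
pose C (x : X) : X ⊗ Dn 0 := cls (Dn 0) (fun=> x).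
have sC : is_smooth C.
  exact: (cls_smooth (e := snd) (Dn_nilpotent R 0) (@snd_smooth R (feuclid R 0) X)).
pose T (k : fexp Y X) : fexp Y (X ⊗ Dn 0) := SMap (smooth_compose sC (smapP k)).
have sT : is_smooth T.
  apply: smooth_curry; apply: (smooth_compose sC).
  exact: (smooth_uncurry (@id_smooth R (fexp Y X))).
pose T' (k : fexp Y (X ⊗ Dn 0)) : fexp Y X := SMap (smooth_compose (@foot_Dn_smooth X 0) (smapP k)).
have sT' : is_smooth T'.
  apply: smooth_curry; apply: (smooth_compose (@foot_Dn_smooth X 0)).
  exact: (smooth_uncurry (@id_smooth R (fexp Y (X ⊗ Dn 0)))).
have TK k : T' (T k) = k.
  apply: smap_eq; apply/funext => y /=; rewrite /C foot_cls//; exact: cst_smooth.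
suff TT : fmap T v = fmap T v'.
  rewrite -(fmap_id v (smooth_compose sT' sT) TK) -(fmap_id v' (smooth_compose sT' sT) TK).
  by rewrite -(fmap_fmap v sT sT') -(fmap_fmap v' sT sT') TT.
suff GG : G (fmap T v) = G (fmap T v') by rewrite -(GK (fmap T v)) GG GK.
apply: smap_eq; apply/funext => y.
have sy := @eval_smooth R Y (X ⊗ Dn 0) y; have sy' := @eval_smooth R Y X y.
have HG w : curry_last (V := Dn 0) (W := W) (rep (G (fmap T w) y)) =
    fmap C (fmap (fun k : fexp Y X => k y) w).
  rewrite (fmap_fmap w sy' sC) -(fmap_fmap w sT sy) -{2}(GK (fmap T w)).
  exact: (esym (HF _ y (rep (G (fmap T w) y)) (esym (cls_rep _)))).
by apply: curry_Dn0_inj; apply: (etrans (HG v)); rewrite vv; exact: (esym (HG v')).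
Qed.

Lemma Dn_tensor p q : @whom_axiom R (Dn (p + q)) (tensor (Dn p) (Dn q)) id.
Proof.
apply: whom_axiom_gen => [|//|f [i fE]]; first exact: id_smooth.
case: (split_ordP i) => j Ej.
  pose K : Csm (feuclid R (p + q)) := Csm_comp (coordinate R j ^+ 2) (SMap (@lsubmx_smooth p q)).
  exists K => [J iJ|x]; last by rewrite fE Ej /= expr2 /= !mxE -expr2.
  by apply; left; exists (coordinate R j ^+ 2) => //; exact: Dn_square.
pose K : Csm (feuclid R (p + q)) := Csm_comp (coordinate R j ^+ 2) (SMap (@rsubmx_smooth p q)).
exists K => [J iJ|x]; last by rewrite fE Ej /= expr2 /= !mxE -expr2.
by apply; right; exists (coordinate R j ^+ 2) => //; exact: Dn_square.
Qed.

(** The isomorphism for constant families shows that [curry_last] only depends on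
    the class of a map. *)
Lemma curry_last_eq X (wX : weil_exponentiable X) p q (f f' : feuclid R (p + q) -> X) :
  is_smooth f -> is_smooth f' -> cls (Dn (p + q)) f = cls (Dn (p + q)) f' ->
  curry_last (V := Dn p) (W := Dn q) f = curry_last (V := Dn p) (W := Dn q) f'.
Proof.
move=> sf sf' /(congr1 (pull (Dn (p + q)) (tensor (Dn p) (Dn q)) id)).
rewrite (pull_cls (@Dn_tensor p q) sf) (pull_cls (@Dn_tensor p q) sf') => ff.
have [F [G [_ _ HF]]] := wX (Dn p) (Dn q) (Dn_weil R p) (Dn_weil R q) (feuclid R 0).
pose g : fexp (feuclid R 0) (X ⊗ tensor (Dn p) (Dn q)) :=
  SMap (@cst_smooth R _ _ (cls (tensor (Dn p) (Dn q)) f)).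
have E := HF g 0 (SMap sf) erefl; have E' := HF g 0 (SMap sf') ff.
by transitivity (fmap (fun k : fexp (feuclid R 0) (X ⊗ Dn p) => k 0) (F g)); [exact: esym E|exact: E'].
Qed.

End WeilExponentiable.

(** * Composition of maps on prolongations *)

Section Star.
Variable R : realType.
Implicit Types (X Y Z : frolicher R).

(** Renaming of the coordinates of [D^n], which covers [permute], the casts
    between equal degrees and the exchange of two blocks of coordinates. *)
Definition reindex X m n (s : 'I_m -> 'I_n) (u : X ⊗ Dn m) : X ⊗ Dn n :=
  pull (Dn m) (Dn n) (fun d => \row_j d 0 (s j)) u.

Lemma reindex_whom m n (s : 'I_m -> 'I_n) :
  @whom_axiom R (Dn m) (Dn n) (fun d => \row_j d 0 (s j)).
Proof.
apply: whom_axiom_gen => [||f [i fE]]; first exact: smooth_reindex.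
  by apply/rowP => j; rewrite !mxE.
by apply: in_ideal_ext (in_square R (s i)) => x; rewrite fE mxE.
Qed.

Lemma reindex_smooth X m n (s : 'I_m -> 'I_n) : is_smooth (@reindex X m n s).
Proof. exact: (pull_smooth (reindex_whom s)). Qed.

Lemma reindex_cls X m n (s : 'I_m -> 'I_n) (f : feuclid R m -> X) : is_smooth f ->
  reindex s (cls (Dn m) f) = cls (Dn n) (fun d => f (\row_j d 0 (s j))).
Proof. exact: (pull_cls (reindex_whom s)). Qed.

Lemma reindex_comp X m n k (s : 'I_m -> 'I_n) (s' : 'I_n -> 'I_k) (u : X ⊗ Dn m) :
  reindex s' (reindex s u) = reindex (fun i => s' (s i)) u.
Proof.
rewrite /reindex (pull_pull _ (reindex_whom s) (reindex_whom s')).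
by congr (pull _ _ _ u); apply/funext => d; apply/rowP => j; rewrite !mxE.
Qed.

Variable M : frolicher R.
Hypothesis wM : weil_exponentiable M.

(** With these representatives, which depend smoothly on the class, [star] and
    [tstar] are seen to be smooth. *)
Lemma Dn_representatives n : exists2 e : fprod (feuclid R n) (M ⊗ Dn n) -> M,
  is_smooth e & forall u, u = cls (Dn n) (fun x => e (x, u)).
Proof. exact: (weil_lift wM (Dn_weil R n) (@id_smooth R (M ⊗ Dn n))). Qed.

Lemma slice_cls_smooth Z p q (f : fprod (feuclid R (p + q)) Z -> M) : is_smooth f ->
  is_smooth (fun yz : fprod (feuclid R q) Z =>
    cls (Dn p) (fun x => f (row_mx x yz.1, yz.2))).
Proof.
move=> sf; apply: (@cls_smooth R M (fprod (feuclid R q) Z) (Dn p)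
  (fun xyz => f (row_mx xyz.1 xyz.2.1, xyz.2.2)) (Dn_nilpotent R p)).
have s1 := @fst_smooth R (feuclid R p) (fprod (feuclid R q) Z).
have s2 := @snd_smooth R (feuclid R p) (fprod (feuclid R q) Z).
apply: (smooth_compose sf); apply: pair_smooth; last first.
  exact: (smooth_compose (@snd_smooth R (feuclid R q) Z) s2).
by apply: (smooth_row_mx s1); exact: (smooth_compose (@fst_smooth R (feuclid R q) Z) s2).
Qed.

Lemma curry_smooth p q (f : feuclid R (p + q) -> M) : is_smooth f ->
  is_smooth (fun y : feuclid R q => cls (Dn p) (fun x => f (row_mx x y)) : M ⊗ Dn p).
Proof.
move=> sf; have sf' : is_smooth (fun u : fprod (feuclid R (p + q)) (fline R) => f u.1).
  exact: (smooth_compose sf (@fst_smooth R (feuclid R (p + q)) (fline R))).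
exact: (slice_smooth (0 : fline R) (slice_cls_smooth sf')).
Qed.

Lemma fmap_curry_last Z p q (eta : smap (M ⊗ Dn p) Z) (f : feuclid R (p + q) -> M) :
  is_smooth f -> fmap eta (curry_last (V := Dn p) (W := Dn q) f) =
  cls (Dn q) (fun y => eta (cls (Dn p) (fun x => f (row_mx x y)))).
Proof. by move=> sf; exact: (@fmap_cls R _ _ (Dn q) eta _ (smapP eta) (curry_smooth sf)). Qed.

Lemma tstar_raw_smooth Y Z p q (eta : Y -> fexp (M ⊗ Dn p) M)
    (zeta : Y -> fexp (M ⊗ Dn q) Z) (u : Y -> M ⊗ Dn (p + q)) :
  is_smooth eta -> is_smooth zeta -> is_smooth u ->
  is_smooth (fun y => zeta y (fmap (eta y)
    (curry_last (V := Dn p) (W := Dn q) (rep (u y)))) : Z).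
Proof.
move=> seta szeta su; have [e se eE] := Dn_representatives (p + q).
pose e' (xy : fprod (feuclid R (p + q)) Y) : M := e (xy.1, u xy.2).
have se' : is_smooth e'.
  apply: (smooth_compose se); apply: pair_smooth; first exact: fst_smooth.
  exact: (smooth_compose su (@snd_smooth R (feuclid R (p + q)) Y)).
have sl y : is_smooth (fun x => e' (x, y)) := slice_smooth y se'.
apply: (is_smooth_ext (f := fun y => zeta y (cls (Dn q) (fun b => eta y
    (cls (Dn p) (fun a => e' (row_mx a b, y))))))) => [y|].
  have E := curry_last_eq wM (sl y) (smapP (rep (u y))) (etrans (esym (eE (u y))) (esym (cls_rep (u y)))).
  by rewrite -E (fmap_curry_last (eta y) (sl y)).
apply: (smooth_eval szeta).
apply: (@cls_smooth R M Y (Dn q)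
  (fun by_ => eta by_.2 (cls (Dn p) (fun a => e' (row_mx a by_.1, by_.2)))) (Dn_nilpotent R q)).
apply: smooth_eval; last exact: slice_cls_smooth.
exact: (smooth_compose seta (@snd_smooth R (feuclid R q) Y)).
Qed.

Lemma tstarE Z p q (eta : fexp (M ⊗ Dn p) M) (zeta : fexp (M ⊗ Dn q) Z) u :
  tstar eta zeta u = zeta (fmap eta (curry_last (V := Dn p) (W := Dn q) (rep u))).
Proof.
rewrite /tstar mk_smapE//.
exact: (tstar_raw_smooth (@cst_smooth R _ _ eta) (@cst_smooth R _ _ zeta) (@id_smooth R _)).
Qed.

Lemma tstar_cls Z p q (eta : fexp (M ⊗ Dn p) M) (zeta : fexp (M ⊗ Dn q) Z)
    (f : feuclid R (p + q) -> M) : is_smooth f ->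
  tstar eta zeta (cls (Dn (p + q)) f) =
  zeta (cls (Dn q) (fun y => eta (cls (Dn p) (fun x => f (row_mx x y))))).
Proof.
move=> sf; have E := curry_last_eq wM (smapP (rep (cls (Dn (p + q)) f))) sf (cls_rep _).
by rewrite tstarE E (fmap_curry_last eta sf).
Qed.

Lemma tstar_smooth Y Z p q (eta : Y -> fexp (M ⊗ Dn p) M) (zeta : Y -> fexp (M ⊗ Dn q) Z) :
  is_smooth eta -> is_smooth zeta -> is_smooth (fun y => tstar (eta y) (zeta y)).
Proof.
move=> seta szeta; apply: smooth_curry.
have s1 := @fst_smooth R Y (M ⊗ Dn (p + q)).
apply: (is_smooth_ext _ (tstar_raw_smooth (smooth_compose seta s1)
  (smooth_compose szeta s1) (@snd_smooth R Y (M ⊗ Dn (p + q))))) => -[y u].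
by rewrite tstarE.
Qed.

Definition block_swap p q (i : 'I_(p + q)) : 'I_(q + p) :=
  match fintype.split i with inl j => rshift q j | inr j => lshift p j end.

Arguments block_swap : clear implicits.

Lemma block_swap_lshift p q (j : 'I_p) : block_swap p q (lshift q j) = rshift q j.
Proof. by rewrite /block_swap -[lshift q j]/(unsplit (inl j)) unsplitK. Qed.

Lemma block_swap_rshift p q (j : 'I_q) : block_swap p q (rshift p j) = lshift p j.
Proof. by rewrite /block_swap -[rshift p j]/(unsplit (inr j)) unsplitK. Qed.

Lemma row_mx_swap p q (x : 'rV[R]_p) (y : 'rV[R]_q) :
  row_mx x y = \row_j row_mx y x 0 (block_swap p q j).
Proof.
apply/rowP => i; rewrite [RHS]mxE; case: (split_ordP i) => j ->.
  by rewrite block_swap_lshift row_mxEl row_mxEr.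
by rewrite block_swap_rshift row_mxEl row_mxEr.
Qed.

Lemma curry_firstE p q (f : feuclid R (p + q) -> M) :
  curry_first (V := Dn p) (W := Dn q) f =
  curry_last (V := Dn q) (W := Dn p) (fun d => f (\row_j d 0 (block_swap p q j))).
Proof.
congr (cls (Dn p) _); apply/funext => x; congr (cls (Dn q) _); apply/funext => y.
by rewrite -row_mx_swap.
Qed.

Lemma star_rawE p q (eta1 : fexp (M ⊗ Dn p) M) (eta2 : fexp (M ⊗ Dn q) M)
    (u : M ⊗ Dn (p + q)) :
  eta1 (fmap eta2 (curry_first (V := Dn p) (W := Dn q) (rep u))) =
  tstar eta2 eta1 (reindex (block_swap p q) u).
Proof.
have su := smapP (rep u); rewrite curry_firstE -{2}[u]cls_rep (reindex_cls _ su).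
have ss := smooth_compose su (@smooth_reindex R _ _ (block_swap p q)).
by rewrite (tstar_cls eta2 eta1 ss) -(fmap_curry_last eta2 ss).
Qed.

(** In [star eta1 eta2] the map [eta2] is applied first, to the last block of
    coordinates. *)
Lemma starE p q (eta1 : fexp (M ⊗ Dn p) M) (eta2 : fexp (M ⊗ Dn q) M)
    (u : M ⊗ Dn (p + q)) :
  star eta1 eta2 u = tstar eta2 eta1 (reindex (block_swap p q) u).
Proof.
rewrite /star mk_smapE ?star_rawE//; apply: (is_smooth_ext (fun v => esym (star_rawE eta1 eta2 v))).
exact: (smooth_compose (smapP (tstar eta2 eta1)) (@reindex_smooth M _ _ (block_swap p q))).
Qed.

Lemma star_cls p q (eta1 : fexp (M ⊗ Dn p) M) (eta2 : fexp (M ⊗ Dn q) M)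
    (f : feuclid R (p + q) -> M) : is_smooth f ->
  star eta1 eta2 (cls (Dn (p + q)) f) =
  eta1 (cls (Dn p) (fun x => eta2 (cls (Dn q) (fun y => f (row_mx x y))))).
Proof.
move=> sf; have ss := smooth_compose sf (@smooth_reindex R _ _ (block_swap p q)).
rewrite starE (reindex_cls _ sf) (tstar_cls eta2 eta1 ss).
congr (eta1 (cls _ _)); apply/funext => x; congr (eta2 (cls _ _)); apply/funext => y.
by rewrite -row_mx_swap.
Qed.

Lemma star_smooth Y p q (eta1 : Y -> fexp (M ⊗ Dn p) M) (eta2 : Y -> fexp (M ⊗ Dn q) M) :
  is_smooth eta1 -> is_smooth eta2 -> is_smooth (fun y => star (eta1 y) (eta2 y)).
Proof.
move=> s1 s2; apply: smooth_curry.
have sy := @fst_smooth R Y (M ⊗ Dn (p + q)).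
apply: (is_smooth_ext (f := fun yu : fprod Y (M ⊗ Dn (p + q)) =>
  tstar (eta2 yu.1) (eta1 yu.1) (reindex (block_swap p q) yu.2))) => [yu|].
  by rewrite starE.
apply: (smooth_eval (tstar_smooth (smooth_compose s2 sy) (smooth_compose s1 sy))).
exact: (smooth_compose (@reindex_smooth M _ _ (block_swap p q)) (@snd_smooth R Y (M ⊗ Dn (p + q)))).
Qed.

End Star.

Arguments block_swap : clear implicits.

(** * Sums and strong differences in function spaces *)

Section FunctionSpaces.
Variable R : realType.
Implicit Types (X Y Z : frolicher R).

(** A family of elements of the ideal of [D^2] has its four coefficients zero for
    every value of the parameter, so that it is a combination of the squares with
    coefficients that are smooth in the parameter too. *)
Lemma family_in_ideal Y (k : fprod (feuclid R 2) Y -> fline R) (phi : feuclid R 2 -> Y) :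
  is_smooth k -> is_smooth phi ->
  (forall y, @in_ideal R (Dn 2) (fun x => k (x, y))) ->
  @in_ideal R (Dn 2) (fun x => k (x, phi x)).
Proof.
move=> sk sphi Hk.
pose P := fprod (fline R) (fprod (fline R) Y).
have s1 := @fst_smooth R (fline R) (fprod (fline R) Y).
have s2 := @snd_smooth R (fline R) (fprod (fline R) Y).
have s21 := smooth_compose (@fst_smooth R (fline R) Y) s2.
have s22 := smooth_compose (@snd_smooth R (fline R) Y) s2.
have sk' : is_smooth (fun p : P => k (vec [:: p.1 : R; p.2.1 : R], p.2.2)).
  by apply: (smooth_compose sk); apply: (pair_smooth _ s22); exact: smooth_vec2.
have [g sg gE] := hadamard_smooth sk'; have [A sA AE] := hadamard_smooth sg.
have [u1 su1 u1E] := hadamard_smooth (slice_smooth_r (0 : fline R) sk').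
have [u2 su2 u2E] := hadamard_smooth su1.
have [v1 sv1 v1E] := hadamard_smooth (slice_smooth_r (0 : fline R) sg).
have [v2 sv2 v2E] := hadamard_smooth sv1.
pose c y : R := k (vec [:: 0 : R; 0], y); pose a y : R := g (0, (0, y)).
pose b y : R := u1 (0, y); pose m y : R := v1 (0, y).
have kE x y : k (x, y) = c y + a y * x 0 0 + b y * x 0 1 + m y * (x 0 0 * x 0 1) +
    ((A (x 0 0, (x 0 1, y)) : R) * x 0 0 ^+ 2 +
     (u2 (x 0 1, y) + x 0 0 * v2 (x 0 1, y)) * x 0 1 ^+ 2) :> R.
  have := gE (x 0 0) (x 0 1, y); rewrite /= vec2E => ->.
  have := u1E (x 0 1) y; rewrite /= => ->; rewrite u2E AE.
  have := v1E (x 0 1) y; rewrite /= => ->; rewrite v2E.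
  by rewrite /c /a /b /m; ring.
have rem (psi : feuclid R 2 -> Y) : is_smooth psi -> @in_ideal R (Dn 2) (fun x =>
    (A (x 0 0, (x 0 1, psi x)) : R) * x 0 0 ^+ 2 +
    ((u2 (x 0 1, psi x) : R) + x 0 0 * v2 (x 0 1, psi x)) * x 0 1 ^+ 2).
  move=> spsi; have x0 := @coord_smooth R 2 0; have x1 := @coord_smooth R 2 1.
  have s1p := pair_smooth x1 spsi.
  pose CA : Csm (feuclid R 2) := SMap (smooth_compose sA (pair_smooth x0 s1p)).
  pose CB : Csm (feuclid R 2) := SMap (smooth_add (smooth_compose su2 s1p)
    (smooth_mul x0 (smooth_compose sv2 s1p))).
  apply: in_idealD.
    exact: (@in_idealM R (Dn 2) CA _ (@in_square R 2 0)).
  exact: (@in_idealM R (Dn 2) CB _ (@in_square R 2 1)).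
have coef0 y : [/\ c y = 0, a y = 0, b y = 0 & m y = 0].
  apply: indep2.
  have := in_idealB (Hk y) (rem (fun=> y) (@cst_smooth R _ _ y)).
  by apply: in_ideal_ext => x; rewrite kE; ring.
apply: in_ideal_ext (rem phi sphi) => x; rewrite kE.
by have [-> -> -> ->] := coef0 (phi x); ring.
Qed.

(** The two components are replaced one after the other. For [h (f x, g y)] and
    [h (f' x, g y)] the difference is in the ideal for every fixed [y], hence also
    for [y = x]. *)
Lemma equivW_pair X Y (f f' : feuclid R 2 -> X) (g g' : feuclid R 2 -> Y) :
  is_smooth f -> is_smooth f' -> is_smooth g -> is_smooth g' ->
  @equivW R X (Dn 2) f f' -> @equivW R Y (Dn 2) g g' ->
  @equivW R (fprod X Y) (Dn 2) (fun x => (f x, g x)) (fun x => (f' x, g' x)).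
Proof.
move=> sf sf' sg sg' [ef Hf] [eg Hg]; split=> [|h]; first by rewrite ef eg.
pose E := feuclid R 2; have s1 := @fst_smooth R E E; have s2 := @snd_smooth R E E.
have sB (a b : fprod E E -> fline R) : is_smooth a -> is_smooth b ->
    is_smooth (fun z => (a z : R) - b z : fline R).
  move=> sa sb; pose A : Csm (fprod E E) := SMap sa; pose B : Csm (fprod E E) := SMap sb.
  have := smapP (A - B).
  by apply: is_smooth_ext => z; exact: CsmBE.
have s12 (F : E -> X) (G : E -> Y) : is_smooth F -> is_smooth G ->
    is_smooth (fun z : fprod E E => h (F z.1, G z.2)).
  move=> sF sG; apply: (smooth_compose (smapP h)).
  by apply: pair_smooth; [exact: (smooth_compose sF s1)|exact: (smooth_compose sG s2)].
have s21 (F : E -> X) (G : E -> Y) : is_smooth F -> is_smooth G ->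
    is_smooth (fun z : fprod E E => h (F z.2, G z.1)).
  move=> sF sG; apply: (smooth_compose (smapP h)).
  by apply: pair_smooth; [exact: (smooth_compose sF s2)|exact: (smooth_compose sG s1)].
have D1 := family_in_ideal (sB _ _ (s12 f g sf sg) (s12 f' g sf' sg)) (@id_smooth R E)
  (fun y => Hf (SMap (slice_smooth (g y) (smapP h)))).
have D2 := family_in_ideal (sB _ _ (s21 f' g sf' sg) (s21 f' g' sf' sg')) (@id_smooth R E)
  (fun y => Hg (SMap (slice_smooth_r (f' y) (smapP h)))).
by apply: in_ideal_ext (in_idealD D1 D2) => x /=; rewrite subrKA.
Qed.

Lemma pairing_cls X Y (f : feuclid R 2 -> X) (g : feuclid R 2 -> Y) :
  is_smooth f -> is_smooth g ->
  pairing (cls (Dn 2) f) (cls (Dn 2) g) = cls (Dn 2) (fun x => (f x, g x) : fprod X Y).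
Proof.
move=> sf sg; have sf' := smapP (rep (cls (Dn 2) f)); have sg' := smapP (rep (cls (Dn 2) g)).
apply/cls_eqP; [exact: (pair_smooth sf' sg')|exact: (pair_smooth sf sg)|].
by apply: (equivW_pair sf' sf sg' sg); exact: rep_cls.
Qed.

Lemma foot_pull X (V W : pres R) phi (u : X ⊗ V) : @whom_axiom R V W phi ->
  foot (pull V W phi u) = foot u.
Proof.
move=> Hphi; have [sphi phi0 _] := Hphi; have su := smapP (rep u).
by rewrite -{1}[u]cls_rep (pull_cls Hphi su) (foot_cls (smooth_compose su sphi)) phi0.
Qed.

Lemma foot_fmap X Y (W : pres R) (F : X -> Y) (u : X ⊗ W) : is_smooth F ->
  foot (fmap F u) = F (foot u).
Proof. by move=> sF; rewrite /fmap (foot_cls (smooth_compose sF (smapP (rep u)))). Qed.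

(** Modulo the ideal of [D(2)] a function has the form [c + a x0 + b x1], and its
    coefficients are visible on the axes. *)
Lemma D2_axes X (u u' : X ⊗ D2 R) :
  pull (D2 R) (Dn 1) (@axis0 R) u = pull (D2 R) (Dn 1) (@axis0 R) u' ->
  pull (D2 R) (Dn 1) (@axis1 R) u = pull (D2 R) (Dn 1) (@axis1 R) u' -> u = u'.
Proof.
have H0 := @axis0_whom R; have H1 := @axis1_whom R.
have [sa0 a00 _] := H0; have [sa1 _ _] := H1.
have su := smapP (rep u); have su' := smapP (rep u').
rewrite -[u]cls_rep -[u']cls_rep (pull_cls H0 su) (pull_cls H0 su').
rewrite (pull_cls H1 su) (pull_cls H1 su').
move=> /cls_eqP[||e0 E0]; [exact: (smooth_compose su sa0)|exact: (smooth_compose su' sa0)|].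
move=> /cls_eqP[||_ E1]; [exact: (smooth_compose su sa1)|exact: (smooth_compose su' sa1)|].
apply/cls_eqP => //; split=> [|h]; first by rewrite a00 in e0.
pose K : Csm (feuclid R 2) := Csm_comp h (rep u) - Csm_comp h (rep u').
have KE x : K x = (h (rep u x) : R) - h (rep u' x) :> R by rewrite CsmBE.
have [c [a [b H]]] := expandD2 K.
have [|c0 aa] := @indep1 R c a.
  have := in_idealB (E0 h) (pull_in_ideal H0 H).
  by apply: in_ideal_ext => x; rewrite KE !mxE /=; ring.
have [|_ bb] := @indep1 R c b.
  have := in_idealB (E1 h) (pull_in_ideal H1 H).
  by apply: in_ideal_ext => x; rewrite KE !mxE /=; ring.
by apply: in_ideal_ext H => x; rewrite KE c0 aa bb; ring.
Qed.

Variable M : frolicher R.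
Hypotheses (microM : microlinear M) (wM : weil_exponentiable M).

Lemma fmap_eval_smooth Z (W : pres R) (v : fexp Z M ⊗ W) : nilpotent W ->
  is_smooth (fun z => fmap (fun k : fexp Z M => k z) v).
Proof.
move=> nW; apply: (cls_smooth (e := fun xz : fprod (feuclid R (pdim W)) Z => rep v xz.1 xz.2) nW).
exact: (smooth_uncurry (smapP (rep v))).
Qed.

(** Gluing in the function space is done pointwise, in [M], and the resulting
    family of elements is lifted to the function space. *)
Lemma fexp_glue Z (A C : pres R) ph0 ph1 (t0 t1 : fexp Z M ⊗ A) (h : Z -> M ⊗ C) :
  is_weil A -> is_weil C -> @whom_axiom R C A ph0 -> @whom_axiom R C A ph1 -> is_smooth h ->
  (forall z, pull C A ph0 (h z) = fmap (fun k : fexp Z M => k z) t0 /\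
             pull C A ph1 (h z) = fmap (fun k : fexp Z M => k z) t1) ->
  exists g : fexp Z M ⊗ C, pull C A ph0 g = t0 /\ pull C A ph1 g = t1.
Proof.
move=> Aw Cw H0 H1 sh hE; have [g gE] := weil_lift_fexp wM Cw sh.
exists g; split; apply: (weil_pointwise wM Aw) => z.
  by rewrite (fmap_pull g H0 (@eval_smooth R Z M z)) gE; exact: (hE z).1.
by rewrite (fmap_pull g H1 (@eval_smooth R Z M z)) gE; exact: (hE z).2.
Qed.

Lemma foot_zero X (t : X ⊗ Dn 1) :
  pull (Dn 1) (Dn 0) (fun=> 0) t = cls (Dn 0) (fun=> foot t).
Proof. by []. Qed.

Lemma tadd_spec Z (t1 t2 : fexp Z M ⊗ Dn 1) : foot t1 = foot t2 ->
  exists g : fexp Z M ⊗ D2 R,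
    [/\ pull (D2 R) (Dn 1) (@axis0 R) g = t1, pull (D2 R) (Dn 1) (@axis1 R) g = t2 &
        tadd t1 t2 = pull (D2 R) (Dn 1) (@diagonal R) g].
Proof.
move=> ft; pose P (g : fexp Z M ⊗ D2 R) :=
  pull (D2 R) (Dn 1) (@axis0 R) g = t1 /\ pull (D2 R) (Dn 1) (@axis1 R) g = t2.
have [z|h sh hE] := @glueD2 R M microM Z _ _ (@fmap_eval_smooth Z (Dn 1) t1 (Dn_nilpotent R 1))
    (@fmap_eval_smooth Z (Dn 1) t2 (Dn_nilpotent R 1)).
  by rewrite !foot_zero !(foot_fmap _ (@eval_smooth R Z M z)) ft.
have exP : exists g, P g := fexp_glue (Dn_weil R 1) (D2_weil R) (@axis0_whom R)
  (@axis1_whom R) sh hE.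
pose d : {classic fexp Z M ⊗ D2 R} := pull (Dn 1) (D2 R) (fun d => vec [:: d 0 0]) t1.
have [e1 e2] : P (xget d P) := @xgetPex _ d P exP.
by exists (xget d P); split; [exact: e1|exact: e2|].
Qed.

Lemma strong_diff_spec Z (g1 g2 : fexp Z M ⊗ Dn 2) :
  pull (Dn 2) (D2 R) id g1 = pull (Dn 2) (D2 R) id g2 ->
  exists g : fexp Z M ⊗ D2plusD R,
    [/\ pull (D2plusD R) (Dn 2) (@sd_psi R) g = g1,
        pull (D2plusD R) (Dn 2) (@sd_phi R) g = g2 &
        strong_diff g1 g2 = pull (D2plusD R) (Dn 1) (@sd_axis R) g].
Proof.
move=> gg; pose P (g : fexp Z M ⊗ D2plusD R) :=
  pull (D2plusD R) (Dn 2) (@sd_psi R) g = g1 /\ pull (D2plusD R) (Dn 2) (@sd_phi R) g = g2.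
have [z|h sh hE] := @glueD2plusD R M microM Z _ _ (@fmap_eval_smooth Z (Dn 2) g1 (Dn_nilpotent R 2))
    (@fmap_eval_smooth Z (Dn 2) g2 (Dn_nilpotent R 2)).
  have ez := @eval_smooth R Z M z.
  by rewrite -(fmap_pull g1 (@incl_whom R) ez) -(fmap_pull g2 (@incl_whom R) ez) gg.
have exP : exists g, P g := fexp_glue (Dn_weil R 2) (D2plusD_weil R) (@sd_psi_whom R)
  (@sd_phi_whom R) sh hE.
pose d : {classic fexp Z M ⊗ D2plusD R} :=
  pull (Dn 2) (D2plusD R) (fun d => vec [:: d 0 0; d 0 1]) g1.
have [e1 e2] : P (xget d P) := @xgetPex _ d P exP.
by exists (xget d P); split; [exact: e1|exact: e2|].
Qed.

Lemma tadd_dcoef Z (t1 t2 : fexp Z M ⊗ Dn 1) (h : Csm (fexp Z M)) : foot t1 = foot t2 ->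
  foot (tadd t1 t2) = foot t1 /\ dcoef h (tadd t1 t2) = dcoef h t1 + dcoef h t2.
Proof.
move=> /tadd_spec[g [<- <- ->]]; split; last exact: dcoef_diagonal.
exact: etrans (foot_pull g (@diagonal_whom R)) (esym (foot_pull g (@axis0_whom R))).
Qed.

Lemma strong_diff_dcoef Z (g1 g2 : fexp Z M ⊗ Dn 2) (h : Csm (fexp Z M)) :
  pull (Dn 2) (D2 R) id g1 = pull (Dn 2) (D2 R) id g2 ->
  foot (strong_diff g1 g2) = foot g1 /\
  dcoef h (strong_diff g1 g2) = mixed_coef h g1 - mixed_coef h g2.
Proof.
move=> /strong_diff_spec[g [<- <- ->]]; split; last exact: dcoef_sd_axis.
exact: etrans (foot_pull g (@sd_axis_whom R)) (esym (foot_pull g (@sd_psi_whom R))).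
Qed.

Lemma foot_tscale X (a : R) (t : X ⊗ Dn 1) : foot (tscale a t) = foot t.
Proof. exact: (foot_pull t (scale_whom a)). Qed.

End FunctionSpaces.

(** * The operator of the Lie bracket *)

Section LieHat.
Variable R : realType.

Definition extend_l m n r (s : 'I_m -> 'I_n) (i : 'I_(m + r)) : 'I_(n + r) :=
  match fintype.split i with inl j => lshift r (s j) | inr k => rshift n k end.

Definition extend_r p m n (s : 'I_m -> 'I_n) (i : 'I_(p + m)) : 'I_(p + n) :=
  match fintype.split i with inl j => lshift n j | inr k => rshift p (s k) end.

Arguments extend_l {m n} r s i.
Arguments extend_r p {m n} s i.

Lemma extend_l_lshift m n r (s : 'I_m -> 'I_n) j :
  extend_l r s (lshift r j) = lshift r (s j).
Proof. by rewrite /extend_l -[lshift r j]/(unsplit (inl j)) unsplitK. Qed.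

Lemma extend_l_rshift m n r (s : 'I_m -> 'I_n) j :
  extend_l r s (rshift m j) = rshift n j.
Proof. by rewrite /extend_l -[rshift m j]/(unsplit (inr j)) unsplitK. Qed.

Lemma extend_r_lshift p m n (s : 'I_m -> 'I_n) j :
  extend_r p s (lshift m j) = lshift n j.
Proof. by rewrite /extend_r -[lshift m j]/(unsplit (inl j)) unsplitK. Qed.

Lemma extend_r_rshift p m n (s : 'I_m -> 'I_n) j :
  extend_r p s (rshift p j) = rshift p (s j).
Proof. by rewrite /extend_r -[rshift p j]/(unsplit (inr j)) unsplitK. Qed.

Lemma row_mx_extend_l m n r (s : 'I_m -> 'I_n) (x : 'rV[R]_n) (z : 'rV[R]_r) :
  row_mx (\row_j x 0 (s j)) z = \row_j row_mx x z 0 (extend_l r s j).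
Proof.
apply/rowP => i; rewrite [RHS]mxE; case: (split_ordP i) => j ->.
  by rewrite extend_l_lshift !row_mxEl mxE.
by rewrite extend_l_rshift !row_mxEr.
Qed.

Lemma row_mx_extend_r p m n (s : 'I_m -> 'I_n) (x : 'rV[R]_p) (z : 'rV[R]_n) :
  row_mx x (\row_j z 0 (s j)) = \row_j row_mx x z 0 (extend_r p s j).
Proof.
apply/rowP => i; rewrite [RHS]mxE; case: (split_ordP i) => j ->.
  by rewrite extend_r_lshift !row_mxEl.
by rewrite extend_r_rshift !row_mxEr mxE.
Qed.

Lemma row_mx_assoc p q r (x : 'rV[R]_p) (y : 'rV[R]_q) (z : 'rV[R]_r) :
  row_mx (row_mx x y) z =
  \row_j row_mx x (row_mx y z) 0 (cast_ord (esym (addnA p q r)) j).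
Proof.
apply/rowP => i; rewrite [RHS]mxE row_mxA castmxE /=.
by congr (row_mx _ _ _ _); [apply: val_inj|apply: ord_inj].
Qed.

Lemma D2_agree (X : frolicher R) (F G : feuclid R 2 -> X) : is_smooth F -> is_smooth G ->
  (forall d, F (axis0 d) = G (axis0 d)) -> (forall d, F (axis1 d) = G (axis1 d)) ->
  pull (Dn 2) (D2 R) id (cls (Dn 2) F) = pull (Dn 2) (D2 R) id (cls (Dn 2) G).
Proof.
move=> sF sG FG0 FG1; have Hi := @incl_whom R.
have H0 := whom_axiom_comp Hi (@axis0_whom R); have H1 := whom_axiom_comp Hi (@axis1_whom R).
apply: D2_axes.
  rewrite !(pull_pull _ Hi (@axis0_whom R)) (pull_cls H0 sF) (pull_cls H0 sG).
  by congr (cls (Dn 1) _); apply/funext.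
rewrite !(pull_pull _ Hi (@axis1_whom R)) (pull_cls H1 sF) (pull_cls H1 sG).
by congr (cls (Dn 1) _); apply/funext.
Qed.

Lemma coord_axes (d : 'rV[R]_1) :
  [/\ fst_coord (axis0 d) = d, snd_coord (axis0 d) = 0,
      fst_coord (axis1 d) = 0 & snd_coord (axis1 d) = d].
Proof. by split; apply/rowP => i; rewrite !mxE ?ord1. Qed.

Lemma coord_vec2 (s t : R) :
  fst_coord (vec [:: s; t]) = vec [:: s] /\ snd_coord (vec [:: s; t]) = vec [:: t].
Proof. by split; apply/rowP => i; rewrite !mxE. Qed.

Variable M : frolicher R.
Hypotheses (microM : microlinear M) (wM : weil_exponentiable M).
Implicit Type Z : frolicher R.

Lemma cls_row_smooth p q (f : feuclid R (p + q) -> M) (y : feuclid R q) :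
  is_smooth f -> is_smooth (fun x : feuclid R p => f (row_mx x y)).
Proof.
move=> sf; apply: (smooth_compose sf).
by apply: smooth_row_mx; [exact: id_smooth|exact: cst_smooth].
Qed.

Lemma cls_row_smooth_r p q (f : feuclid R (p + q) -> M) (x : feuclid R p) :
  is_smooth f -> is_smooth (fun y : feuclid R q => f (row_mx x y)).
Proof.
move=> sf; apply: (smooth_compose sf).
by apply: smooth_row_mx; [exact: cst_smooth|exact: id_smooth].
Qed.

Lemma tstar_reindex_l Z m n r (s : 'I_m -> 'I_n) (eta : fexp (M ⊗ Dn n) M)
    (eta' : fexp (M ⊗ Dn m) M) (zeta : fexp (M ⊗ Dn r) Z) u :
  (forall v, eta' v = eta (reindex s v)) ->
  tstar eta' zeta u = tstar eta zeta (reindex (extend_l r s) u).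
Proof.
move=> H; have su := smapP (rep u); rewrite -[u]cls_rep.
have ss := smooth_compose su (@smooth_reindex R _ _ (extend_l r s)).
rewrite (reindex_cls _ su) (tstar_cls wM eta' zeta su) (tstar_cls wM eta zeta ss).
congr (zeta (cls _ _)); apply/funext => y; rewrite H (reindex_cls s (cls_row_smooth y su)).
by congr (eta (cls _ _)); apply/funext => x; rewrite row_mx_extend_l.
Qed.

Lemma tstar_reindex_r Z p m n (s : 'I_m -> 'I_n) (eta : fexp (M ⊗ Dn p) M)
    (zeta : fexp (M ⊗ Dn n) Z) (zeta' : fexp (M ⊗ Dn m) Z) u :
  (forall v, zeta' v = zeta (reindex s v)) ->
  tstar eta zeta' u = tstar eta zeta (reindex (extend_r p s) u).
Proof.
move=> H; have su := smapP (rep u); rewrite -[u]cls_rep.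
have ss := smooth_compose su (@smooth_reindex R _ _ (extend_r p s)).
rewrite (reindex_cls _ su) (tstar_cls wM eta zeta' su) (tstar_cls wM eta zeta ss).
have sE := smooth_compose (smapP eta) (curry_smooth su).
rewrite H (reindex_cls s sE); congr (zeta (cls _ _)); apply/funext => y.
by congr (eta (cls _ _)); apply/funext => x; rewrite row_mx_extend_r.
Qed.

Lemma tstarA Z p q r (eta1 : fexp (M ⊗ Dn p) M) (eta2 : fexp (M ⊗ Dn q) M)
    (zeta : fexp (M ⊗ Dn r) Z) u :
  tstar (tstar eta1 eta2) zeta u =
  tstar eta1 (tstar eta2 zeta) (reindex (cast_ord (esym (addnA p q r))) u).
Proof.
have su := smapP (rep u); rewrite -[u]cls_rep.
have ss := smooth_compose su (@smooth_reindex R _ _ (cast_ord (esym (addnA p q r)))).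
rewrite (reindex_cls _ su) (tstar_cls wM _ _ su) (tstar_cls wM _ _ ss).
have sE := smooth_compose (smapP eta1) (curry_smooth ss).
rewrite (tstar_cls wM _ _ sE); congr (zeta (cls _ _)); apply/funext => z.
rewrite (tstar_cls wM _ _ (cls_row_smooth z su)); congr (eta2 (cls _ _)); apply/funext => y.
by congr (eta1 (cls _ _)); apply/funext => x; rewrite row_mx_assoc.
Qed.

Lemma delta_cls p (f : feuclid R p -> M) : is_smooth f ->
  delta M p (cls (Dn p) f) = f 0.
Proof. by move=> sf; rewrite /delta mk_smapE ?(foot_cls (W := Dn p) sf)//; exact: foot_Dn_smooth. Qed.

(** The two compositions differ only in the order in which the maps are applied,
    each to its own block of coordinates, so that they agree when one of the maps
    discards its coordinates. *)
Lemma tstar_delta_r p q (eta : fexp (M ⊗ Dn p) M) :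
  tstar eta (delta M q) = star eta (delta M q).
Proof.
apply: smap_eq; apply/funext => u; have su := smapP (rep u); rewrite -[u]cls_rep.
rewrite (tstar_cls wM eta _ su) (star_cls wM eta _ su).
rewrite (delta_cls (smooth_compose (smapP eta) (curry_smooth su))).
congr (eta (cls _ _)); apply/funext => x.
by rewrite (delta_cls (cls_row_smooth_r x su)).
Qed.

Lemma tstar_delta_l p q (zeta : fexp (M ⊗ Dn q) M) :
  tstar (delta M p) zeta = star (delta M p) zeta.
Proof.
apply: smap_eq; apply/funext => u; have su := smapP (rep u); rewrite -[u]cls_rep.
rewrite (tstar_cls wM _ zeta su) (star_cls wM _ zeta su).
have ss := smooth_compose su (@smooth_reindex R _ _ (block_swap p q)).
have s0 : is_smooth (fun x : feuclid R p =>
    zeta (cls (Dn q) (fun y => rep u (row_mx x y)))).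
  apply: (is_smooth_ext _ (smooth_compose (smapP zeta) (curry_smooth ss))) => x.
  by congr (zeta (cls _ _)); apply/funext => y; rewrite -row_mx_swap.
rewrite (delta_cls s0); congr (zeta (cls _ _)); apply/funext => y.
by rewrite (delta_cls (cls_row_smooth y su)).
Qed.

Lemma tstar_delta p q : tstar (delta M p) (delta M q) = delta M (p + q).
Proof.
apply: smap_eq; apply/funext => u; have su := smapP (rep u); rewrite -[u]cls_rep.
rewrite (tstar_cls wM _ _ su) (delta_cls su).
rewrite (delta_cls (smooth_compose (smapP (delta M p)) (curry_smooth su))).
by rewrite (delta_cls (cls_row_smooth _ su)) row_mx0.
Qed.

Lemma tstar_at_smooth p r (theta : Csm (M ⊗ Dn r)) (u : M ⊗ Dn (p + r)) :
  is_smooth (fun eta : fexp (M ⊗ Dn p) M => tstar eta (theta : fexp _ (fline R)) u).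
Proof.
exact: (smooth_eval (tstar_smooth wM (@id_smooth R (fexp (M ⊗ Dn p) M))
  (@cst_smooth R _ (fexp (M ⊗ Dn r) (fline R)) theta)) (@cst_smooth R _ _ u)).
Qed.

(** The test function which computes [Lie_hat]. *)
Definition tstar_at p r (theta : Csm (M ⊗ Dn r)) (u : M ⊗ Dn (p + r)) :
  Csm (fexp (M ⊗ Dn p) M) := SMap (@tstar_at_smooth p r theta u).

Lemma Lie_hatE p r (xi : fexp (M ⊗ Dn p) M ⊗ Dn 1) (theta : Csm (M ⊗ Dn r)) u :
  Lie_hat xi theta u = dcoef (tstar_at theta u) xi :> R.
Proof.
have sF := tstar_smooth wM (@id_smooth R (fexp (M ⊗ Dn p) M))
  (@cst_smooth R _ (fexp (M ⊗ Dn r) (fline R)) theta).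
by rewrite /Lie_hat DderE (dcoef_fmap _ _ sF); congr (dcoef _ xi); apply: smap_eq.
Qed.

Section Bracket.
Variables (p q : nat).
Variables (xi1 : fexp (M ⊗ Dn p) M ⊗ Dn 1) (xi2 : fexp (M ⊗ Dn q) M ⊗ Dn 1).

Let s1 := smooth_compose (smapP (rep xi1)) (whom_axiom_smooth (@fst_coord_whom R)).
Let s2 := smooth_compose (smapP (rep xi2)) (whom_axiom_smooth (@snd_coord_whom R)).

Lemma otstarE : otstar xi1 xi2 =
  cls (Dn 2) (fun x => tstar (rep xi1 (fst_coord x)) (rep xi2 (snd_coord x))).
Proof.
have sT := tstar_smooth wM (@fst_smooth R (fexp (M ⊗ Dn p) M) (fexp (M ⊗ Dn q) M))
  (@snd_smooth R (fexp (M ⊗ Dn p) M) (fexp (M ⊗ Dn q) M)).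
have E := pairing_cls s1 s2; apply: etrans (congr1 _ E) _.
exact: (fmap_cls sT (pair_smooth s1 s2)).
Qed.

Lemma ostarE : ostar xi1 xi2 =
  cls (Dn 2) (fun x => star (rep xi1 (fst_coord x)) (rep xi2 (snd_coord x))).
Proof.
have sT := star_smooth wM (@fst_smooth R (fexp (M ⊗ Dn p) M) (fexp (M ⊗ Dn q) M))
  (@snd_smooth R (fexp (M ⊗ Dn p) M) (fexp (M ⊗ Dn q) M)).
have E := pairing_cls s1 s2; apply: etrans (congr1 _ E) _.
exact: (fmap_cls sT (pair_smooth s1 s2)).
Qed.

Lemma bismooth_tstar r (theta : Csm (M ⊗ Dn r)) u :
  bismooth (fun s t => tstar (rep xi1 (vec [:: s]))
    (tstar (rep xi2 (vec [:: t])) (theta : fexp _ (fline R))) u : R).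
Proof.
have sK : is_smooth (fun x : feuclid R 2 => tstar (rep xi1 (fst_coord x))
    (tstar (rep xi2 (snd_coord x)) (theta : fexp _ (fline R))) u).
  apply: (smooth_eval (tstar_smooth wM s1 _) (@cst_smooth R _ _ u)).
  exact: (tstar_smooth wM s2 (@cst_smooth R _ _ (theta : fexp (M ⊗ Dn r) (fline R)))).
apply: eq_ind (@Csm2_bismooth R (SMap sK)) _ _.
apply/funext => s; apply/funext => t.
rewrite -[LHS]/(tstar (rep xi1 (fst_coord (vec [:: s; t])))
  (tstar (rep xi2 (snd_coord (vec [:: s; t]))) (theta : fexp _ (fline R))) u).
by have [-> ->] := coord_vec2 s t.
Qed.

Hypotheses (icon1 : is_icon xi1) (icon2 : is_icon xi2).

Lemma ostar_otstar_D2 :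
  pull (Dn 2) (D2 R) id (otstar xi1 xi2) = pull (Dn 2) (D2 R) id (ostar xi1 xi2).
Proof.
have sT := tstar_smooth wM s1 s2; have sS := star_smooth wM s1 s2.
rewrite otstarE ostarE; apply: (D2_agree sT sS) => d.
  have [-> -> _ _] := coord_axes d.
  rewrite -[rep xi2 0]/(foot xi2) icon2; exact: tstar_delta_r.
have [_ _ -> ->] := coord_axes d.
rewrite -[rep xi1 0]/(foot xi1) icon1; exact: tstar_delta_l.
Qed.

Lemma Lbracket_icon : is_icon (Lbracket xi1 xi2).
Proof.
have f0 := whom_axiom_map0 (@fst_coord_whom R); have s0 := whom_axiom_map0 (@snd_coord_whom R).
have [E _] := strong_diff_dcoef microM wM 0 ostar_otstar_D2.
rewrite /is_icon /Lbracket E otstarE (foot_cls (tstar_smooth wM s1 s2)) f0 s0.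
by rewrite -[rep xi1 0]/(foot xi1) -[rep xi2 0]/(foot xi2) icon1 icon2 tstar_delta.
Qed.

Lemma Lie_hat_Lie_hat r (theta : Csm (M ⊗ Dn r)) u :
  Lie_hat xi1 (Lie_hat xi2 theta) u =
  mixed (fun s t => tstar (rep xi1 (vec [:: s]))
    (tstar (rep xi2 (vec [:: t])) (theta : fexp _ (fline R))) u : R) :> R.
Proof.
rewrite Lie_hatE /dcoef /mixed; congr (derive1 _ 0); apply/funext => s.
apply: etrans (tstarE wM _ (Lie_hat xi2 theta : fexp _ (fline R)) u) _.
apply: etrans (Lie_hatE _ _ _) _; congr (derive1 _ 0); apply/funext => t.
exact: (esym (tstarE wM _ (tstar (rep xi2 (vec [:: t])) (theta : fexp _ (fline R))) u)).
Qed.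

End Bracket.

(** In [M ⊗ Dn (p + q)] the coordinates of [star eta1 eta2] are those of
    [tstar eta2 eta1], with the two blocks exchanged. The difference of the mixed
    derivatives of the two composites is therefore a commutator of operators. *)
Lemma Lie_hat_Lbracket p q r (xi1 : fexp (M ⊗ Dn p) M ⊗ Dn 1)
    (xi2 : fexp (M ⊗ Dn q) M ⊗ Dn 1) (theta : Csm (M ⊗ Dn r)) u :
  is_icon xi1 -> is_icon xi2 ->
  Lie_hat (Lbracket xi1 xi2) theta u =
  (Lie_hat xi1 (Lie_hat xi2 theta) (reindex (cast_ord (esym (addnA p q r))) u) : R) -
  Lie_hat xi2 (Lie_hat xi1 theta) (reindex (cast_ord (esym (addnA q p r)))
    (reindex (extend_l r (block_swap p q)) u)) :> R.
Proof.
move=> icon1 icon2; rewrite Lie_hatE.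
have [_ ->] := strong_diff_dcoef microM wM (tstar_at theta u) (ostar_otstar_D2 icon1 icon2).
have s1 := smooth_compose (smapP (rep xi1)) (whom_axiom_smooth (@fst_coord_whom R)).
have s2 := smooth_compose (smapP (rep xi2)) (whom_axiom_smooth (@snd_coord_whom R)).
have Et : mixed_coef (tstar_at theta u) (otstar xi1 xi2) = Lie_hat xi1 (Lie_hat xi2 theta)
    (reindex (cast_ord (esym (addnA p q r))) u).
  rewrite otstarE Lie_hat_Lie_hat.
  apply: etrans (@mixed_coef_cls R _ (tstar_at theta u) _ (tstar_smooth wM s1 s2)) _.
  congr mixed; apply/funext => s; apply/funext => t; have [-> ->] := coord_vec2 s t.
  exact: (tstarA (rep xi1 (vec [:: s])) (rep xi2 (vec [:: t])) (theta : fexp _ (fline R)) u).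
have Es : mixed_coef (tstar_at theta u) (ostar xi1 xi2) = Lie_hat xi2 (Lie_hat xi1 theta)
    (reindex (cast_ord (esym (addnA q p r))) (reindex (extend_l r (block_swap p q)) u)).
  rewrite ostarE Lie_hat_Lie_hat -(mixedC (@bismooth_tstar q p xi2 xi1 r theta _)).
  apply: etrans (@mixed_coef_cls R _ (tstar_at theta u) _ (star_smooth wM s1 s2)) _.
  congr mixed; apply/funext => s; apply/funext => t; have [-> ->] := coord_vec2 s t.
  apply: etrans (tstarA (rep xi2 (vec [:: t])) (rep xi1 (vec [:: s])) (theta : fexp _ (fline R)) _).
  apply: (@tstar_reindex_l (fline R) (p + q) (q + p) r (block_swap p q)) => v.
  exact: (starE wM).
by congr (_ - _); [exact: Et|exact: Es].
Qed.

End LieHat.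

Arguments extend_l {m n} r s i.
Arguments extend_r p {m n} s i.

(** * Permutations and alternation *)

Section Permutations.

(** A product of transpositions is transported along [f] factor by factor. *)
Lemma perm_extend m n (f : 'I_m -> 'I_n) (s : 'S_m) : injective f ->
  exists s' : 'S_n, [/\ forall x, s' (f x) = f (s x),
    forall y, (forall x, y != f x) -> s' y = y & odd_perm s' = odd_perm s].
Proof.
move=> f_inj; have [ts -> dts] := prod_tpermP s.
exists (\prod_(t <- ts) tperm (f t.1) (f t.2))%g; split.
- elim: ts {dts} => [|t ts IHts] x; first by rewrite !big_nil !perm1.
  by rewrite !big_cons !permM -inj_tperm// IHts.
- move=> y yf; elim: ts {dts} => [|t ts IHts]; first by rewrite big_nil perm1.
  by rewrite big_cons permM tpermD// eq_sym.
- rewrite (odd_perm_prod dts).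
  elim: ts dts => [|t ts IHts] /=; first by rewrite big_nil odd_perm1.
  by move=> /andP[dt dts]; rewrite big_cons odd_permM IHts// odd_tperm inj_eq// dt.
Qed.

(** A cyclic permutation of [n + 1] elements has the sign [(-1) ^ n]. *)
Lemma odd_rotation n q (t : 'S_n) : (forall i, t i = (i + q) %% n :> nat)%N ->
  odd_perm t = odd (q * n.-1).
Proof.
case: n t => [|n] t tE; first by rewrite muln0 (_ : t = 1%g) ?odd_perm1//; apply/permP; case.
pose c : 'S_n.+1 := lift_perm ord_max ord0 1%g.
have cE i : c i = (i.+1 %% n.+1)%N :> nat.
  case: (unliftP ord_max i) => [j ->|->]; last by rewrite lift_perm_id modnn.
  by rewrite lift_perm_lift perm1 lift0 /= /bump leqNgt ltn_ord add0n modn_small ?ltnS.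
have cX k i : (c ^+ k)%g i = ((i + k) %% n.+1)%N :> nat.
  elim: k i => [|k IHk] i; first by rewrite expg0 perm1 addn0 modn_small.
  by rewrite expgSr permM cE IHk -addn1 modnDml addn1 addnS.
have -> : t = (c ^+ q)%g by apply/permP => i; apply: ord_inj; rewrite tE cX.
have : odd_perm c = odd n by rewrite odd_lift_perm odd_perm1 /= addbF addbF.
elim: q {tE cX} => [|q IHq] oc; first by rewrite expg0 odd_perm1.
by rewrite expgS odd_permM oc IHq//= mulSn oddD.
Qed.

Lemma odd_block p q : odd (q * (p + q).-1) = odd (p * q).
Proof.
case: q => [|q]; first by rewrite muln0.
by rewrite addnS /= !oddM oddD /=; case: (odd p); case: (odd q).
Qed.

(** Exchanging two blocks of length [p] and [q] is a power of a cyclic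
    permutation, of sign [(-1) ^ (q * (p + q - 1)) = (-1) ^ (p * q)]. *)
Lemma block_swap_perm p q r : exists2 t : 'S_(p + q + r),
  odd_perm t = odd (p * q) & forall i,
  cast_ord (esym (addnA q p r)) (extend_l r (block_swap p q) i) =
  cast_ord (esym (etrans (addnCA q p r) (addnA p q r))) (t i).
Proof.
pose b i := cast_ord (addnC q p) (block_swap p q i).
have bE i : b i = ((i + q) %% (p + q))%N :> nat.
  rewrite /b /=; case: (split_ordP i) => j ->.
    by rewrite block_swap_lshift /= modn_small ?ltn_add2r// addnC.
  rewrite block_swap_rshift /= addnAC modnDl modn_small//.
  exact: leq_trans (ltn_ord j) (leq_addl _ _).
have b_inj : injective b.
  move=> i j /(congr1 val) /= ij; apply: ord_inj; move: ij; rewrite -[LHS]/(nat_of_ord (b i)).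
  rewrite -[RHS]/(nat_of_ord (b j)) !bE => /eqP; rewrite eqn_modDr => /eqP.
  by rewrite !modn_small.
have [t [tl tr ot]] := perm_extend (perm b_inj) (@lshift_inj (p + q) r).
exists t => [|i].
  rewrite ot (@odd_rotation _ q) => [|i]; last by rewrite permE bE.
  exact: odd_block.
apply: ord_inj => /=; case: (split_ordP i) => j ->.
  by rewrite extend_l_lshift tl permE.
rewrite extend_l_rshift tr => [/=|x]; first by rewrite (addnC q p).
by rewrite eq_sym eq_lrshift.
Qed.

End Permutations.

Section Alternation.
Variables (R : realType) (M : frolicher R).

Lemma permute_permute n (s t : 'S_n) (u : M ⊗ Dn n) :
  permute s (permute t u) = permute (t * s)%g u.
Proof.
apply: etrans (reindex_comp (X := M) t s u) _.
by congr (pull _ _ _ u); apply/funext => d; apply/rowP => j; rewrite !mxE permM.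
Qed.

Lemma permute_smooth n (s : 'S_n) : is_smooth (permute s : M ⊗ Dn n -> M ⊗ Dn n).
Proof. exact: (@reindex_smooth R M n n s). Qed.

Lemma precompE n (Y : frolicher R) (s : 'S_n) (eta : fexp (M ⊗ Dn n) Y) u :
  precomp (permute s) eta u = eta (permute s u).
Proof. by rewrite /precomp mk_smapE//; exact: (smooth_compose (smapP eta) (@permute_smooth n s)). Qed.

Lemma alt_funE n (theta : Csm (M ⊗ Dn n)) u :
  alt_fun theta u = \sum_(s : 'S_n) (-1) ^+ s * (theta (permute s u) : R) :> R.
Proof.
rewrite /alt_fun Csm_sumE; apply: eq_bigr => s _.
by rewrite CsmZE; congr (_ * _); exact: (@precompE n (fline R) s theta u).
Qed.

Lemma sum_sign_permute n (t : 'S_n) (theta : Csm (M ⊗ Dn n)) (u : M ⊗ Dn n) :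
  \sum_(s : 'S_n) (-1) ^+ s * (theta (permute t (permute s u)) : R) =
  (-1) ^+ t * (alt_fun theta u : R).
Proof.
rewrite alt_funE mulr_sumr [in RHS](reindex_inj (mulIg t)) /=; apply: eq_bigr => s _.
by rewrite permute_permute odd_permM addbC signr_addb -mulrA signrMK.
Qed.

(** Each [s] contributes the alternation of [theta0], since its sign occurs twice. *)
Lemma alt_fun_sum n N (e : 'S_n -> 'S_N) (k : R) (theta theta0 : Csm (M ⊗ Dn N)) :
  (forall s, odd_perm (e s) = odd_perm s) ->
  (forall u, theta u = k * \sum_(s : 'S_n) (-1) ^+ s * (theta0 (permute (e s) u) : R) :> R) ->
  forall u, alt_fun theta u = k * n`!%:R * alt_fun theta0 u :> R.
Proof.
move=> oe thetaE u; apply: etrans (alt_funE theta u) _.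
under eq_bigr => s _ do rewrite thetaE mulrCA mulr_sumr.
rewrite -mulr_sumr exchange_big /= -mulrA; congr (_ * _).
transitivity (\sum_(t : 'S_n) (alt_fun theta0 u : R)); last first.
  by rewrite sumr_const mulr_natl -[in RHS](card_Sn n).
apply: eq_bigr => t _; under eq_bigr => s _ do rewrite mulrCA.
by rewrite -mulr_sumr sum_sign_permute oe signrMK.
Qed.

Lemma reindex_id n (u : M ⊗ Dn n) (s : 'I_n -> 'I_n) : (forall i, s i = i) ->
  reindex s u = u.
Proof.
move=> sE; rewrite -[RHS]cls_rep /reindex /pull; congr cls; apply/funext => d /=.
by congr (rep u _); apply/rowP => i; rewrite mxE sE.
Qed.

Lemma ecastE m n (e : m = n) (theta : Csm (M ⊗ Dn m)) u :
  ecast n (Csm (M ⊗ Dn n)) e theta u = theta (reindex (cast_ord (esym e)) u).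
Proof. by case: n / e u => u; rewrite reindex_id// => i; apply: ord_inj. Qed.

Lemma alt_fun_cast m n (e : m = n) (theta : Csm (M ⊗ Dn m)) :
  ecast n (Csm (M ⊗ Dn n)) e (alt_fun theta) = alt_fun (ecast n (Csm (M ⊗ Dn n)) e theta).
Proof. by case: n / e. Qed.

End Alternation.

(** * The Frölicher-Nijenhuis bracket *)

Section Conclusion.
Variables (R : realType) (M : frolicher R).
Hypotheses (microM : microlinear M) (wM : weil_exponentiable M).

Lemma reindex_ext m n (s s' : 'I_m -> 'I_n) (u : M ⊗ Dn m) : (forall i, s i = s' i) ->
  reindex s u = reindex s' u.
Proof.
move=> ss; congr (pull _ _ _ u); apply/funext => d; apply/rowP => j.
by rewrite !mxE ss.
Qed.

Lemma dcoef_sum (X : frolicher R) (I : finType) (k : I -> R) (h : I -> Csm X) (H : Csm X)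
    (t : X ⊗ Dn 1) : (forall x, H x = \sum_i k i * (h i x : R) :> R) ->
  dcoef H t = \sum_i k i * dcoef (h i) t.
Proof.
move=> HE; have st := smapP (rep t).
rewrite -{1}[t]cls_rep; apply: (@dcoef_mod R X H _ (\sum_i k i * (h i (rep t 0) : R)) _ st).
have := @in_ideal_sum R (Dn 1) I (index_enum I) _
  (fun i => in_ideal_cstM (k i) (expand1 (Csm_comp (h i) (rep t)))).
apply: in_ideal_ext => x; rewrite HE mulr_suml -big_split -sumrB /=.
by apply: eq_bigr => i _; rewrite /dcoef /=; ring.
Qed.

Lemma precomp_smooth n (Y : frolicher R) (s : 'S_n) :
  is_smooth (fun eta : fexp (M ⊗ Dn n) Y => precomp (permute s) eta).
Proof.
apply: smooth_curry.
have s1 := @fst_smooth R (fexp (M ⊗ Dn n) Y) (M ⊗ Dn n).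
have s2 := @snd_smooth R (fexp (M ⊗ Dn n) Y) (M ⊗ Dn n).
apply: (is_smooth_ext _ (smooth_eval s1 (smooth_compose (@permute_smooth R M n s) s2))) => z.
exact: (esym (precompE s z.1 z.2)).
Qed.

Lemma precomp_delta n (s : 'S_n) : precomp (permute s) (delta M n) = delta M n.
Proof.
apply: smap_eq; apply/funext => u; rewrite precompE /delta mk_smapE; last exact: foot_Dn_smooth.
exact: (foot_pull u (@reindex_whom R n n s)).
Qed.

(** The sum in [alt_icon] is taken over tangent vectors at [delta M n], since
    foot points are invariant under permutations. *)
Lemma alt_icon_spec n (xi : fexp (M ⊗ Dn n) M ⊗ Dn 1) (h : Csm (fexp (M ⊗ Dn n) M)) :
  is_icon xi -> is_icon (alt_icon xi) /\ dcoef h (alt_icon xi) =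
    \sum_(s : 'S_n) (-1) ^+ s * dcoef h (fmap (precomp (permute s)) xi).
Proof.
move=> icon.
pose P (t : fexp (M ⊗ Dn n) M ⊗ Dn 1) (y : R) := foot t = delta M n /\ dcoef h t = y.
apply: (big_rec2 P) => [|s t y _ [ft <-]]; rewrite /P.
  have sd := @cst_smooth R (feuclid R 1) (fexp (M ⊗ Dn n) M) (delta M n).
  split; first exact: (foot_cls (W := Dn 1) sd).
  rewrite (dcoef_cls h sd); exact: derive1_cst.
have fs : foot (tscale ((-1) ^+ s) (fmap (precomp (permute s)) xi)) = delta M n.
  rewrite foot_tscale (foot_fmap xi (@precomp_smooth n M s)).
  by rewrite icon precomp_delta.
have [f1 d1] := tadd_dcoef microM wM h (etrans fs (esym ft)).
split; first exact: etrans f1 fs.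
apply: etrans d1 (congr1 (fun a : R => a + dcoef h t) _).
exact: (dcoef_scale h ((-1) ^+ s) (fmap (precomp (permute s)) xi)).
Qed.

Lemma Lie_hat_permute n r (s : 'S_n) (xi : fexp (M ⊗ Dn n) M ⊗ Dn 1)
    (theta : Csm (M ⊗ Dn r)) u :
  Lie_hat (fmap (precomp (permute s)) xi) theta u =
  Lie_hat xi theta (reindex (extend_l r s) u).
Proof.
apply: etrans (Lie_hatE wM (fmap (precomp (permute s)) xi) theta u) _.
apply: etrans _ (esym (Lie_hatE wM xi theta (reindex (extend_l r s) u))).
apply: etrans (dcoef_fmap (tstar_at wM theta u) xi (@precomp_smooth n M s)) _.
congr (dcoef _ xi); apply: Csm_eq => eta.
apply: (@tstar_reindex_l R M wM (fline R) n n r s eta (precomp (permute s) eta)) => v.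
exact: precompE.
Qed.

Lemma Lie_hat_alt_l p q r (xi : fexp (M ⊗ Dn (p + q)) M ⊗ Dn 1)
    (theta : Csm (M ⊗ Dn r)) u : is_icon xi ->
  Lie_hat (alt_icon_pq xi) theta u = (p`!%:R * q`!%:R)^-1 *
    \sum_(s : 'S_(p + q)) (-1) ^+ s * (Lie_hat xi theta (reindex (extend_l r s) u) : R) :> R.
Proof.
move=> icon; apply: etrans (Lie_hatE wM (alt_icon_pq xi) theta u) _.
rewrite dcoef_scale; have [_ ->] := alt_icon_spec (tstar_at wM theta u) icon.
congr (_ * _); apply: eq_bigr => s _; congr (_ * _).
apply: etrans (esym (Lie_hatE wM (fmap (precomp (permute s)) xi) theta u)) _.
exact: Lie_hat_permute.
Qed.

Lemma Lie_hat_alt_r p q r (xi : fexp (M ⊗ Dn p) M ⊗ Dn 1)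
    (theta : Csm (M ⊗ Dn (q + r))) u :
  Lie_hat xi (alt_fun_pq theta) u = (q`!%:R * r`!%:R)^-1 *
    \sum_(s : 'S_(q + r)) (-1) ^+ s * (Lie_hat xi theta (reindex (extend_r p s) u) : R) :> R.
Proof.
pose h (s : 'S_(q + r)) := tstar_at wM theta (reindex (extend_r p s) u).
apply: etrans (Lie_hatE wM xi (alt_fun_pq theta) u) _.
pose k : R := (q`!%:R * r`!%:R)^-1.
have E (eta : fexp (M ⊗ Dn p) M) : tstar_at wM (alt_fun_pq theta) u eta =
    \sum_(s : 'S_(q + r)) k * (-1) ^+ s * (h s eta : R) :> R.
  apply: etrans (tstarE wM eta (alt_fun_pq theta : fexp _ (fline R)) u) _.
  set w := fmap eta _; rewrite -[LHS]/(k * (alt_fun theta w : R)) alt_funE mulr_sumr.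
  apply: eq_bigr => s _; rewrite -mulrA; congr (_ * (_ * _)).
  apply: etrans (esym (precompE s (theta : fexp _ (fline R)) w)) _.
  apply: etrans (esym (tstarE wM eta (precomp (permute s) (theta : fexp _ (fline R))) u)) _.
  apply: (@tstar_reindex_r R M wM (fline R) p (q + r) (q + r) s eta) => v.
  exact: precompE.
apply: etrans (dcoef_sum xi E) _; rewrite mulr_sumr; apply: eq_bigr => s _.
rewrite -mulrA; congr (_ * (_ * _)).
exact: (esym (Lie_hatE wM xi theta (reindex (extend_r p s) u))).
Qed.

Lemma permute_extend m n (f : 'I_m -> 'I_n) (ext : 'S_m -> 'I_n -> 'I_n) :
  injective f -> (forall s x, ext s (f x) = f (s x)) ->
  (forall s y, (forall x, y != f x) -> ext s y = y) ->
  exists2 e : 'S_m -> 'S_n, forall s, odd_perm (e s) = odd_perm s &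
    forall s (u : M ⊗ Dn n), reindex (ext s) u = permute (e s) u.
Proof.
move=> f_inj ext_f ext_id.
have /choice[e He] := fun s => perm_extend s f_inj.
exists e => [s|s u]; first by have [] := He s.
have [ef eid _] := He s; apply: reindex_ext => y.
have [[x ->]|yf] := pselect (exists x, y = f x); first by rewrite ext_f ef.
have {}yf x : y != f x by apply/eqP => yE; apply: yf; exists x.
by rewrite ext_id// eid.
Qed.

Lemma alt_Lie_hat_l p q r (xi : fexp (M ⊗ Dn (p + q)) M ⊗ Dn 1)
    (theta : Csm (M ⊗ Dn r)) u : is_icon xi ->
  alt_fun (Lie_hat (alt_icon_pq xi) theta) u =
  (p`!%:R * q`!%:R)^-1 * (p + q)`!%:R * alt_fun (Lie_hat xi theta) u :> R.
Proof.
move=> icon.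
have [||s y yl|e oe eE] := @permute_extend (p + q) (p + q + r) (@lshift (p + q) r)
  (fun s => extend_l r s).
- exact: lshift_inj.
- by move=> s x; exact: extend_l_lshift.
- case: (split_ordP y) yl => j -> yl; last exact: extend_l_rshift.
  by have := yl j; rewrite eqxx.
apply: (alt_fun_sum oe) => v; apply: etrans (Lie_hat_alt_l theta v icon) _.
by congr (_ * _); apply: eq_bigr => s _; rewrite eE.
Qed.

Lemma alt_Lie_hat_r p q r (xi : fexp (M ⊗ Dn p) M ⊗ Dn 1)
    (theta : Csm (M ⊗ Dn (q + r))) u :
  alt_fun (Lie_hat xi (alt_fun_pq theta)) u =
  (q`!%:R * r`!%:R)^-1 * (q + r)`!%:R * alt_fun (Lie_hat xi theta) u :> R.
Proof.
have [||s y yl|e oe eE] := @permute_extend (q + r) (p + (q + r)) (@rshift p (q + r))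
  (fun s => extend_r p s).
- exact: rshift_inj.
- by move=> s x; exact: extend_r_rshift.
- case: (split_ordP y) yl => j -> yl; first exact: extend_r_lshift.
  by have := yl j; rewrite eqxx.
apply: (alt_fun_sum oe) => v; apply: etrans (Lie_hat_alt_r xi theta v) _.
by congr (_ * _); apply: eq_bigr => s _; rewrite eE.
Qed.

Lemma fact_neq0 n : n`!%:R != 0 :> R.
Proof. by rewrite pnatr_eq0 -lt0n fact_gt0. Qed.

Lemma inv_cancel (a b c d : R) : a != 0 -> b != 0 -> c != 0 -> d != 0 ->
  (a * d)^-1 * ((b * c)^-1 * d) = (a * b * c)^-1.
Proof. by move=> a0 b0 c0 d0; field; rewrite a0 b0 c0 d0. Qed.

(** Composition of Lie derivations: the inner alternation is absorbed by the
    outer one. *)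
Lemma Lie_Lie p q r (xi1 : fexp (M ⊗ Dn p) M ⊗ Dn 1) (xi2 : fexp (M ⊗ Dn q) M ⊗ Dn 1)
    (theta : Csm (M ⊗ Dn r)) :
  Lie xi1 (Lie xi2 theta) =
  (p`!%:R * q`!%:R * r`!%:R)^-1 *: alt_fun (Lie_hat xi1 (Lie_hat xi2 theta)).
Proof.
apply: Csm_eq => u; apply: etrans _ (esym (CsmZE _ _ u)).
apply: etrans (congr1 (fun a : R => (p`!%:R * (q + r)`!%:R)^-1 * a)
  (alt_Lie_hat_r xi1 (Lie_hat xi2 theta) u)) _.
move: (alt_fun _ u : R) => a; rewrite mulrA; congr (_ * a).
exact: inv_cancel (fact_neq0 p) (fact_neq0 q) (fact_neq0 r) (fact_neq0 (q + r)).
Qed.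

Lemma Lie_FNbracket p q r (xi1 : fexp (M ⊗ Dn p) M ⊗ Dn 1)
    (xi2 : fexp (M ⊗ Dn q) M ⊗ Dn 1) (theta : Csm (M ⊗ Dn r)) :
  is_icon xi1 -> is_icon xi2 ->
  Lie (FNbracket xi1 xi2) theta =
  (p`!%:R * q`!%:R * r`!%:R)^-1 *: alt_fun (Lie_hat (Lbracket xi1 xi2) theta).
Proof.
move=> icon1 icon2; apply: Csm_eq => u; apply: etrans _ (esym (CsmZE _ _ u)).
apply: etrans (congr1 (fun a : R => ((p + q)`!%:R * r`!%:R)^-1 * a)
  (alt_Lie_hat_l theta u (Lbracket_icon microM wM icon1 icon2))) _.
move: (alt_fun _ u : R) => a; rewrite mulrA [(_ * r`!%:R)%R]mulrC; congr (_ * a).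
apply: etrans (inv_cancel (fact_neq0 r) (fact_neq0 p) (fact_neq0 q) (fact_neq0 (p + q))) _.
by rewrite -mulrA mulrC.
Qed.

Lemma ecastZ m n (e : m = n) (k : R) (theta : Csm (M ⊗ Dn m)) :
  ecast n (Csm (M ⊗ Dn n)) e (k *: theta) = k *: ecast n (Csm (M ⊗ Dn n)) e theta.
Proof. by case: n / e. Qed.

Lemma alt_fun_sub n (t : 'S_n) (theta theta1 theta2 : Csm (M ⊗ Dn n)) :
  (forall v, theta v = (theta1 v : R) - theta2 (permute t v) :> R) ->
  alt_fun theta = alt_fun theta1 - (-1) ^+ t *: alt_fun theta2.
Proof.
move=> E; apply: Csm_eq => u; apply: etrans (alt_funE theta u) _.
under eq_bigr => s _ do rewrite E mulrBr.
rewrite sumrB sum_sign_permute -alt_funE.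
by apply: etrans _ (esym (CsmBE _ _ u)).
Qed.

(** The exchange of the first two blocks of coordinates contributes the sign of
    the graded commutator. *)
Lemma alt_Lie_hat_Lbracket p q r (xi1 : fexp (M ⊗ Dn p) M ⊗ Dn 1)
    (xi2 : fexp (M ⊗ Dn q) M ⊗ Dn 1) (theta : Csm (M ⊗ Dn r)) :
  is_icon xi1 -> is_icon xi2 ->
  alt_fun (Lie_hat (Lbracket xi1 xi2) theta) =
  alt_fun (ecast n (Csm (M ⊗ Dn n)) (addnA p q r) (Lie_hat xi1 (Lie_hat xi2 theta))) -
  (-1) ^+ (p * q) *: alt_fun (ecast n (Csm (M ⊗ Dn n))
    (etrans (addnCA q p r) (addnA p q r)) (Lie_hat xi2 (Lie_hat xi1 theta))).
Proof.
move=> icon1 icon2; have [t ot tE] := block_swap_perm p q r.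
rewrite -signr_odd -ot; apply: alt_fun_sub => v.
apply: etrans (Lie_hat_Lbracket microM wM theta v icon1 icon2) _; congr (_ - _).
  exact: (esym (ecastE (addnA p q r) (Lie_hat xi1 (Lie_hat xi2 theta)) v)).
apply: etrans _ (esym (ecastE _ (Lie_hat xi2 (Lie_hat xi1 theta)) (permute t v))).
congr (Lie_hat xi2 (Lie_hat xi1 theta) _).
apply: etrans (reindex_comp _ _ _) (etrans _ (esym (reindex_comp (X := M) t _ v))).
exact: reindex_ext.
Qed.

End Conclusion.

Theorem theorem77 (R : realType) (M : frolicher R)
    (microM : microlinear M) (wexpM : weil_exponentiable M)
    (p q : nat)
    (xi1 : fexp (M ⊗ Dn p) M ⊗ Dn 1) (xi2 : fexp (M ⊗ Dn q) M ⊗ Dn 1)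
    (semi1 : is_semiform xi1) (semi2 : is_semiform xi2) :
  forall (r : nat) (theta : Csm (M ⊗ Dn r)), is_form theta ->
    Lie (FNbracket xi1 xi2) theta = graded_comm (Lie xi1) (Lie xi2) theta.
Proof.
move=> r theta _; have [icon1 _] := semi1; have [icon2 _] := semi2.
rewrite (Lie_FNbracket microM wexpM theta icon1 icon2) /graded_comm.
rewrite (Lie_Lie wexpM xi1 xi2) (Lie_Lie wexpM xi2 xi1).
rewrite (alt_Lie_hat_Lbracket microM wexpM theta icon1 icon2) !ecastZ !alt_fun_cast scalerBr.
rewrite [(q`!%:R * p`!%:R)%R]mulrC; congr (_ - _).
by rewrite [LHS]scalerA [RHS]scalerA; congr (_ *: _); exact: mulrC.
Qed.
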